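(* Let $\Omega\subset\mathbb{R}^n$ be a nonempty open set, $M=(M_p)_{p\in\mathbb{Z}_+}$ a weight sequence as in the context, and $f\in\mathcal{G}(\Omega)$. Then: 1) The projection of $WF_{\mathcal{A}}^{M}(f)$ on $\Omega$ is $\mathrm{singsupp}_{M,\mathcal{A}}(f)$. 2) If $f\in\mathcal{G}_C(\Omega)$, then the projection of $WF_{\mathcal{A}}^{M}(f)$ on $\mathbb{R}^n\setminus\{0\}$ is $\sum_{\mathcal{A}}^{M}(f)$. 3) $WF_{\mathcal{A}}^{M}(\partial^\alpha f)\subset WF_{\mathcal{A}}^{M}(f)$ for all $\alpha\in\mathbb{Z}_+^n$. 4) $WF_{\mathcal{A}}^{M}(gf)\subset WF_{\mathcal{A}}^{M}(f)$ for all $g\in\mathcal{G}^{M,\mathcal{A}}(\Omega)$.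
   Context: $\mathbb{Z}_+=\{0,1,2,\dots\}$, $\mathbb{R}_+=[0,\infty)$, $\mathcal{F}$ is the Fourier transform. Colombeau algebra: $\mathcal{X}(\Omega)$ is the set of families $(u_\varepsilon)_\varepsilon\in C^\infty(\Omega)^{]0,1]}$ such that for every compact $K\subset\Omega$ and every $\alpha\in\mathbb{Z}_+^n$ there are $m\in\mathbb{Z}_+$, $C>0$, $\eta\in\,]0,1]$ with $\sup_{K}|\partial^\alpha u_\varepsilon|\le C\varepsilon^{-m}$ for all $\varepsilon\in\,]0,\eta]$. $\mathcal{N}(\Omega)$ is the set of $(u_\varepsilon)_\varepsilon\in\mathcal{X}(\Omega)$ such that for every compact $K\subset\Omega$, every $\alpha$ and every $m\in\mathbb{Z}_+$ there are $C>0$, $\eta\in\,]0,1]$ with $\sup_{K}|\partial^\alpha u_\varepsilon|\le C\varepsilon^{m}$ for all $\varepsilon\in\,]0,\eta]$. $\mathcal{G}(\Omega)=\mathcal{X}(\Omega)/\mathcal{N}(\Omega)$. $\mathcal{G}_C(\Omega)$ is the subalgebra of those $f\in\mathcal{G}(\Omega)$ having a representative $(f_\varepsilon)_\varepsilon$ and a compact $K\subset\Omega$ with $\mathrm{supp}f_\varepsilon\subset K$ for all $\varepsilon$; such a representative is called compactly supported. Weight sequence: positive numbers $(M_p)_{p\in\mathbb{Z}_+}$ with $M_0=1$, (H1) $M_p^2\le M_{p-1}M_{p+1}$ for $p\ge1$, (H2) there are $A,H>0$ with $M_p\le AH^pM_qM_{p-q}$ for all $p\ge q$, (H3)$'$ $\sum_{p\ge1}M_{p-1}/M_p<\infty$.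 Associated function: $\widetilde M(t)=\sup_p\ln(t^p/M_p)$ for $t>0$, $\widetilde M(0)=0$. $\mathcal{E}^M(\Omega)$ is the space of $f\in C^\infty(\Omega)$ such that for every compact $K\subset\Omega$ there is $c>0$ with $\sup_K|\partial^\alpha f|\le c^{|\alpha|+1}M_{|\alpha|}$ for all $\alpha$; $\mathcal{D}^M(\Omega)$ is the space of compactly supported elements of $\mathcal{E}^M(\Omega)$. $\mathcal{A}$ is the set of sequences $(N_m)_{m}\in\mathbb{R}_+^{\mathbb{Z}_+}$ for which there are $a,b\ge0$ with $N_m\le am+b$ for all $m$. $\mathcal{X}^{M,\mathcal{A}}(\Omega)$ is the set of $(f_\varepsilon)_\varepsilon\in C^\infty(\Omega)^{]0,1]}$ such that for every compact $K\subset\Omega$ there are $N\in\mathcal{A}$, $C>0$, $\varepsilon_0\in\,]0,1]$ with $\sup_{K}|\partial^\alpha f_\varepsilon|\le C^{|\alpha|+1}M_{|\alpha|}\varepsilon^{-N_{|\alpha|}}$ for all $\alpha\in\mathbb{Z}_+^n$, $\varepsilon\le\varepsilon_0$. $\mathcal{G}^{M,\mathcal{A}}(\Omega)=\mathcal{X}^{M,\mathcal{A}}(\Omega)/(\mathcal{N}(\Omega)\cap\mathcal{X}^{M,\mathcal{A}}(\Omega))\subset\mathcal{G}(\Omega)$. $\mathrm{singsupp}_{M,\mathcal{A}}(f)$ is the complement in $\Omega$ of the largest open $\Omega'\subset\Omega$ with $f|_{\Omega'}\in\mathcal{G}^{M,\mathcal{A}}(\Omega')$. For $f\in\mathcal{G}_C(\Omega)$,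 $\sum_{\mathcal{A}}^{M}(f)\subset\mathbb{R}^n\setminus\{0\}$ is the complement of the set of points having an open conic neighborhood $\Gamma$ for which there are a compactly supported representative $(f_\varepsilon)_\varepsilon$ of $f$ and constants $a,b\ge0$, $C,k>0$, $\varepsilon_0\in\,]0,1]$ with $|\mathcal{F}(f_\varepsilon)(\xi)|\le C\varepsilon^{-b}\exp(-\widetilde M(k\varepsilon^a|\xi|))$ for all $\varepsilon\le\varepsilon_0$, $\xi\in\Gamma$. For $f\in\mathcal{G}(\Omega)$, $WF_{\mathcal{A}}^{M}(f)\subset\Omega\times(\mathbb{R}^n\setminus\{0\})$: $(x_0,\xi_0)\notin WF_{\mathcal{A}}^{M}(f)$ iff there is $\phi\in\mathcal{D}^M(\Omega)$, $\phi\equiv1$ on a neighborhood of $x_0$, with $\xi_0\notin\sum_{\mathcal{A}}^{M}(\phi f)$, i.e. there are an open conic neighborhood $\Gamma$ of $\xi_0$, a compactly supported representative $(h_\varepsilon)_\varepsilon$ of $\phi f$ and constants $a,b\ge0$, $C,k>0$, $\varepsilon_0\in\,]0,1]$ with $|\mathcal{F}(h_\varepsilon)(\xi)|\le C\varepsilon^{-b}\exp(-\widetilde M(k\varepsilon^a|\xi|))$ for all $\varepsilon\le\varepsilon_0$, $\xi\in\Gamma$. *)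

(* Defs.v *)
(* R is an arbitrary realType, points of R^n are row vectors 'rV[R]_n, and
   complex numbers are elements of R[i]. *)
From HB Require Import structures.
From mathcomp Require Import all_boot all_order all_algebra.
From mathcomp Require Import complex.
From mathcomp Require Import all_classical all_reals all_analysis.

Set Implicit Arguments.
Unset Strict Implicit.
Unset Printing Implicit Defensive.

Import Order.TTheory GRing.Theory Num.Theory.
Import numFieldNormedType.Exports.

Local Open Scope classical_set_scope.
Local Open Scope ring_scope.

Section Smooth.
Variables (R : realType) (n : nat).
Local Notation V := 'rV[R]_n.
Local Notation C := R[i].
Implicit Types (Omega : set V) (alpha : {ffun 'I_n -> nat}).

Definition pderiv (i : 'I_n) (f : V -> R) : V -> R :=
  fun x => 'D_(delta_mx 0 i : V) f x.

Fixpoint Ck (k : nat) Omega (f : V -> R) : Prop :=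
  (forall x, Omega x -> {for x, continuous f}) /\
  if k is k'.+1 then
    forall i : 'I_n,
      (forall x, Omega x -> derivable f x (delta_mx 0 i : V)) /\
      Ck k' Omega (pderiv i f)
  else True.

(* An element of C^oo(Omega) is represented by a total function, of which only
   the values on Omega matter. *)
Definition smooth Omega (f : V -> C) : Prop :=
  forall k, Ck k Omega (fun x => complex.Re (f x)) /\
            Ck k Omega (fun x => complex.Im (f x)).

Definition mlen alpha : nat := (\sum_i alpha i)%N.

Definition rpartial alpha (f : V -> R) : V -> R :=
  foldr (fun i g => iter (alpha i) (pderiv i) g) f (enum 'I_n).

Definition partial alpha (f : V -> C) : V -> C :=
  fun x => (rpartial alpha (fun y => complex.Re (f y)) x
            +i* rpartial alpha (fun y => complex.Im (f y)) x)%C.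

(* Since K is compact, hence closed in R^n, taking the closure in R^n rather
   than in Omega is immaterial. *)
Definition supp_in Omega (K : set V) (f : V -> C) : Prop :=
  closure [set x | Omega x /\ f x != 0] `<=` K.

End Smooth.

Section Fourier.
Variable R : realType.

(* A sigma-finite measure space whose points are read as vectors of R^n. *)
Record vec_space (n : nat) := VecSpace {
  vs_disp : measure_display ;
  vs_car : measurableType vs_disp ;
  vs_mu : {sigma_finite_measure set vs_car -> \bar R} ;
  vs_row : vs_car -> 'rV[R]_n }.

(* Through canonical inference the library provides the product of sigma-finite
   measures only as a measure, hence this packaging. *)
Section ProdMeasure.
Context d1 d2 (T1 : measurableType d1) (T2 : measurableType d2).
Variables (m1 : {sigma_finite_measure set T1 -> \bar R})
          (m2 : {sigma_finite_measure set T2 -> \bar R}).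

Lemma prod_sigma_finite : sigma_finite setT (m1 \x m2)%E.
Proof.
have /sigma_finiteP[F [TF ndF Foo]] := sigma_finiteT m1.
have /sigma_finiteP[G [TG ndG Goo]] := sigma_finiteT m2.
exists (fun n => F n `*` G n).
  rewrite -setXTT TF TG predeqE => -[x y]; split.
    move=> [/= [n _ Fnx] [k _ Gky]]; exists (maxn n k) => //; split.
    - by move: x Fnx; exact/subsetPset/ndF/leq_maxl.
    - by move: y Gky; exact/subsetPset/ndG/leq_maxr.
  by move=> [n _ []/= ? ?]; split; exists n.
move=> k; have [? ?] := Foo k; have [? ?] := Goo k.
split; first exact: measurableX.
by rewrite product_measure1E// lte_mul_pinfty// ge0_fin_numE.
Qed.

Definition prod_measure : {sigma_finite_measure set (T1 * T2)%type -> \bar R} :=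
  HB.pack_for {sigma_finite_measure set (T1 * T2)%type -> \bar R} (m1 \x m2)%E
    (Measure.on (m1 \x m2)%E)
    (Measure_isSigmaFinite.Build _ _ _ (m1 \x m2)%E prod_sigma_finite).

End ProdMeasure.

(* R * (R * (... * unit)) with the n-fold product of the Lebesgue measure,
   i.e. the n-dimensional Lebesgue measure. *)
Fixpoint lebesgue_space (n : nat) : vec_space n :=
  match n with
  | 0 => @VecSpace 0 _ unit (\d_tt) (fun=> 0)
  | m.+1 =>
    let S := lebesgue_space m in
    @VecSpace m.+1 _ (measurableTypeR R * vs_car S)%type
      (prod_measure (@lebesgue_measure R) (@vs_mu _ S))
      (fun p => row_mx (const_mx p.1 : 'rV[R]_1) (vs_row p.2) : 'rV[R]_(1 + m))
  end.

Definition integral_on (n : nat) (D : set 'rV[R]_n) (f : 'rV[R]_n -> R) : R :=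
  let S := lebesgue_space n in
  \int[@vs_mu _ S]_(p in [set p | D (vs_row p)]) f (vs_row p).

Definition dotv (n : nat) (x y : 'rV[R]_n) : R := \sum_i x 0 i * y 0 i.

(* The library norm on 'rV[R]_n is the max norm. *)
Definition enorm (n : nat) (x : 'rV[R]_n) : R := Num.sqrt (dotv x x).

(* int_Omega f(x) exp(-i x.xi) dx, i.e. the Fourier transform of the extension
   of f by 0 outside Omega. *)
Definition fourier (n : nat) (Omega : set 'rV[R]_n) (f : 'rV[R]_n -> R[i])
    (xi : 'rV[R]_n) : R[i] :=
  let g := fun x => f x * (cos (dotv x xi) -i* sin (dotv x xi))%C in
  (integral_on Omega (fun x => complex.Re (g x))
   +i* integral_on Omega (fun x => complex.Im (g x)))%C.

End Fourier.

Section Weights.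
Variable R : realType.
Implicit Type M : nat -> R.

Definition weight_sequence M : Prop :=
  [/\ (forall p, 0 < M p),
      M 0%N = 1,
      (forall p, (1 <= p)%N -> M p ^+ 2 <= M p.-1 * M p.+1),
      (exists A H : R, [/\ 0 < A, 0 < H &
        forall p q, (q <= p)%N -> M p <= A * H ^+ p * M q * M (p - q)%N]) &
      (\sum_(1 <= p <oo) (M p.-1 / M p)%:E < +oo)%E].

Definition assoc_fun M (t : R) : R :=
  if 0 < t then sup (range (fun p => ln (t ^+ p / M p))) else 0.

Definition at_most_affine (N : nat -> R) : Prop :=
  (forall m, 0 <= N m) /\
  exists a b : R, [/\ 0 <= a, 0 <= b & forall m, N m <= a * m%:R + b].

End Weights.

Section Colombeau.
Variables (R : realType) (n : nat).
Local Notation V := 'rV[R]_n.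
Local Notation C := R[i].

(* A net (u_eps), of which only the values at eps in ]0,1] matter. *)
Definition net := R -> V -> C.

Implicit Types (Omega W K : set V) (M : nat -> R) (u v w : net).

Definition smooth_net Omega u : Prop :=
  forall eps, 0 < eps <= 1 -> smooth Omega (u eps).

Definition moderate Omega : set net :=
  [set u | smooth_net Omega u /\
    forall K (alpha : {ffun 'I_n -> nat}), compact K -> K `<=` Omega ->
    exists (m : nat) (c eta : R), [/\ 0 < c, 0 < eta <= 1 &
      forall eps, 0 < eps <= eta -> forall x, K x ->
        Normc.normc (partial alpha (u eps) x) <= c * eps ^- m]].

Definition negligible Omega : set net :=
  [set u | moderate Omega u /\
    forall K (alpha : {ffun 'I_n -> nat}) (m : nat),
    compact K -> K `<=` Omega ->
    exists c eta : R, [/\ 0 < c, 0 < eta <= 1 &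
      forall eps, 0 < eps <= eta -> forall x, K x ->
        Normc.normc (partial alpha (u eps) x) <= c * eps ^+ m]].

Definition gclass Omega u : set net :=
  [set v | moderate Omega v /\
           negligible Omega (fun eps x => v eps x - u eps x)].

(* G(Omega) as the set of cosets of the negligible nets in the moderate nets. *)
Definition colombeau Omega : set (set net) := gclass Omega @` moderate Omega.

Definition compact_rep Omega (f : set net) u : Prop :=
  f u /\ exists K, [/\ compact K, K `<=` Omega &
    forall eps, 0 < eps <= 1 -> supp_in Omega K (u eps)].

Definition colombeau_c Omega : set (set net) :=
  [set f | colombeau Omega f /\ exists u, compact_rep Omega f u].

(* The operations are defined on representatives; the unions below run over
   one and the same coset. *)
Definition gmul Omega (g f : set net) : set net :=
  \bigcup_(v in g) \bigcup_(u in f) gclass Omega (fun eps x => v eps x * u eps x).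

Definition gpartial Omega (alpha : {ffun 'I_n -> nat}) (f : set net) : set net :=
  \bigcup_(u in f) gclass Omega (fun eps => partial alpha (u eps)).

Definition grestr W (f : set net) : set net := \bigcup_(u in f) gclass W u.

Definition gconst Omega (phi : V -> C) : set net := gclass Omega (fun=> phi).

Definition EM Omega M (phi : V -> C) : Prop :=
  smooth Omega phi /\
  forall K, compact K -> K `<=` Omega ->
  exists c : R, 0 < c /\
    forall (alpha : {ffun 'I_n -> nat}) x, K x ->
      Normc.normc (partial alpha phi x)
        <= c ^+ (mlen alpha).+1 * M (mlen alpha).

Definition DM Omega M (phi : V -> C) : Prop :=
  EM Omega M phi /\
  exists K, [/\ compact K, K `<=` Omega & supp_in Omega K phi].

Definition moderateMA Omega M : set net :=
  [set u | smooth_net Omega u /\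
    forall K, compact K -> K `<=` Omega ->
    exists (N : nat -> R) (c eps0 : R),
      [/\ at_most_affine N, 0 < c, 0 < eps0 <= 1 &
      forall (alpha : {ffun 'I_n -> nat}) eps, 0 < eps <= eps0 ->
      forall x, K x ->
        Normc.normc (partial alpha (u eps) x)
          <= c ^+ (mlen alpha).+1 * M (mlen alpha)
             * eps `^ (- N (mlen alpha))]].

(* As a subset of G(Omega). *)
Definition colombeauMA Omega M : set (set net) :=
  gclass Omega @` moderateMA Omega M.

Definition regular_open Omega M (f : set net) : set (set V) :=
  [set W | [/\ open W, W `<=` Omega & colombeauMA W M (grestr W f)]].

Definition is_largest (P : set (set V)) W : Prop :=
  P W /\ forall W', P W' -> W' `<=` W.

(* The default set0 is irrelevant as soon as a largest element exists. *)
Definition singsuppMA Omega M (f : set net) : set V :=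
  Omega `\` xget set0 (is_largest (regular_open Omega M f)).

Definition open_cone (Gamma : set V) : Prop :=
  open Gamma /\ forall (t : R) xi, 0 < t -> Gamma xi -> Gamma (t *: xi).

Definition SigmaMA Omega M (f : set net) : set V :=
  [set xi0 | xi0 != 0 /\
    ~ exists Gamma u (a b c k eps0 : R),
      [/\ open_cone Gamma, Gamma xi0, compact_rep Omega f u,
          [/\ 0 <= a, 0 <= b, 0 < c, 0 < k & 0 < eps0 <= 1] &
      forall eps xi, 0 < eps <= eps0 -> Gamma xi ->
        Normc.normc (fourier Omega (u eps) xi)
          <= c * eps `^ (- b)
             * expR (- assoc_fun M (k * eps `^ a * enorm xi))]].

Definition WFMA Omega M (f : set net) : set (V * V) :=
  [set p | [/\ Omega p.1, p.2 != 0 &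
    ~ exists phi : V -> C,
      [/\ DM Omega M phi, \forall x \near p.1, phi x = 1 &
          ~ SigmaMA Omega M (gmul Omega (gconst Omega phi) f) p.2]]].

End Colombeau.

(* Main.v *)
Require Import Defs.
From HB Require Import structures.
From mathcomp Require Import all_boot all_order all_algebra.
From mathcomp Require Import complex.
From mathcomp Require Import all_classical all_reals all_analysis.
From mathcomp Require Import measurable_realfun zify ring lra.

(** Why the theorem is true. Throughout, [e] is the parameter of a net, and every constant is
    absorbed in a power of [1 / e]; by [assoc_le] the decay of a Fourier transform like the
    exponential of minus the associated function is the family of moment estimates
    [|xi|^p |F(xi)| <= e^-(d (p + 1)) M_p], for all [p].

    The key estimate is [dec_mul]: if the transform of a compactly supported moderate net [u]
    decays in an open cone, then so does the transform of [theta u] in smaller cones, for every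
    compactly supported regular net [theta]. The transform of the product is a convolution;
    a small frequency of [theta] does not leave the cone, and at a large one the transform of
    [theta] decays by itself. Convolutions and Fourier inversion are replaced by finite sums:
    [trig_approx] approximates a test function by trigonometric sums of its transform, namely
    its convolutions with powers of a cosine kernel, and [trig_sum_bound] bounds these sums
    uniformly in the number of frequencies.

    By the key estimate, a point [(x0, xi0)] is outside the wave front set if and only if there
    are a neighbourhood of [x0] and a cone around [xi0] in which the transform of [theta f]
    decays for every regular [theta] supported in the neighbourhood ([micro], [WF_micro]); the
    cut-offs come from the non-quasianalytic bumps of [bumpV]. In this form the two inclusions
    are short: a regular factor [g] is absorbed in [theta] ([micro_mul]), and a derivative
    multiplies the transform by a polynomial ([micro_wD]).

    For the projection on directions, a direction that is regular at every point of a compact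
    support is regular for the whole net, since finitely many cut-offs can be patched
    ([reg_dir_micro]). For the projection on [Omega], suppose that all directions are regular
    at [x0]. By compactness of the sphere one cut-off [chi] serves all of them, and the pieces
    of transforms make up one function [G] that decays in all directions and is close to the
    transform of [chi f] ([micro_all]). The trigonometric sums of [G], with a number of
    frequencies that grows fast enough as [e] tends to 0, form a regular net that represents
    [f] near [x0] ([synthesis], [regular_near]). Finally, the largest regular open set exists
    because regular representatives on different open sets, though not equal on the overlaps,
    can be glued by cut-offs ([regular_bigcup]). *)

Set Implicit Arguments.
Unset Strict Implicit.
Unset Printing Implicit Defensive.

Import Order.TTheory GRing.Theory Num.Theory.
Import numFieldNormedType.Exports.

Local Open Scope classical_set_scope.
Local Open Scope ring_scope.

(** * Real-valued smooth functions *)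

Lemma near_continuous (T U : topologicalType) (x : T) (f g : T -> U) :
  (\forall y \near x, f y = g y) ->
  {for x, continuous f} -> {for x, continuous g}.
Proof.
move=> fg cf; rewrite /prop_for /continuous_at -(@nbhs_singleton _ x _ fg).
by apply: cvg_trans cf; exact: near_eq_cvg.
Qed.

Section RealSmooth.
Variables (R : realType) (n : nat).
Local Notation V := 'rV[R]_n.
Implicit Types (W : set V) (f g : V -> R) (i : 'I_n) (k : nat).

Lemma Ck_sub k W W' f : W' `<=` W -> Ck k W f -> Ck k W' f.
Proof.
move=> WW; elim: k f => [|k IH] f [cf df]; split=> //.
- by move=> x /WW /cf.
- by move=> x /WW /cf.
- by move=> i; have [di dk] := df i; split => [x /WW /di|]//; exact: IH.
Qed.

(** The definition only asks for conditions at the points of [W], so that smoothness can be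
    checked at one point at a time. *)
Lemma Ck_ptw k W f : (forall x, W x -> Ck k [set x] f) -> Ck k W f.
Proof.
elim: k f => [|k IH] f H.
  by split=> // x /H [+ _]; apply.
split=> [x /H [+ _]|i]; first by apply.
by split=> [x /H [_ /(_ i) [+ _]]|]; [apply | apply: IH => x /H [_ /(_ i) []]].
Qed.

Lemma CkS k W f : Ck k.+1 W f -> Ck k W f.
Proof.
elim: k f => [|k IH] f [cf df]; split=> // i.
by have [di dk] := df i; split => //; apply: IH.
Qed.

Lemma near_pderiv (x : V) i f g : (\forall y \near x, f y = g y) ->
  \forall y \near x, pderiv i f y = pderiv i g y.
Proof.
move=> /near_join; apply: filterS => y fg; exact: near_eq_derive.
Qed.

Lemma Ck_near k (x : V) f g : (\forall y \near x, f y = g y) ->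
  Ck k [set x] f -> Ck k [set x] g.
Proof.
elim: k f g => [|k IH] f g fg [cf df].
  by split=> // y ->; exact: near_continuous fg (cf _ erefl).
split.
  by move=> y ->; exact: near_continuous fg (cf _ erefl).
move=> i; have [di dk] := df i; split.
  by move=> y ->; apply: near_eq_derivable fg (di _ erefl).
by apply: IH dk; exact: near_pderiv.
Qed.

Lemma Ck_eq k W f g : open W -> (forall x, W x -> f x = g x) ->
  Ck k W f -> Ck k W g.
Proof.
move=> oW fg Wf; apply: Ck_ptw => x Wx; apply: (@Ck_near _ _ f).
  by apply: filterS (open_nbhs_nbhs (conj oW Wx)) => y; exact: fg.
by apply: Ck_sub Wf => y ->.
Qed.

Lemma pderiv_eq W i f g : open W -> (forall x, W x -> f x = g x) ->
  forall x, W x -> pderiv i f x = pderiv i g x.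
Proof.
move=> oW fg x Wx; apply: near_eq_derive.
by apply: filterS (open_nbhs_nbhs (conj oW Wx)) => y; exact: fg.
Qed.

Lemma Ck_cst k W (c : R) : Ck k W (fun=> c).
Proof.
elim: k c => [|k IH] c; split => //; try by move=> x _; exact: cst_continuous.
move=> i; split=> [x _|]; first exact: derivable_cst.
suff -> : pderiv i (fun=> c) = (fun=> 0 : R) by exact: IH.
by apply/funext => x; rewrite /pderiv (derive_cst (c : R^o)).
Qed.

Lemma CkD k W f g : open W -> Ck k W f -> Ck k W g -> Ck k W (fun x => f x + g x).
Proof.
move=> oW; elim: k f g => [|k IH] f g [cf df] [cg dg].
  by split=> // x Wx; exact: (cvgD (cf x Wx) (cg x Wx)).
split=> [x Wx|i]; first by exact: (cvgD (cf x Wx) (cg x Wx)).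
have [[df1 df2] [dg1 dg2]] := (df i, dg i).
split=> [x Wx|]; first by apply: derivableD; [exact: df1|exact: dg1].
apply: (Ck_eq oW _ (IH _ _ df2 dg2)) => x Wx.
by rewrite /pderiv -deriveD //; [exact: df1|exact: dg1].
Qed.

Lemma CkM k W f g : open W -> Ck k W f -> Ck k W g -> Ck k W (fun x => f x * g x).
Proof.
move=> oW; elim: k f g => [|k IH] f g Cf Cg.
  have [[cf df] [cg dg]] := (Cf, Cg).
  by split=> // x Wx; exact: (cvgM (cf x Wx) (cg x Wx)).
have [[cf df] [cg dg]] := (Cf, Cg).
split=> [x Wx|i]; first by exact: (cvgM (cf x Wx) (cg x Wx)).
have [[df1 df2] [dg1 dg2]] := (df i, dg i).
split=> [x Wx|]; first by apply: derivableM; [exact: df1|exact: dg1].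
apply: (@Ck_eq _ _ (fun x => f x * pderiv i g x + g x * pderiv i f x)) => //.
  move=> x Wx; rewrite /pderiv deriveM //; [exact: df1|exact: dg1].
by apply: CkD => //; apply: IH => //; apply: CkS.
Qed.

Definition rsm W f := forall k, Ck k W f.

Lemma rsm_cont W f : rsm W f -> forall x, W x -> {for x, continuous f}.
Proof. by move=> /(_ 0%N) []. Qed.

Lemma rsm_der W f i : rsm W f -> forall x, W x -> derivable f x (delta_mx 0 i : V).
Proof. by move=> /(_ 1%N) [_ /(_ i)] []. Qed.

Lemma rsm_pderiv W f i : rsm W f -> rsm W (pderiv i f).
Proof. by move=> H k; have [_ /(_ i)] := H k.+1 => -[]. Qed.

Lemma rsmD W f g : open W -> rsm W f -> rsm W g -> rsm W (fun x => f x + g x).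
Proof. by move=> oW H1 H2 k; apply: CkD. Qed.

Lemma rsmM W f g : open W -> rsm W f -> rsm W g -> rsm W (fun x => f x * g x).
Proof. by move=> oW H1 H2 k; apply: CkM. Qed.

Lemma pderivD W f g i : rsm W f -> rsm W g ->
  forall x, W x -> pderiv i (fun x => f x + g x) x = pderiv i f x + pderiv i g x.
Proof. by move=> sf sg x Wx; rewrite /pderiv -deriveD //; apply: rsm_der Wx. Qed.

Lemma pderivN W f i : rsm W f ->
  forall x, W x -> pderiv i (fun x => - f x) x = - pderiv i f x.
Proof. by move=> sf x Wx; rewrite /pderiv -deriveN //; apply: rsm_der Wx. Qed.

Lemma rsmN W f : open W -> rsm W f -> rsm W (fun x => - f x).
Proof.
move=> oW sf k; apply: (@Ck_eq _ _ (fun x => -1 * f x)) => //.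
  by move=> x _; rewrite mulN1r.
by apply: CkM => //; exact: Ck_cst.
Qed.

Lemma pderivM W f g i : rsm W f -> rsm W g -> forall x, W x ->
  pderiv i (fun x => f x * g x) x = pderiv i f x * g x + f x * pderiv i g x.
Proof.
move=> sf sg x Wx; rewrite /pderiv deriveM //; try by apply: rsm_der Wx.
by rewrite addrC /GRing.scale /= mulrC.
Qed.

Lemma is_derive_line (f : V -> R) (x v : V) (s : R) :
  derivable f (s *: v + x) v ->
  is_derive s 1 (fun t : R => f (t *: v + x)) ('D_v f (s *: v + x)).
Proof.
move=> df; have := derivableP df => -[H1 H2].
have E : (fun h : R => h^-1 *: (((fun t : R => f (t *: v + x)) \o shift s) (h *: 1)
     - f (s *: v + x))) =
   (fun h => h^-1 *: ((f \o shift (s *: v + x)) (h *: v) - f (s *: v + x))).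
  apply/funext => h /=; congr (_ *: (f _ - _)).
  by rewrite [h *: 1]mulr1 scalerDl addrA.
by split; rewrite /derivable /derive E.
Qed.

Lemma MVT_line (f : V -> R) (x v : V) (h : R) : 0 < h ->
  (forall s : R, 0 <= s <= h -> derivable f (s *: v + x) v) ->
  exists2 c, 0 <= c <= h & f (h *: v + x) - f x = 'D_v f (c *: v + x) * h.
Proof.
move=> h0 df.
have D s : 0 <= s <= h -> is_derive s 1 (fun t : R => f (t *: v + x)) ('D_v f (s *: v + x)).
  by move=> /df; exact: is_derive_line.
have [||c cI E] := @MVT R (fun t => f (t *: v + x)) (fun s => 'D_v f (s *: v + x)) 0 h h0.
- by move=> s; rewrite in_itv /= => /andP[a b]; apply: D; rewrite !ltW.
- apply: derivable_within_continuous => s; rewrite in_itv /= => si.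
  by have [] := D s si.
exists c; first by move: cI; rewrite in_itv /= => /andP[a b]; rewrite !ltW.
by move: E; rewrite scale0r add0r subr0.
Qed.

Lemma norm_delta i : `|(delta_mx 0 i : V)| <= 1.
Proof.
rewrite /Num.norm /= mx_normrE; apply/bigmax_leP; split=> // -[a b] _ /=.
by rewrite mxE; case: eqP => _; case: eqP => _; rewrite ?normr0 ?normr1.
Qed.

Lemma derive_translate (f : V -> R) (c x v : V) :
  'D_v (fun y => f (c + y)) x = 'D_v f (c + x).
Proof.
rewrite /derive; set F := (X in lim (X @ _)); set G := (X in _ = lim (X @ _)).
suff -> : F = G by [].
by apply/funext => u; rewrite /F /G /= addrCA.
Qed.

Lemma derivable_translate (f : V -> R) (c x v : V) :
  derivable f (c + x) v -> derivable (fun y => f (c + y)) x v.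
Proof.
rewrite /derivable; set F := (X in cvg (X @ _)); set G := (X in _ -> cvg (X @ _)).
suff -> : F = G by [].
by apply/funext => u; rewrite /F /G /= addrCA.
Qed.

(** Two applications of the mean value theorem, first along [i] and then along [j]. *)
Lemma second_difference W f i j x : open W -> W x -> rsm W f ->
  exists2 r, 0 < r & forall h : R, 0 < h < r ->
  exists2 y : V, `|y - x| <= 2 * h &
   W y /\ pderiv i (pderiv j f) y =
   (f (h *: delta_mx 0 i + (h *: delta_mx 0 j + x)) - f (h *: delta_mx 0 i + x)
   - (f (h *: delta_mx 0 j + x) - f x)) / (h * h).
Proof.
move=> oW Wx sf.
have /nbhs_ballP[/= e e0 He] := open_nbhs_nbhs (conj oW Wx).
set ei : V := delta_mx 0 i; set ej : V := delta_mx 0 j.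
exists (e / 2); first by rewrite divr_gt0.
move=> h /andP[h0 hr].
have nb (s t : R) : 0 <= s <= h -> 0 <= t <= h -> `|s *: ei + t *: ej| <= 2 * h.
  move=> /andP[s0 sh] /andP[t0 th]; apply: (le_trans (ler_normD _ _)).
  rewrite !normrZ (ger0_norm s0) (ger0_norm t0) mulr_natl mulr2n.
  apply: lerD; rewrite -[leRHS]mulr1; apply: ler_pM => //; exact: norm_delta.
have inW (s t : R) : 0 <= s <= h -> 0 <= t <= h -> W (s *: ei + t *: ej + x).
  move=> s0 t0; apply: He; rewrite -ball_normE /=.
  rewrite opprD addrCA subrr addr0 normrN.
  by apply: le_lt_trans (nb _ _ s0 t0) _; move: hr; rewrite ltr_pdivlMr // mulrC.
have h0h : 0 <= h <= h by rewrite lexx ltW.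
have z0h : 0 <= (0:R) <= h by rewrite lexx ltW.
have [] := @MVT_line (fun y => f (h *: ei + y) - f y) x ej h h0.
  move=> s s0; apply: derivableB.
    apply: derivable_translate; rewrite addrA.
    exact: rsm_der (inW _ _ h0h s0).
  by have := inW _ _ z0h s0; rewrite scale0r add0r => HW; exact: (rsm_der sf).
move=> s s0 E.
have [] := @MVT_line (pderiv j f) (s *: ej + x) ei h h0.
  by move=> t t0; rewrite addrA; apply: rsm_der (inW _ _ t0 s0); exact: rsm_pderiv.
move=> t t0; rewrite addrA => E2.
exists (t *: ei + s *: ej + x); first by rewrite addrK; exact: nb.
split; first exact: inW.
have -> : pderiv i (pderiv j f) (t *: ei + s *: ej + x) =
    (pderiv j f (h *: ei + s *: ej + x) - pderiv j f (s *: ej + x)) / h.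
  by rewrite addrA in E2; rewrite E2 mulfK ?gt_eqF.
suff E3 : f (h *: ei + (h *: ej + x)) - f (h *: ei + x) - (f (h *: ej + x) - f x) =
    (pderiv j f (h *: ei + s *: ej + x) - pderiv j f (s *: ej + x)) * h.
  by rewrite E3 invfM mulrA mulfK ?gt_eqF.
have -> : pderiv j f (h *: ei + s *: ej + x) - pderiv j f (s *: ej + x) =
   'D_ej (fun y => f (h *: ei + y) - f y) (s *: ej + x); last first.
  by rewrite -E; move: (f _) (f _) (f _) (f _) => a b c d; ring.
rewrite deriveB.
- by rewrite derive_translate addrA.
- by apply: derivable_translate; rewrite addrA; exact: rsm_der (inW _ _ h0h s0).
- by have := inW _ _ z0h s0; rewrite scale0r add0r => HW; exact: (rsm_der sf).
Qed.

(** Both mixed derivatives are limits of the same second difference quotient,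
    which the mean value theorem evaluates in either order. *)
Lemma pderivC W f i j : open W -> rsm W f -> forall x, W x ->
  pderiv i (pderiv j f) x = pderiv j (pderiv i f) x.
Proof.
move=> oW sf x Wx; apply/eqP; rewrite -subr_eq0 -normr_le0.
apply/ler_addgt0Pl => e e0; rewrite addr0.
have c1 := rsm_cont (rsm_pderiv i (rsm_pderiv j sf)) Wx.
have c2 := rsm_cont (rsm_pderiv j (rsm_pderiv i sf)) Wx.
have e2 : 0 < e / 2 by rewrite divr_gt0.
have /nbhs_ballP[/= d1 d10 H1] : \forall y \near x,
   `|pderiv i (pderiv j f) x - pderiv i (pderiv j f) y| < e / 2.
  by move/cvgrPdist_lt: c1; apply.
have /nbhs_ballP[/= d2 d20 H2] : \forall y \near x,
   `|pderiv j (pderiv i f) x - pderiv j (pderiv i f) y| < e / 2.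
  by move/cvgrPdist_lt: c2; apply.
have [r1 r10 S1] := second_difference i j oW Wx sf.
have [r2 r20 S2] := second_difference j i oW Wx sf.
pose m := Num.min (Num.min r1 r2) (Num.min (d1 / 2) (d2 / 2)).
have m0 : 0 < m by rewrite !lt_min r10 r20 !divr_gt0.
pose h := m / 2.
have h0 : 0 < h by rewrite divr_gt0.
have hm : h < m by rewrite ltr_pdivrMr // ltr_pMr // ltr1n.
have [hr1 hr2 hd1 hd2] : [/\ h < r1, h < r2, 2 * h < d1 & 2 * h < d2].
  by move: hm; rewrite !lt_min => /andP[/andP[-> ->]] /andP[]; rewrite !ltr_pdivlMr // ![h * 2]mulrC => -> ->.
have [y yx [_ Ey]] := S1 h ltac:(by rewrite h0).
have [z zx [_ Ez]] := S2 h ltac:(by rewrite h0).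
have EE : pderiv i (pderiv j f) y = pderiv j (pderiv i f) z.
  rewrite Ey Ez [h *: 'e_i + (_ + _)]addrCA; congr (_ / _).
  by move: (f _) (f _) (f _) (f _) => a b c d; ring.
have B1 : ball x d1 y by rewrite -ball_normE /= distrC; exact: le_lt_trans yx _.
have B2 : ball x d2 z by rewrite -ball_normE /= distrC; exact: le_lt_trans zx _.
have := ltrD (H1 _ B1) (H2 _ B2); rewrite -splitr EE => /ltW; apply: le_trans.
rewrite [X in _ <= _ + X]distrC; apply: le_trans (ler_normD _ _).
by rewrite [X in _ <= `|X|]addrA subrK.
Qed.

End RealSmooth.

(** * The modulus of complex numbers *)

Section ComplexNorm.
Variable R : realType.
Local Notation C := R[i].
Local Notation Nc := (@Normc.normc R).

Lemma Re_mul (x y : C) : complex.Re (x * y) = complex.Re x * complex.Re y - complex.Im x * complex.Im y.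
Proof. by case: x; case: y. Qed.
Lemma Im_mul (x y : C) : complex.Im (x * y) = complex.Re x * complex.Im y + complex.Im x * complex.Re y.
Proof. by case: x; case: y. Qed.
Lemma Re_add (x y : C) : complex.Re (x + y) = complex.Re x + complex.Re y.
Proof. by case: x; case: y. Qed.
Lemma Im_add (x y : C) : complex.Im (x + y) = complex.Im x + complex.Im y.
Proof. by case: x; case: y. Qed.
Lemma Re_opp (x : C) : complex.Re (- x) = - complex.Re x.
Proof. by case: x. Qed.
Lemma Im_opp (x : C) : complex.Im (- x) = - complex.Im x.
Proof. by case: x. Qed.

Definition ReImE := (Re_mul, Im_mul, Re_add, Im_add, Re_opp, Im_opp).

Lemma normcE2 (x : C) : Nc x = Num.sqrt (complex.Re x ^+ 2 + complex.Im x ^+ 2).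
Proof. by case: x. Qed.

Lemma normc_ge0 (x : C) : 0 <= Nc x.
Proof. by rewrite normcE2 sqrtr_ge0. Qed.

Lemma normcD (x y : C) : Nc (x + y) <= Nc x + Nc y.
Proof. exact: le_normcD. Qed.

Lemma normcB (x y : C) : Nc (x - y) <= Nc x + Nc y.
Proof. by rewrite -(normcN y); exact: le_normcD. Qed.

Lemma Re_le_normc (x : C) : `|complex.Re x| <= Nc x.
Proof. by rewrite normcE2 -sqrtr_sqr ler_wsqrtr // lerDl sqr_ge0. Qed.

Lemma Im_le_normc (x : C) : `|complex.Im x| <= Nc x.
Proof. by rewrite normcE2 -sqrtr_sqr ler_wsqrtr // lerDr sqr_ge0. Qed.

Lemma normc_le_ReIm (x : C) : Nc x <= `|complex.Re x| + `|complex.Im x|.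
Proof.
rewrite normcE2 -[leRHS]ger0_norm ?addr_ge0 // -sqrtr_sqr ler_wsqrtr //.
rewrite sqrrD !real_normK ?num_real // lerD2r lerDl.
by rewrite mulrn_wge0 // mulr_ge0.
Qed.

Lemma normc_real (a : R) : Nc (a%:C)%C = `|a|.
Proof. by rewrite normcE2 /= expr0n addr0 sqrtr_sqr. Qed.

Lemma normc_sum I (r : seq I) (P : pred I) (F : I -> C) :
  Nc (\sum_(i <- r | P i) F i) <= \sum_(i <- r | P i) Nc (F i).
Proof.
elim/big_ind2 : _ => //; first by rewrite Normc.normc0.
by move=> x1 x2 y1 y2 h1 h2; apply: le_trans (normcD _ _) (lerD _ _).
Qed.

End ComplexNorm.

(** * Complex-valued smooth functions and iterated derivatives *)

Section ComplexSmooth.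
Variables (R : realType) (n : nat).
Local Notation V := 'rV[R]_n.
Local Notation C := R[i].
Local Notation Nc := (@Normc.normc R).
Implicit Types (W : set V) (f g : V -> C) (i : 'I_n) (w : seq 'I_n).

Definition reF f : V -> R := fun x => complex.Re (f x).
Definition imF f : V -> R := fun x => complex.Im (f x).

Definition cD i f : V -> C := fun x => (pderiv i (reF f) x +i* pderiv i (imF f) x)%C.

(** Words of coordinate directions replace multi-indices, since they allow inductions that
    peel off the first or the last derivative. *)
Definition wD w f : V -> C := foldr cD f w.

Lemma smoothE W f : smooth W f <-> rsm W (reF f) /\ rsm W (imF f).
Proof. by split=> [H|[H1 H2] k]; [split=> k; have [] := H k | split]. Qed.

Lemma smooth_sub W W' f : W' `<=` W -> smooth W f -> smooth W' f.
Proof. by move=> WW H k; have [H1 H2] := H k; split; apply: Ck_sub WW _. Qed.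

Lemma smooth_eq W f g : open W -> (forall x, W x -> f x = g x) ->
  smooth W f -> smooth W g.
Proof.
move=> oW fg H k; have [H1 H2] := H k.
by split; [apply: Ck_eq H1|apply: Ck_eq H2] => // x Wx; rewrite fg.
Qed.

Lemma smooth_loc W f : (forall x, W x -> exists2 W', W' x & smooth W' f) ->
  smooth W f.
Proof.
move=> H k; split; apply: Ck_ptw => x /H [W' Wx /(_ k) [H1 H2]];
  by [apply: Ck_sub H1 => y -> | apply: Ck_sub H2 => y ->].
Qed.

Lemma smooth_cst W (c : C) : smooth W (fun=> c).
Proof. by move=> k; split; apply: Ck_cst. Qed.

Lemma smoothD W f g : open W -> smooth W f -> smooth W g ->
  smooth W (fun x => f x + g x).
Proof.
move=> oW /smoothE[f1 f2] /smoothE[g1 g2]; apply/smoothE; split=> k.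
  by apply: Ck_eq (rsmD oW f1 g1 k) => // x _; rewrite /reF ReImE.
by apply: Ck_eq (rsmD oW f2 g2 k) => // x _; rewrite /imF ReImE.
Qed.

Lemma smoothM W f g : open W -> smooth W f -> smooth W g ->
  smooth W (fun x => f x * g x).
Proof.
move=> oW /smoothE[f1 f2] /smoothE[g1 g2]; apply/smoothE; split=> k.
  apply: Ck_eq (rsmD oW (rsmM oW f1 g1) (rsmN oW (rsmM oW f2 g2)) k) => // x _.
  by rewrite /reF /imF ReImE.
apply: Ck_eq (rsmD oW (rsmM oW f1 g2) (rsmM oW f2 g1) k) => // x _.
by rewrite /reF /imF ReImE.
Qed.

Lemma smoothN W f : open W -> smooth W f -> smooth W (fun x => - f x).
Proof.
move=> oW sf; apply: (@smooth_eq _ (fun x => -1 * f x)) => //.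
  by move=> x _; rewrite mulN1r.
by apply: smoothM => //; exact: smooth_cst.
Qed.

Lemma smoothB W f g : open W -> smooth W f -> smooth W g ->
  smooth W (fun x => f x - g x).
Proof. by move=> oW sf sg; apply: smoothD => //; exact: smoothN. Qed.

Lemma smooth_sum W I (r : seq I) (P : pred I) (F : I -> V -> C) : open W ->
  (forall a, P a -> smooth W (F a)) -> smooth W (fun x => \sum_(i <- r | P i) F i x).
Proof.
move=> oW sF; elim: r => [|a r IH].
  by apply: smooth_eq (smooth_cst W 0) => // x _; rewrite big_nil.
case: (boolP (P a)) => Pa.
  by apply: smooth_eq (smoothD oW (sF a Pa) IH) => // x _; rewrite big_cons Pa.
by apply: smooth_eq IH => // x _; rewrite big_cons (negbTE Pa).
Qed.

Lemma smooth_prod W I (r : seq I) (P : pred I) (F : I -> V -> C) : open W ->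
  (forall a, P a -> smooth W (F a)) -> smooth W (fun x => \prod_(i <- r | P i) F i x).
Proof.
move=> oW sF; elim: r => [|a r IH].
  by apply: smooth_eq (smooth_cst W 1) => // x _; rewrite big_nil.
case: (boolP (P a)) => Pa.
  by apply: smooth_eq (smoothM oW (sF a Pa) IH) => // x _; rewrite big_cons Pa.
by apply: smooth_eq IH => // x _; rewrite big_cons (negbTE Pa).
Qed.

Lemma smooth_cD W f i : smooth W f -> smooth W (cD i f).
Proof.
by move=> /smoothE[f1 f2]; apply/smoothE; split; exact: rsm_pderiv.
Qed.

Lemma smooth_wD W f w : smooth W f -> smooth W (wD w f).
Proof. by move=> sf; elim: w => //= i w; exact: smooth_cD. Qed.

Lemma cD_eq W i f g : open W -> (forall x, W x -> f x = g x) ->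
  forall x, W x -> cD i f x = cD i g x.
Proof.
move=> oW fg x Wx; rewrite /cD.
by congr (_ +i* _)%C; apply: (pderiv_eq i oW) Wx => y /fg; rewrite /reF /imF => ->.
Qed.

Lemma wD_eq W w f g : open W -> (forall x, W x -> f x = g x) ->
  forall x, W x -> wD w f x = wD w g x.
Proof. by move=> oW fg; elim: w => //= i w IH; exact: cD_eq. Qed.

Lemma wD_cat w1 w2 f : wD (w1 ++ w2) f = wD w1 (wD w2 f).
Proof. by rewrite /wD foldr_cat. Qed.

Lemma cD_cst i (c : C) x : cD i (fun=> c) x = 0.
Proof.
by rewrite /cD /pderiv /reF /imF !(derive_cst (_ : R^o)).
Qed.

Lemma cDD W f g i : smooth W f -> smooth W g ->
  forall x, W x -> cD i (fun x => f x + g x) x = cD i f x + cD i g x.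
Proof.
move=> /smoothE[f1 f2] /smoothE[g1 g2] x Wx; rewrite /cD.
have -> : reF (fun x => f x + g x) = (fun x => reF f x + reF g x).
  by apply/funext => y; rewrite /reF ReImE.
have -> : imF (fun x => f x + g x) = (fun x => imF f x + imF g x).
  by apply/funext => y; rewrite /imF ReImE.
by rewrite (pderivD i f1 g1) ?(pderivD i f2 g2).
Qed.

Lemma cDM W f g i : open W -> smooth W f -> smooth W g -> forall x, W x ->
  cD i (fun x => f x * g x) x = cD i f x * g x + f x * cD i g x.
Proof.
move=> oW /smoothE[f1 f2] /smoothE[g1 g2] x Wx; rewrite /cD.
have -> : reF (fun x => f x * g x) = (fun x => reF f x * reF g x + - (imF f x * imF g x)).
  by apply/funext => y; rewrite /reF /imF ReImE.
have -> : imF (fun x => f x * g x) = (fun x => reF f x * imF g x + imF f x * reF g x).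
  by apply/funext => y; rewrite /reF /imF ReImE.
have a1 := rsmM oW f1 g1; have a2 := rsmM oW f2 g2.
have a3 := rsmM oW f1 g2; have a4 := rsmM oW f2 g1.
rewrite (pderivD i a1 (rsmN oW a2)) // (pderivD i a3 a4) // (pderivN i a2) //.
rewrite (pderivM i f1 g1) // (pderivM i f2 g2) // (pderivM i f1 g2) // (pderivM i f2 g1) //.
rewrite /reF /imF; case: (f x) => a b; case: (g x) => c d /=.
by apply/eqP; rewrite eq_complex /=; apply/andP; split; apply/eqP; ring.
Qed.

Lemma cDC W f i j : open W -> smooth W f -> forall x, W x ->
  cD i (cD j f) x = cD j (cD i f) x.
Proof.
move=> oW /smoothE[f1 f2] x Wx.
change ((pderiv i (pderiv j (reF f)) x +i* pderiv i (pderiv j (imF f)) x)%C =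
        (pderiv j (pderiv i (reF f)) x +i* pderiv j (pderiv i (imF f)) x)%C).
by rewrite (pderivC i j oW f1 Wx) (pderivC i j oW f2 Wx).
Qed.

(** Schwarz: the order of the letters is immaterial, so words and multi-indices describe the
    same derivatives. *)
Lemma wD_perm W f w w' : open W -> smooth W f -> perm_eq w w' ->
  forall x, W x -> wD w f x = wD w' f x.
Proof.
move=> oW sf.
have mv i w1 w2 : forall x, W x -> wD (w1 ++ i :: w2) f x = wD (i :: w1 ++ w2) f x.
  elim: w1 => //= j w1 IH x Wx.
  rewrite (cD_eq j oW IH Wx) /=; apply: (cDC _ _ oW _ Wx).
  exact: smooth_wD.
elim: w w' => [|i w IH] w'.
  by rewrite perm_sym => /perm_nilP ->.
move=> pw; have iw' : i \in w' by rewrite -(perm_mem pw) mem_head.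
case/splitPr: iw' pw => p1 p2 pw x Wx; rewrite mv //=.
apply: (cD_eq i oW _ Wx) => y Wy; apply: IH => //.
by rewrite -(perm_cons i); apply: perm_trans pw _; rewrite -cat1s perm_catCA.
Qed.

Definition aword (a : {ffun 'I_n -> nat}) : seq 'I_n :=
  flatten [seq nseq (a i) i | i <- enum 'I_n].

Lemma partial_wD a f : partial a f = wD (aword a) f.
Proof.
have E (h : V -> R) s : foldr (fun i (g : V -> R) => iter (a i) (pderiv i) g) h s
     = foldr (@pderiv R n) h (flatten [seq nseq (a i) i | i <- s]).
  elim: s => //= i s ->; rewrite foldr_cat; elim: (a i) => //= k IH; exact: congr1.
have F w : wD w f = fun x => (foldr (@pderiv R n) (reF f) w x
                              +i* foldr (@pderiv R n) (imF f) w x)%C.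
  elim: w => [|i w IH] /=; first by apply/funext => x; rewrite /reF /imF; case: (f x).
  by rewrite IH.
by rewrite F /partial; apply/funext => x; rewrite /rpartial !E.
Qed.

Lemma size_aword a : size (aword a) = mlen a.
Proof.
rewrite /aword size_flatten /shape -map_comp sumnE big_map /mlen.
by rewrite big_enum; apply: eq_bigr => i _ /=; rewrite size_nseq.
Qed.

Lemma aword_surj w : exists2 a, perm_eq (aword a) w & mlen a = size w.
Proof.
exists [ffun i => count_mem i w].
  apply/permP => p; rewrite /aword count_flatten -map_comp sumnE big_map.
  rewrite big_enum /= -(sum1_count w p) [RHS]big_mkcond /=.
  transitivity (\sum_(i : 'I_n) \sum_(j <- w | j == i) (if p j then 1 else 0))%N.
    apply: eq_bigr => i _; rewrite count_nseq ffunE.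
    rewrite (eq_bigr (fun=> nat_of_bool (p i))); last by move=> j /eqP->; case: (p i).
    by rewrite big_const_seq iter_addn_0 mulnC.
  rewrite (exchange_big_dep xpredT) //=; apply: eq_bigr => j _.
  by rewrite (big_pred1 j) // => i; rewrite /= eq_sym.
rewrite /mlen -(sum1_size w).
transitivity (\sum_(i : 'I_n) \sum_(j <- w | j == i) 1)%N.
  by apply: eq_bigr => i _; rewrite ffunE sum1_count.
rewrite (exchange_big_dep xpredT) //=; apply: eq_bigr => j _.
by rewrite (big_pred1 j) // => i; rewrite /= eq_sym.
Qed.

Lemma wDD W f g w : open W -> smooth W f -> smooth W g -> forall x, W x ->
  wD w (fun x => f x + g x) x = wD w f x + wD w g x.
Proof.
move=> oW sf sg; elim: w => //= i w IH x Wx.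
by rewrite (cD_eq i oW IH Wx) (cDD _ (smooth_wD w sf) (smooth_wD w sg)).
Qed.

(** Differentiating one factor shifts its bound, and submultiplicativity passes the shift on
    to [H]; each derivative doubles the number of terms. *)
Lemma leibniz_bound W (x : V) (w : seq 'I_n) f g (F G H : nat -> R) m :
  open W -> W x -> smooth W f -> smooth W g ->
  (forall j, 0 <= F j) -> (forall j, 0 <= G j) ->
  (forall j k, (j + k <= m)%N -> F j * G k <= H (j + k)%N) ->
  (forall u, (size u <= m)%N -> Nc (wD u f x) <= F (size u)) ->
  (forall u, (size u <= m)%N -> Nc (wD u g x) <= G (size u)) ->
  (size w <= m)%N ->
  Nc (wD w (fun x => f x * g x) x) <= 2 ^+ size w * H (size w).
Proof.
move=> oW Wx; elim/last_ind: w m f g F G H => [|w i IH] m f g F G H sf sg F0 G0 FG bf bg sw.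
  rewrite /= expr0 mul1r Normc.normcM; apply: le_trans (FG 0%N 0%N _) => //.
  apply: ler_pM; rewrite ?normc_ge0 //; first exact: (bf [::]).
  exact: (bg [::]).
rewrite -cats1 wD_cat /= size_cat addn1 exprS.
rewrite size_rcons in sw.
case: m sw FG bf bg => // m sw FG bf bg.
have -> : wD w (cD i (fun x => f x * g x)) x =
  wD w (fun x => cD i f x * g x) x + wD w (fun x => f x * cD i g x) x.
  transitivity (wD w (fun x => cD i f x * g x + f x * cD i g x) x).
    by apply: (wD_eq w oW _ Wx) => y Wy; exact: (cDM _ oW).
  have s1 := smoothM oW (smooth_cD i sf) sg.
  have s2 := smoothM oW sf (smooth_cD i sg).
  exact: (wDD w oW s1 s2 Wx).
apply: le_trans (normcD _ _) _.
rewrite -mulrA mulr_natl mulr2n; apply: lerD.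
  apply: (IH m _ _ (fun j => F j.+1) G (fun j => H j.+1)) => //.
  - exact: smooth_cD.
  - by move=> j k jk; rewrite -addSn; apply: FG; rewrite addSn.
  - move=> u su; have := bf (rcons u i); rewrite -cats1 wD_cat /= size_cat addn1.
    by apply.
  - by move=> u su; apply: bg; exact: leqW.
apply: (IH m _ _ F (fun j => G j.+1) (fun j => H j.+1)) => //.
- exact: smooth_cD.
- by move=> j k jk; rewrite -addnS; apply: FG; rewrite addnS.
- by move=> u su; apply: bf; exact: leqW.
- move=> u su; have := bg (rcons u i); rewrite -cats1 wD_cat /= size_cat addn1.
  by apply.
Qed.

Lemma cDZ W f i (c : C) : open W -> smooth W f -> forall x, W x ->
  cD i (fun x => c * f x) x = c * cD i f x.
Proof.
move=> oW sf x Wx; rewrite (@cDM W (fun=> c)) //; last exact: smooth_cst.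
by rewrite cD_cst mul0r add0r.
Qed.

Lemma wDZ W f w (c : C) : open W -> smooth W f -> forall x, W x ->
  wD w (fun x => c * f x) x = c * wD w f x.
Proof.
move=> oW sf; elim: w => //= i w IH x Wx.
by rewrite (cD_eq i oW IH Wx) (cDZ _ _ oW (smooth_wD w sf)).
Qed.

Lemma wDB W f g w : open W -> smooth W f -> smooth W g -> forall x, W x ->
  wD w (fun x => f x - g x) x = wD w f x - wD w g x.
Proof.
move=> oW sf sg x Wx.
rewrite (wDD w oW sf (smoothN oW sg) Wx); congr (_ + _).
rewrite -mulN1r -(wDZ w _ oW sg Wx).
by apply: (wD_eq w oW _ Wx) => y _; rewrite mulN1r.
Qed.

Lemma wD_cst (c : C) w x : wD w (fun=> c) x = if w is [::] then c else 0.
Proof.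
elim: w x => //= i w IH x.
case: w IH => [|j w] IH; first by rewrite cD_cst.
have -> : wD (j :: w) (fun=> c) = fun=> 0 by apply/funext.
by rewrite cD_cst.
Qed.

Lemma wD_sum W I (r : seq I) (P : pred I) (F : I -> V -> C) w : open W ->
  (forall a, P a -> smooth W (F a)) -> forall x, W x ->
  wD w (fun x => \sum_(i <- r | P i) F i x) x = \sum_(i <- r | P i) wD w (F i) x.
Proof.
move=> oW sF x Wx; elim: r => [|a r IH].
  rewrite big_nil -[RHS](_ : wD w (fun=> 0) x = 0).
    by apply: (wD_eq w oW _ Wx) => y _; rewrite big_nil.
  by rewrite wD_cst; case: w.
rewrite big_cons; case: ifPn => Pa.
  rewrite -IH -(wDD w oW (sF a Pa) _ Wx); last exact: smooth_sum.
  by apply: (wD_eq w oW _ Wx) => y _; rewrite big_cons Pa.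
by rewrite -IH; apply: (wD_eq w oW _ Wx) => y _; rewrite big_cons (negbTE Pa).
Qed.

Lemma smooth_contRe W f : smooth W f -> forall x, W x -> {for x, continuous (reF f)}.
Proof. by move=> /smoothE[/rsm_cont H _]. Qed.

Lemma smooth_contIm W f : smooth W f -> forall x, W x -> {for x, continuous (imF f)}.
Proof. by move=> /smoothE[_ /rsm_cont H]. Qed.

End ComplexSmooth.

(** * Boxes, rational balls and measurability *)

Section Boxes.
Variable R : realType.

Lemma ballrVP n (x y : 'rV[R]_n) (e : R) :
  ball x e y <-> 0 < e /\ forall i, `|x 0 i - y 0 i| < e.
Proof.
split=> -[e0 H]; split=> //; first by move=> i; have := H 0 i.
by move=> i j; move: (H j); rewrite (ord1 i).
Qed.

Lemma normrV_lt n (x : 'rV[R]_n) (e : R) : 0 < e ->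
  (`|x| < e) <-> forall i, `|x 0 i| < e.
Proof.
move=> e0; have -> : `|x| < e <-> ball x e 0.
  by rewrite -ball_normE /= subr0.
by split=> [/ballrVP[_ H] i|H]; [have := H i; rewrite mxE subr0|
  apply/ballrVP; split => // i; rewrite mxE subr0].
Qed.

Lemma normrV_le n (x : 'rV[R]_n) (e : R) : 0 <= e ->
  (`|x| <= e) <-> forall i, `|x 0 i| <= e.
Proof.
move=> e0; split=> [xe i|H]; apply/ler_addgt0Pl => d d0.
  have ed : 0 < d + e by rewrite ltr_pwDl.
  have : `|x| < d + e by apply: le_lt_trans xe _; rewrite ltrDr.
  by move/(normrV_lt x ed)/(_ i)/ltW.
have ed : 0 < d + e by rewrite ltr_pwDl.
by apply/ltW/normrV_lt => // i; apply: le_lt_trans (H i) _; rewrite ltrDr.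
Qed.

Lemma coord_le_norm n (x : 'rV[R]_n) i : `|x 0 i| <= `|x|.
Proof. by move: i; apply/normrV_le. Qed.

(** The countable basis of rational balls, which makes open sets Borel and later indexes the
    gluing of local representatives. *)
Definition qball n (k : nat) : 'rV[R]_n * R :=
  if unpickle k is Some (q, r) then
    (map_mx (@ratr R) (q : 'rV[rat]_n), ratr (r : rat)) else (0, 0).

(** The factor 4 leaves room for a bump that equals one on the ball itself. *)
Lemma qball_dense n (U : set 'rV[R]_n) x : nbhs x U ->
  exists k, let: (c, r) := qball n k in [/\ 0 < r, ball c r x & [set y : 'rV[R]_n | `|y - c| <= 4 * r] `<=` U].
Proof.
move=> /nbhs_ballP[/= e e0 eU].
have [r] := @rat_in_itvoo R 0 (e / 5) ltac:(by rewrite divr_gt0).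
rewrite in_itv /= => /andP[r0 re].
have q_ex i : exists q : rat, `|ratr q - x 0 i| < ratr r.
  have [|q] := @rat_in_itvoo R (x 0 i - ratr r) (x 0 i + ratr r).
    by rewrite ltrBlDr -addrA ltrDl addr_gt0.
  by rewrite in_itv /= => qi; exists q; rewrite ltr_distl.
have [q qP] := choice q_ex.
exists (pickle ((\row_i q i : 'rV[rat]_n), r)); rewrite /qball pickleK; split=> //.
  by apply/ballrVP; split=> // i; rewrite !mxE.
move=> y /= yc; apply: eU; apply/ballrVP; split=> // i.
have := le_trans (coord_le_norm _ i) yc; rewrite !mxE distrC => Hi.
have := qP i; rewrite distrC => Hq.
have E : `|x 0 i - y 0 i| <= `|x 0 i - ratr (q i)| + `|ratr (q i) - y 0 i|.
  by apply: le_trans (ler_normD _ _); rewrite addrA subrK.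
apply: le_lt_trans E _; apply: lt_trans (ltr_leD Hq Hi) _; lra.
Qed.

End Boxes.

(** * Integration over R^n *)

Section VecSpace.
Variable R : realType.
Local Notation vsc n := (vs_car (lebesgue_space R n)).

Definition vmu n := @vs_mu R n (lebesgue_space R n).
Definition rowv n : vsc n -> 'rV[R]_n := @vs_row R n (lebesgue_space R n).
Definition lint n (f : 'rV[R]_n -> R) : R := \int[vmu n]_p f (rowv p).
Definition consmx n (t : R) (y : 'rV[R]_n) : 'rV[R]_n.+1 :=
  row_mx (const_mx t : 'rV[R]_1) y : 'rV[R]_(1 + n).
Definition boxc n (r : R) : set 'rV[R]_n := [set x | forall i, `|x 0 i| <= r].

Lemma consmx0 n t (y : 'rV[R]_n) : consmx t y 0 0 = t.
Proof.
rewrite /consmx (_ : 0 = lshift n (0 : 'I_1)); last exact: val_inj.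
by rewrite (@row_mxEl R 1 1 n) mxE.
Qed.

Lemma consmxS n t (y : 'rV[R]_n) i : consmx t y 0 (lift ord0 i) = y 0 i.
Proof.
rewrite /consmx (_ : lift ord0 i = rshift 1 i); last exact: val_inj.
by rewrite (@row_mxEr R 1 1 n).
Qed.

Lemma rowv_cons n (p : vsc n.+1) : rowv p = consmx p.1 (rowv p.2).
Proof. by []. Qed.

Lemma measurable_coord n i : measurable_fun setT (fun p : vsc n => rowv p 0 i).
Proof.
elim: n i => [|n IH] i; first by case: i.
case: (unliftP ord0 i) => [j ->|->].
  rewrite (_ : (fun p => _) = (fun p : vsc n => rowv p 0 j) \o
    (snd : (measurableTypeR R * vsc n)%type -> _)).
    by apply: measurableT_comp; [exact: IH|exact: measurable_snd].
  by apply/funext => p; rewrite rowv_cons consmxS.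
rewrite (_ : (fun p => _) = (fst : (measurableTypeR R * vsc n)%type -> _)).
  exact: measurable_fst.
by apply/funext => p; rewrite rowv_cons consmx0.
Qed.

Lemma measurable_ball n (c : 'rV[R]_n) r : measurable (@rowv n @^-1` ball c r).
Proof.
have [r0|r0] := ltP 0 r; last first.
  rewrite (_ : _ @^-1` _ = set0) //; apply/seteqP; split=> p //= [r1].
  by move: r0; rewrite leNgt r1.
rewrite (_ : _ @^-1` _ = \bigcap_(i in [set: 'I_n])
   ((fun p => rowv p 0 i) @^-1` `]c 0 i - r, c 0 i + r[%classic)).
  apply: fin_bigcap_measurable; first exact: finite_finset.
  move=> i _; rewrite -[X in measurable X]setTI; apply: measurable_coord => //.
apply/seteqP; split=> p /=.
  by move=> /ballrVP[_ H] i _ /=; rewrite in_itv /= -ltr_distl distrC.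
move=> H; apply/ballrVP; split=> // i; have := H i I.
by rewrite /= in_itv /= -ltr_distl distrC.
Qed.

Lemma measurable_open n (U : set 'rV[R]_n) : open U -> measurable (@rowv n @^-1` U).
Proof.
move=> oU.
pose F k := if `[< ball (qball R n k).1 (qball R n k).2 `<=` U >] then
   @rowv n @^-1` (ball (qball R n k).1 (qball R n k).2) else set0.
rewrite (_ : _ @^-1` U = \bigcup_k F k).
  apply: bigcupT_measurable => k; rewrite /F; case: asboolP => // _.
  exact: measurable_ball.
apply/seteqP; split=> [p /= Up|p [k _]]; last first.
  by rewrite /F; case: asboolP => // kU /kU.
have [k] := qball_dense (open_nbhs_nbhs (conj oU Up)).
case E : (qball R n k) => [c r] [r0 pk kU]; exists k => //; rewrite /F E /=.
case: asboolP => //= -[] y; rewrite -ball_normE /= distrC => /ltW yc; apply: kU => /=.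
by apply: le_trans yc _; rewrite ler_peMl ?ler1n // ltW.
Qed.

Lemma measurable_cont n (f : 'rV[R]_n -> R) : continuous f ->
  measurable_fun setT (f \o @rowv n).
Proof.
move=> cf; apply: (measurability _ (measurable_realfun.RGenOInfty.measurableE R)) => _ [_ [a ->] <-].
rewrite setTI comp_preimage; apply: measurable_open.
by apply: open_comp => [x _|]; [exact: cf|exact: rray_open].
Qed.

Lemma measurable_boxc n r : measurable (@rowv n @^-1` @boxc n r).
Proof.
rewrite (_ : _ @^-1` _ = \bigcap_(i in [set: 'I_n])
   ((fun p => rowv p 0 i) @^-1` `[- r, r]%classic)).
  apply: fin_bigcap_measurable; first exact: finite_finset.
  move=> i _; rewrite -[X in measurable X]setTI; apply: measurable_coord => //.
apply/seteqP; split=> p /=.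
  by move=> H i _ /=; rewrite in_itv /= -ler_norml.
by move=> H i; have := H i I; rewrite /= in_itv /= -ler_norml.
Qed.

Lemma boxc_cons n r t (y : 'rV[R]_n) : boxc r (consmx t y) <-> `|t| <= r /\ boxc r y.
Proof.
split=> [H|[tr H] i].
  by split=> [|i]; [have := H 0; rewrite consmx0|have := H (lift ord0 i); rewrite consmxS].
by case: (unliftP ord0 i) => [j ->|->]; rewrite ?consmxS ?consmx0.
Qed.

Lemma lebesgue_sym_itv (r : R) : 0 <= r ->
  lebesgue_measure (`[- r, r]%classic : set R) = (r *+ 2)%:E.
Proof.
move=> r0; rewrite lebesgue_measure_itv /= lte_fin.
case: ltP => [_|rr]; first by rewrite -EFinD opprK mulr2n.
by have -> : r = 0; [apply/eqP; rewrite eq_le r0 andbT; lra|rewrite mul0rn].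
Qed.

Lemma vmu_boxc n r : 0 <= r -> vmu n (@rowv n @^-1` @boxc n r) = ((r *+ 2) ^+ n)%:E.
Proof.
move=> r0; elim: n => [|n IH].
  rewrite expr0 /vmu /= diracE mem_set //; by case.
rewrite (_ : _ @^-1` _ = `[- r, r]%classic `*` (@rowv n @^-1` @boxc n r)).
  rewrite /vmu /= product_measure1E //; last exact: measurable_boxc.
  rewrite [X in (X * _)%E](_ : _ = (r *+ 2)%:E); last exact: lebesgue_sym_itv.
  by rewrite [X in (_ * X)%E]IH exprS EFinM.
apply/seteqP; split=> p /=.
  by rewrite rowv_cons => /boxc_cons[H1 H2]; split=> //=; rewrite in_itv /= -ler_norml.
rewrite rowv_cons => -[/=]; rewrite in_itv /= -ler_norml => H1 H2.
exact/boxc_cons.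
Qed.

(** This class is closed under all the operations used below and its members are integrable,
    so no integrability condition has to be carried along. *)
Definition nice n (f : 'rV[R]_n -> R) : Prop :=
  measurable_fun setT (f \o @rowv n) /\
  exists r B : R, 0 <= r /\ forall x, `|f x| <= B /\ (~ boxc r x -> f x = 0).

Lemma nice_integrable n (f : 'rV[R]_n -> R) : nice f ->
  (vmu n).-integrable setT (EFin \o (f \o @rowv n)).
Proof.
move=> [mf [r [B [r0 H]]]].
have mb := measurable_boxc n r.
have : (vmu n).-integrable (@rowv n @^-1` @boxc n r) (EFin \o (f \o @rowv n)).
  apply: measurable_bounded_integrable => //.
  - by have := vmu_boxc n r0 => /= E; rewrite E; exact: ltry.
  - exact: measurable_funS mf.
  - exists B; split; first exact: num_real.
    by move=> M BM x _; apply: le_trans (ltW BM); exact: (H _).1.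
rewrite -[X in _.-integrable X _ -> _]setIT setIC.
move/(integrable_restrict (vmu n) _ measurableT) => /(_ mb).
congr (_.-integrable _ _); apply/funext => p; rewrite /patch /=.
case: ifPn => //; rewrite notin_setE /= => /(H (rowv p)).2 E.
by rewrite E.
Qed.

Lemma niceD n (f g : 'rV[R]_n -> R) : nice f -> nice g -> nice (fun x => f x + g x).
Proof.
move=> [mf [r1 [B1 [r10 H1]]]] [mg [r2 [B2 [r20 H2]]]]; split.
  exact: measurable_funD mf mg.
exists (Num.max r1 r2), (B1 + B2); split; first by rewrite le_max r10.
move=> x; split.
  by apply: le_trans (ler_normD _ _) (lerD _ _); [exact: (H1 x).1|exact: (H2 x).1].
move=> nb; rewrite (H1 x).2 ?(H2 x).2 ?addr0 // => b; apply: nb => i;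
 by rewrite le_max (b i) ?orbT.
Qed.

Lemma niceM n (f g : 'rV[R]_n -> R) : nice f -> nice g -> nice (fun x => f x * g x).
Proof.
move=> [mf [r1 [B1 [r10 H1]]]] [mg [r2 [B2 [r20 H2]]]]; split.
  exact: measurable_funM mf mg.
exists r1, (B1 * B2); split=> // x; split.
  by rewrite normrM ler_pM //; [exact: (H1 x).1|exact: (H2 x).1].
by move=> nb; rewrite (H1 x).2 ?mul0r.
Qed.

Lemma niceZ n (f : 'rV[R]_n -> R) c : nice f -> nice (fun x => c * f x).
Proof.
move=> [mf [r1 [B1 [r10 H1]]]]; split.
  by apply: measurable_funM mf; exact: measurable_cst.
exists r1, (`|c| * B1); split=> // x; split.
  by rewrite normrM ler_wpM2l //; exact: (H1 x).1.
by move=> nb; rewrite (H1 x).2 ?mulr0.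
Qed.

Lemma nice_abs n (f : 'rV[R]_n -> R) : nice f -> nice (fun x => `|f x|).
Proof.
move=> [mf [r1 [B1 [r10 H1]]]]; split.
  by apply: measurableT_comp mf.
exists r1, B1; split=> // x; split; first by rewrite normr_id; exact: (H1 x).1.
by move=> nb; rewrite (H1 x).2 ?normr0.
Qed.

Lemma nice_cst0 n : nice (fun _ : 'rV[R]_n => 0).
Proof.
split; first exact: measurable_cst.
by exists 0, 0; split=> // x; rewrite normr0.
Qed.

(** Cuts continuous functions off, which makes them integrable. *)
Definition ibox n (r : R) (x : 'rV[R]_n) : R := \1_(boxc r) x.

Lemma ibox_in n r (x : 'rV[R]_n) : boxc r x -> ibox r x = 1.
Proof. by move=> b; rewrite /ibox indicE mem_set. Qed.

Lemma ibox_out n r (x : 'rV[R]_n) : ~ boxc r x -> ibox r x = 0.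
Proof. by move=> b; rewrite /ibox indicE memNset. Qed.

Lemma ibox_ge0 n r (x : 'rV[R]_n) : 0 <= ibox r x.
Proof. by rewrite /ibox indicE ler0n. Qed.

Lemma boxc_norm n r (x : 'rV[R]_n) : 0 <= r -> boxc r x <-> `|x| <= r.
Proof. by move=> r0; split=> /(normrV_le x r0). Qed.

Lemma compact_boxc n r : compact (@boxc n r).
Proof.
have [r0|r0] := leP 0 r; last first.
  case: n => [|n].
    rewrite (_ : boxc r = [set 0]); first exact: compact_set1.
    by apply/seteqP; split=> x _; [apply/rowP => -[] | case].
  rewrite (_ : boxc r = set0); first exact: compact0.
  apply/seteqP; split=> x //= /(_ 0); rewrite leNgt => /negP; apply.
  exact: lt_le_trans r0 _.
rewrite (_ : boxc r = [set x | `|x| <= r]).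
  apply: bounded_closed_compact.
    exists r; split; first exact: num_real.
    by move=> M rM x /= xr; apply: le_trans xr (ltW rM).
  rewrite (_ : [set x | _] = (fun x => `|x|) @^-1` [set t | t <= r]) //.
  by apply: closed_comp => [x _|]; [exact: norm_continuous|exact: closed_le].
by apply/seteqP; split=> x /(boxc_norm x r0).
Qed.

Lemma compact_bound n (K : set 'rV[R]_n) (f : 'rV[R]_n -> R) : compact K ->
  (forall x, K x -> {for x, continuous f}) -> exists B, forall x, K x -> `|f x| <= B.
Proof.
move=> cK cf.
have : compact (f @` K).
  by apply: continuous_compact cK; apply: continuous_in_subspaceT => x /set_mem /cf.
move=> /compact_bounded [M [_ HM]]; exists (M + 1) => x Kx.
by apply: HM; [rewrite ltrDl|exists x].
Qed.

Lemma nice_box n r (f : 'rV[R]_n -> R) : 0 <= r -> continuous f ->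
  nice (fun x => ibox r x * f x).
Proof.
move=> r0 cf; split.
  apply: measurable_funM; last exact: measurable_cont.
  rewrite (_ : (fun x => _) = \1_(@rowv n @^-1` boxc r)); last first.
    by apply/funext => p; rewrite /= /ibox !indicE.
  by apply: measurable_indic; exact: measurable_boxc.
have [B HB] := compact_bound (@compact_boxc n r) (fun x _ => cf x).
exists r, `|B|; split=> // x.
have [b|b] := pselect (boxc r x); last by rewrite ibox_out // mul0r normr0.
by rewrite ibox_in // mul1r; split=> //; apply: le_trans (HB _ b) (ler_norm _).
Qed.

Lemma nice_cont n r (f : 'rV[R]_n -> R) : 0 <= r -> continuous f ->
  (forall x, ~ boxc r x -> f x = 0) -> nice f.
Proof.
move=> r0 cf f0; rewrite (_ : f = fun x => ibox r x * f x); first exact: nice_box.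
apply/funext => x; have [b|b] := pselect (boxc r x).
  by rewrite ibox_in // mul1r.
by rewrite ibox_out // mul0r f0.
Qed.

Lemma lintD n (f g : 'rV[R]_n -> R) : nice f -> nice g ->
  lint (fun x => f x + g x) = lint f + lint g.
Proof.
by move=> nf ng; apply: RintegralD => //; exact: nice_integrable.
Qed.

Lemma lintZ n (f : 'rV[R]_n -> R) c : nice f -> lint (fun x => c * f x) = c * lint f.
Proof. by move=> nf; apply: RintegralZl => //; exact: nice_integrable. Qed.

Lemma le_lint n (f g : 'rV[R]_n -> R) : nice f -> nice g -> (forall x, f x <= g x) ->
  lint f <= lint g.
Proof. by move=> nf ng fg; apply: le_Rintegral => //; exact: nice_integrable. Qed.

Lemma lint_abs_le n (f F : 'rV[R]_n -> R) : nice f -> nice F ->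
  (forall x, `|f x| <= F x) -> `|lint f| <= lint F.
Proof.
move=> nf nF fF; apply: le_trans (le_normr_Rintegral _ (nice_integrable nf)) _ => //.
exact: le_lint (nice_abs nf) nF fF.
Qed.

Lemma lint_ibox n r : 0 <= r -> lint (@ibox n r) = (r *+ 2) ^+ n.
Proof.
move=> r0; rewrite /lint (_ : (fun p => _) = \1_(@rowv n @^-1` boxc r)).
  rewrite /Rintegral (integral_indic (vmu n)) ?setIT //; last exact: measurable_boxc.
  by have /= -> := vmu_boxc n r0.
by apply/funext => p; rewrite /ibox !indicE.
Qed.

Lemma nice_ibox n r : 0 <= r -> nice (@ibox n r).
Proof.
move=> r0; rewrite (_ : ibox r = fun x => ibox r x * 1).
  by apply: nice_box => // x; exact: cst_continuous.
by apply/funext => x; rewrite mulr1.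
Qed.

(** With this, Fubini applies to nice functions without further conditions. *)
Lemma nice_slice n (f : 'rV[R]_n.+1 -> R) t : nice f -> nice (fun y => f (consmx t y)).
Proof.
move=> [mf [r [B [r0 H]]]]; split.
  exact: (measurableT_comp mf (pair1_measurable (t : measurableTypeR R))).
exists r, B; split=> // y; split; first exact: (H _).1.
by move=> nb; apply: (H _).2 => /boxc_cons[_ b]; exact: nb.
Qed.

Lemma lint_cons n (f : 'rV[R]_n.+1 -> R) : nice f ->
  lint f = \int[@lebesgue_measure R]_t lint (fun y => f (consmx t y)).
Proof.
move=> nf; rewrite /lint /Rintegral; congr fine.
have := nice_integrable nf => /= If.
have := @integral12_prod_meas1 _ _ _ _ R (@lebesgue_measure R) (vmu n) _ If.
rewrite /= => <-; apply: eq_integral => t _; rewrite /fubini_F /=.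
rewrite fineK //; apply: integrable_fin_num => //.
exact: (nice_integrable (nice_slice t nf)).
Qed.

(** The order of integration that puts the fundamental theorem of calculus in the first
    variable. *)
Lemma lint_cons2 n (f : 'rV[R]_n.+1 -> R) : nice f ->
  lint f = lint (fun y => \int[@lebesgue_measure R]_t f (consmx t y)).
Proof.
move=> nf; rewrite /lint /Rintegral; congr fine.
have := nice_integrable nf => /= If.
have := @integral21_prod_meas1 _ _ _ _ R (@lebesgue_measure R) (vmu n) _ If.
rewrite /= => <-; apply: eq_integral => p _; rewrite /fubini_G /=.
rewrite fineK //; apply: integrable_fin_num => //.
have [mf [r [B [r0 H]]]] := nf.
have mg : measurable_fun setT (fun t : measurableTypeR R => f (consmx t (rowv p))).
  exact: (measurableT_comp mf (pair2_measurable p)).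
have : (@lebesgue_measure R).-integrable `[- r, r]%classic
   (EFin \o (fun t => f (consmx t (rowv p)))).
  apply: measurable_bounded_integrable => //.
  - exact: (eq_ind_r (fun z => (z < +oo)%E) (ltry _) (lebesgue_sym_itv r0)).
  - exact: measurable_funS mg.
  - exists B; split; first exact: num_real.
    by move=> M BM x _; apply: le_trans (ltW BM); exact: (H _).1.
rewrite -[X in _.-integrable X _ -> _]setIT setIC.
move/(integrable_restrict (@lebesgue_measure R) _ measurableT) => /(_ ltac:(done)).
congr (_.-integrable _ _); apply/funext => t; rewrite /patch /=.
case: ifPn => //; rewrite notin_setE /= in_itv /= -ler_norml => tr.
by rewrite (H _).2 // => /boxc_cons[].
Qed.

End VecSpace.

(** * Fubini and integration by parts *)

Section Parts.
Variable R : realType.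
Local Notation mu1 := (@lebesgue_measure R).

Lemma continuous_norm_near (V : normedModType R) (F : V -> R) (x : V) :
  {for x, continuous F} <-> forall e : R, 0 < e -> exists2 d : R, 0 < d &
     forall y, `|x - y| < d -> `|F x - F y| < e.
Proof.
split=> [cF e e0|H].
  have /nbhs_ballP[/= d d0 Hd] : \forall y \near x, `|F x - F y| < e.
    by move/cvgrPdist_lt: cF; apply.
  by exists d => // y xy; apply: Hd; rewrite -ball_normE.
apply/cvgrPdist_lt => e e0; have [d d0 Hd] := H e e0.
by apply/nbhs_ballP; exists d => //= y; rewrite -ball_normE /= => /Hd.
Qed.

Lemma consmxB n t (y z : 'rV[R]_n) : `|consmx t y - consmx t z| <= `|y - z|.
Proof.
apply/normrV_le => // i; rewrite !mxE.
case: (unliftP ord0 i) => [j ->|->]; rewrite -?[row_mx _ _]/(consmx _ _).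
  have := coord_le_norm (y - z) j; rewrite !mxE.
  by have := consmxS t y j; have := consmxS t z j; rewrite /consmx !mxE => -> ->.
have := consmx0 t y; have := consmx0 t z; rewrite /consmx !mxE => -> ->.
by rewrite subrr normr0.
Qed.

Lemma consmx_line n t (y : 'rV[R]_n) : consmx t y = t *: delta_mx 0 ord0 + consmx 0 y.
Proof.
apply/rowP => i; rewrite [RHS]mxE [X in _ = X + _]mxE [X in _ = _ * X + _]mxE eqxx /=.
case: (unliftP ord0 i) => [j ->|->]; rewrite ?consmxS ?consmx0 /=.
  by rewrite mulr0 add0r.
by rewrite mulr1 addr0.
Qed.

Lemma consmx_shift n t (y : 'rV[R]_n) j (h : R) :
  consmx t (h *: delta_mx 0 j + y) = h *: delta_mx 0 (lift ord0 j) + consmx t y.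
Proof.
apply/rowP => i; rewrite [RHS]mxE [X in _ = X + _]mxE [X in _ = _ * X + _]mxE eqxx /=.
case: (unliftP ord0 i) => [k ->|->]; rewrite ?consmxS ?consmx0 /=.
  by rewrite !mxE eqxx (inj_eq lift_inj).
by rewrite mulr0 add0r.
Qed.

Lemma continuous_slice n (f : 'rV[R]_n.+1 -> R) t : continuous f ->
  continuous (fun y : 'rV[R]_n => f (consmx t y)).
Proof.
move=> cf y; apply/continuous_norm_near => e e0.
have [d d0 Hd] := (continuous_norm_near f (consmx t y)).1 (cf _) e e0.
by exists d => // z yz; apply: Hd; apply: le_lt_trans (consmxB t y z) yz.
Qed.

Lemma slice_quotient n (f : 'rV[R]_n.+1 -> R) t j y :
  (fun h : R => h^-1 *: (((fun y => f (consmx t y)) \o shift y) (h *: (delta_mx 0 j : 'rV[R]_n))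
     - f (consmx t y))) =
  (fun h : R => h^-1 *: ((f \o shift (consmx t y)) (h *: (delta_mx 0 (lift ord0 j) : 'rV[R]_n.+1))
     - f (consmx t y))).
Proof. by apply/funext => h /=; rewrite consmx_shift. Qed.

Lemma pderiv_slice n (f : 'rV[R]_n.+1 -> R) t j :
  pderiv j (fun y : 'rV[R]_n => f (consmx t y)) =
  (fun y => pderiv (lift ord0 j) f (consmx t y)).
Proof. by apply/funext => y; rewrite /pderiv /derive slice_quotient. Qed.

Lemma derivable_slice n (f : 'rV[R]_n.+1 -> R) t j (y : 'rV[R]_n) :
  derivable f (consmx t y) (delta_mx 0 (lift ord0 j) : 'rV[R]_n.+1) ->
  derivable (fun y : 'rV[R]_n => f (consmx t y)) y (delta_mx 0 j : 'rV[R]_n).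
Proof. by rewrite /derivable slice_quotient. Qed.

Lemma int_derive0 (g g' : R -> R) (r : R) : 0 <= r ->
  (forall t : R, is_derive t 1 g (g' t)) -> continuous g' ->
  (forall t : R, r < `|t| -> g t = 0) -> (forall t : R, r < `|t| -> g' t = 0) ->
  \int[mu1]_t g' t = 0.
Proof.
move=> r0 dg cg' g0 g'0.
have rr : - (r + 1) < r + 1 by lra.
have -> : \int[mu1]_t g' t = \int[mu1]_(t in `[- (r + 1), r + 1]) g' t.
  rewrite [RHS]Rintegral_mkcond; congr Rintegral; apply/funext => t; rewrite /patch.
  case: ifPn => //; rewrite notin_setE /= in_itv /= -ler_norml => /negP.
  by rewrite -ltNge => tr; rewrite g'0 //; lra.
have cg : continuous g.
  by move=> t; apply/differentiable_continuous/derivable1_diffP; have [] := dg t.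
rewrite /Rintegral (@continuous_FTC2 _ g' g) //.
- by rewrite !g0 ?subee //= ?normrN ger0_norm; lra.
- by apply: continuous_subspaceT.
- split; first by move=> t _; have [] := dg t.
  + by apply: cvg_at_right_filter; exact: cg.
  + by apply: cvg_at_left_filter; exact: cg.
- by move=> t _; rewrite derive1E; have [] := dg t.
Qed.

Lemma pderiv_out n (f : 'rV[R]_n -> R) r i : 0 <= r ->
  (forall x, ~ boxc r x -> f x = 0) -> forall x, ~ boxc r x -> pderiv i f x = 0.
Proof.
move=> r0 f0 x xr.
have rx : r < `|x| by rewrite ltNge; apply/negP => /(boxc_norm x r0).
rewrite /pderiv (@near_eq_derive _ _ _ f (fun=> 0)) ?(derive_cst (0 : R^o)) //.
apply/nbhs_ballP; exists (`|x| - r); rewrite /= ?subr_gt0 // => y.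
rewrite -ball_normE /= => xy; apply: f0 => /(boxc_norm y r0) yr.
have := ler_normB x (x - y); rewrite opprB addrCA subrr addr0.
move=> H; have := ler_normD (x - y) y; rewrite subrK; lra.
Qed.

(** In the first variable this is the fundamental theorem of calculus after Fubini; for the
    others, slice and use induction on the dimension. *)
Lemma lint_pderiv n (f : 'rV[R]_n -> R) r i : 0 <= r -> continuous f ->
  (forall x, derivable f x (delta_mx 0 i : 'rV[R]_n)) -> continuous (pderiv i f) ->
  (forall x, ~ boxc r x -> f x = 0) -> lint (pderiv i f) = 0.
Proof.
move=> r0; elim: n f i => [|n IH] f i cf df cdf f0; first by case: i df cdf.
have nf : nice (pderiv i f) by apply: (nice_cont r0 cdf); exact: pderiv_out.
case: (unliftP ord0 i) df cdf nf => [j ->|->] df cdf nf.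
  rewrite lint_cons // (_ : (fun t => _) = fun=> 0) /Rintegral ?integral0 //.
  apply/funext => t; rewrite -(pderiv_slice f t j); apply: IH.
  - exact: continuous_slice.
  - by move=> y; exact: derivable_slice.
  - by rewrite pderiv_slice; exact: continuous_slice.
  - by move=> y by_; apply: f0 => /boxc_cons[].
rewrite lint_cons2 // (_ : (fun y => _) = fun=> 0).
  by rewrite /lint /Rintegral integral0.
apply/funext => y; apply: (@int_derive0 (fun t => f (consmx t y)) _ r) => //.
- move=> t; have := @is_derive_line R n.+1 f (consmx 0 y) (delta_mx 0 ord0) t.
  rewrite -consmx_line => /(_ (df _)); rewrite /pderiv.
  by under [X in is_derive _ _ X _ -> _]funext do rewrite -consmx_line.
- move=> t.
  apply/(@continuous_norm_near R^o (fun t => pderiv ord0 f (consmx t y)) t) => e e0.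
  have [d d0 Hd] := (continuous_norm_near _ (consmx t y)).1 (cdf _) e e0.
  exists d => // s ts; apply: Hd.
  rewrite [consmx t y]consmx_line [consmx s y]consmx_line opprD addrACA subrr addr0.
  rewrite -scalerBl normrZ; apply: le_lt_trans ts.
  by rewrite -[leRHS]mulr1 ler_wpM2l // norm_delta.
- by move=> t tr; apply: f0 => /boxc_cons[]; rewrite leNgt tr.
- move=> t tr; apply: (pderiv_out ord0 r0 f0) => /boxc_cons[]; by rewrite leNgt tr.
Qed.

Lemma continuous_prod (T : topologicalType) I (s : seq I) (F : I -> T -> R) :
  (forall a, continuous (F a)) -> continuous (fun x => \prod_(a <- s) F a x).
Proof.
move=> cF; elim: s => [|a s IH].
  by under [X in continuous X]funext do rewrite big_nil; exact: cst_continuous.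
under [X in continuous X]funext do rewrite big_cons.
by move=> x; exact: (cvgM (cF a x) (IH x)).
Qed.

Lemma continuous_coord n (phi : R -> R) (i : 'I_n) : continuous phi ->
  continuous (fun x : 'rV[R]_n => phi (x 0 i)).
Proof.
move=> cp x; apply/continuous_norm_near => e e0.
have [d d0 Hd] := (continuous_norm_near (phi : R^o -> R) (x 0 i)).1 (cp _) e e0.
exists d => // y xy; apply: Hd; apply: le_lt_trans xy.
by have := coord_le_norm (x - y) i; rewrite !mxE.
Qed.

Lemma lint_prod n (phi : 'I_n -> R -> R) r : 0 <= r -> (forall i, continuous (phi i)) ->
  lint (fun x => ibox r x * \prod_i phi i (x 0 i)) =
  \prod_i \int[mu1]_(t in `[- r, r]) phi i t.
Proof.
move=> r0; elim: n phi => [|n IH] phi cphi.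
  rewrite big_ord0 (_ : (fun x => _) = ibox r); first by rewrite lint_ibox ?expr0.
  by apply/funext => x; rewrite big_ord0 mulr1.
have cprod m (psi : 'I_m -> R -> R) : (forall i, continuous (psi i)) ->
    nice (fun x : 'rV[R]_m => ibox r x * \prod_i psi i (x 0 i)).
  move=> cpsi; apply: nice_box => //.
  by apply: continuous_prod => i; exact: continuous_coord.
rewrite lint_cons; last exact: cprod.
rewrite big_ord_recl /= -IH //.
set L := lint _.
rewrite -RintegralZr //; last first.
  by apply: continuous_compact_integrable; [exact: segment_compact|apply: continuous_subspaceT].
rewrite [RHS]Rintegral_mkcond; congr Rintegral; apply/funext => t; rewrite /patch.
case: ifPn => [|]; last first.
  rewrite notin_setE /= in_itv /= -ler_norml => tr.
  rewrite (_ : (fun y => _) = fun=> 0); first by rewrite /lint /Rintegral integral0.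
  by apply/funext => y; rewrite ibox_out ?mul0r // => /boxc_cons[].
rewrite inE /= in_itv /= -ler_norml => tr.
have -> : phi ord0 t * L = lint (fun y : 'rV[R]_n => phi ord0 t *
    (ibox r y * \prod_i phi (lift ord0 i) (y 0 i))).
  by rewrite lintZ //; apply: (cprod n (fun i => phi (lift ord0 i))).
congr lint; apply/funext => y; rewrite big_ord_recl consmx0.
rewrite (eq_bigr (fun i => phi (lift ord0 i) (y 0 i))); last first.
  by move=> i _; congr (phi _ _); exact: consmxS.
have [b|b] := pselect (boxc r y).
  by rewrite !ibox_in //; [rewrite !mul1r | apply/boxc_cons].
by rewrite !ibox_out ?mul0r ?mulr0 // => /boxc_cons[].
Qed.

End Parts.

(** * Local properties of compact sets *)

(** The covering property of compact sets as an induction principle; it is used for estimates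
    on compact sets, for the unit sphere of frequencies and for the support of a net. *)
Lemma compact_ind (T : topologicalType) (K : set T) (Q : set T -> Prop) :
  compact K -> Q set0 -> (forall A B, Q A -> Q B -> Q (A `|` B)) ->
  (forall A B, A `<=` B -> Q B -> Q A) ->
  (forall x, K x -> exists2 U, nbhs x U & Q U) -> Q K.
Proof.
move=> cK Q0 QU QS Qloc; apply: contrapT => nQ.
pose F := [set A | Q (K `\` A)].
have FF : ProperFilter F.
  split; first by rewrite /F /= setD0.
  split; rewrite /F /=.
  - by rewrite setDT.
  - by move=> A B /= QA QB; rewrite setDIr; exact: QU.
  - by move=> A B AB /=; apply: QS; apply: setDS.
have FK : F K by rewrite /F /= setDv.
have [x [Kx clx]] := cK F FF FK.
have [U nU QU1] := Qloc x Kx.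
have FU : F (~` U).
  by rewrite /F /=; apply: QS QU1 => y [_ /= /contrapT].
by have [y []] := clx _ _ FU nU.
Qed.

(** * Characters *)

Section Linear.
Variables (R : realType) (n : nat).
Local Notation V := 'rV[R]_n.
Local Notation C := R[i].

Lemma dotvC (x y : V) : dotv x y = dotv y x.
Proof. by rewrite /dotv; apply: eq_bigr => i _; rewrite mulrC. Qed.

Lemma dotvDr (l x y : V) : dotv l (x + y) = dotv l x + dotv l y.
Proof. by rewrite /dotv -big_split /=; apply: eq_bigr => i _; rewrite mxE mulrDr. Qed.

Lemma dotvZr (l x : V) a : dotv l (a *: x) = a * dotv l x.
Proof. by rewrite /dotv mulr_sumr; apply: eq_bigr => i _; rewrite mxE mulrCA. Qed.

Lemma dotvNr (l x : V) : dotv l (- x) = - dotv l x.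
Proof. by rewrite -scaleN1r dotvZr mulN1r. Qed.

Lemma dotv_delta (l : V) i : dotv l (delta_mx 0 i) = l 0 i.
Proof.
rewrite /dotv (bigD1 i) //= mxE !eqxx mulr1 big1 ?addr0 // => j ji.
by rewrite mxE (negbTE ji) andbF mulr0.
Qed.

Lemma derive_dot (g : R -> R) (dg : R) (l x : V) i :
  is_derive (dotv l x) 1 g dg ->
  is_derive x (delta_mx 0 i : V) (fun y => g (dotv l y)) (l 0 i * dg).
Proof.
move=> Dg.
have dg1 : derivable g (dotv l x) 1 by case: Dg.
have D : is_derive (dotv l x) (l 0 i) g (l 0 i * dg).
  have df : differentiable g (dotv l x) by apply/derivable1_diffP.
  split; first exact: diff_derivable.
  rewrite deriveE // deriv1E // derive1E.
  by have [_ ->] := Dg.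
have E : (fun h : R => h^-1 *: (((fun y => g (dotv l y)) \o shift x) (h *: (delta_mx 0 i : V))
    - g (dotv l x))) = (fun h => h^-1 *: ((g \o shift (dotv l x)) (h *: l 0 i) - g (dotv l x))).
  by apply/funext => h /=; rewrite dotvDr dotvZr dotv_delta.
by case: D => D1 D2; split; rewrite /derivable /derive E.
Qed.

(** The chain [U] must be differentiable at every level, so that all derivatives of a ridge
    function are again ridge functions of the same chain. *)
Lemma rsm_dot (U : nat -> R -> R) (l : V) :
  (forall p (t : R), is_derive t 1 (U p) (U p.+1 t)) ->
  forall p c, rsm setT (fun x => c * U p (dotv l x)).
Proof.
move=> dU.
have C0 p c x : {for x, continuous (fun x => c * U p (dotv l x))}.
  suff H : {for x, continuous (fun x => U p (dotv l x))}.
    exact: (cvgM (cvg_cst c) H).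
  apply/continuous_norm_near => e e0.
  have cU : {for dotv l x, continuous (U p : R^o -> R)}.
    by apply/differentiable_continuous/derivable1_diffP; have [] := dU p (dotv l x).
  have [d d0 Hd] := (continuous_norm_near (U p : R^o -> R) (dotv l x)).1 cU e e0.
  pose s := \sum_i `|l 0 i| + 1.
  have s0 : 0 < s by rewrite ltr_wpDl // sumr_ge0.
  exists (d / s); first by rewrite divr_gt0.
  move=> y xy; apply: Hd; rewrite -dotvNr -dotvDr.
  apply: (@le_lt_trans _ _ (s * `|x - y|)); last by rewrite mulrC -ltr_pdivlMr.
  apply: le_trans (ler_norm_sum _ _ _) _; rewrite /s mulrDl mul1r.
  apply: ler_wpDr => //; rewrite mulr_suml; apply: ler_sum => i _.
  by rewrite normrM ler_wpM2l // coord_le_norm.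
move=> p c k; elim: k p c => [|k IH] p c; first by split=> // x _; exact: C0.
have D x i : is_derive x (delta_mx 0 i : V) (fun x => c * U p (dotv l x))
    (c * l 0 i * U p.+1 (dotv l x)).
  have := derive_dot i (dU p (dotv l x)) => H.
  have H2 : is_derive x (delta_mx 0 i : V) (c \*: (fun y => U p (dotv l y)))
     (c *: (l 0 i * U p.+1 (dotv l x))) by apply: is_deriveZ.
  by rewrite -mulrA; apply: H2.
split; first by move=> x _; exact: C0.
move=> i; split; first by move=> x _; have [] := D x i.
rewrite (_ : pderiv i _ = fun x => c * l 0 i * U p.+1 (dotv l x)) //.
by apply/funext => x; have [_] := D x i.
Qed.

Definition cis (a : R) : C := (cos a +i* sin a)%C.

Lemma cisD a b : cis (a + b) = cis a * cis b.
Proof.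
rewrite /cis cosD sinD; apply/eqP; rewrite eq_complex /=.
by apply/andP; split; apply/eqP => //; rewrite addrC mulrC [sin b * _]mulrC.
Qed.

Lemma cis0 : cis 0 = 1.
Proof. by rewrite /cis cos0 sin0. Qed.

Lemma normc_cis a : Normc.normc (cis a) = 1.
Proof. by rewrite normcE2 /= cos2Dsin2 sqrtr1. Qed.

Lemma cis_sum I (s : seq I) (P : pred I) (F : I -> R) :
  cis (\sum_(a <- s | P a) F a) = \prod_(a <- s | P a) cis (F a).
Proof. by elim/big_rec2 : _ => [|a x y _ <-]; rewrite ?cis0 ?cisD. Qed.

Lemma cisMn a k : cis (a *+ k) = cis a ^+ k.
Proof. by elim: k => [|k IH]; rewrite ?mulr0n ?cis0 ?expr0 // mulrS cisD IH exprS. Qed.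

(** The cosine and the sine of an affine argument belong to one chain of derivatives, a
    derivative being a shift of the phase by a quarter period. *)
Definition Ucos (s : R) (p : nat) (t : R) : R := cos (t + (s + p%:R * (pi / 2))).

Lemma Ucos_derive s p (t : R) : is_derive t 1 (Ucos s p) (Ucos s p.+1 t).
Proof.
rewrite /Ucos; set a := s + p%:R * (pi / 2).
have -> : cos (t + (s + p.+1%:R * (pi / 2))) = - sin (t + a).
  by rewrite -cosDpihalf -natr1 mulrDl mul1r !addrA.
have H1 : is_derive (t + a) 1 (@cos R) (- sin (t + a)) by exact: is_derive_cos.
have H2 : is_derive t 1 (fun u : R => u + a) 1.
  by have := @is_derive_shift R t 1 a.
have := @is_derive1_comp R (@cos R) (fun u : R => u + a) t _ _ H1 H2.
by rewrite mulr1.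
Qed.

Lemma smooth_cis (l : V) : smooth setT (fun x => cis (dotv l x)).
Proof.
apply/smoothE; split => k.
  have := rsm_dot l (Ucos_derive 0) 0 1 k; apply: Ck_eq; first exact: openT.
  by move=> x _; rewrite mul1r /Ucos mul0r !addr0.
have := rsm_dot l (Ucos_derive (- (pi / 2))) 0 1 k; apply: Ck_eq; first exact: openT.
by move=> x _; rewrite mul1r /Ucos mul0r !addr0 cosBpihalf.
Qed.

Lemma cD_cis (l : V) i x :
  cD i (fun x => cis (dotv l x)) x = (0 +i* l 0 i)%C * cis (dotv l x).
Proof.
have D1 := derive_dot i (is_derive_cos (dotv l x)).
have D2 := derive_dot i (is_derive_sin (dotv l x)).
rewrite /cD /pderiv /reF /imF /=; have [_ ->] := D1; have [_ ->] := D2.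
by apply/eqP; rewrite eq_complex /=; apply/andP; split; apply/eqP; ring.
Qed.

Lemma wD_cis (l : V) w x :
  wD w (fun x => cis (dotv l x)) x = (\prod_(i <- w) (0 +i* l 0 i)%C) * cis (dotv l x).
Proof.
elim: w x => [|i w IH] x; first by rewrite big_nil mul1r.
rewrite /= (cD_eq i openT (fun y _ => IH y)) // (@cDZ _ _ setT) //; [|exact: openT|exact: smooth_cis].
by rewrite cD_cis big_cons mulrA [_ * (0 +i* _)%C]mulrC.
Qed.

End Linear.

(** * The Fourier transform of test functions *)

Section FT.
Variables (R : realType) (n : nat).
Local Notation V := 'rV[R]_n.
Local Notation C := R[i].
Local Notation Nc := (@Normc.normc R).

Definition cint (f : V -> C) : C := (lint (reF f) +i* lint (imF f))%C.
Definition cnice (f : V -> C) := nice (reF f) /\ nice (imF f).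
Definition ft (f : V -> C) (xi : V) : C := cint (fun x => f x * cis (- dotv x xi)).

Definition tf (r : R) (f : V -> C) :=
  smooth setT f /\ forall x, ~ boxc r x -> f x = 0.

Lemma cniceD f g : cnice f -> cnice g -> cnice (fun x => f x + g x).
Proof.
move=> [f1 f2] [g1 g2]; split.
  rewrite (_ : reF _ = fun x => reF f x + reF g x); first exact: niceD.
  by apply/funext => x; rewrite /reF ReImE.
rewrite (_ : imF _ = fun x => imF f x + imF g x); first exact: niceD.
by apply/funext => x; rewrite /imF ReImE.
Qed.

Lemma cniceZ f (c : C) : cnice f -> cnice (fun x => c * f x).
Proof.
move=> [f1 f2]; split.
  rewrite (_ : reF _ = fun x => complex.Re c * reF f x + (- complex.Im c) * imF f x).
    by apply: niceD; exact: niceZ.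
  by apply/funext => x; rewrite /reF /imF ReImE mulNr.
rewrite (_ : imF _ = fun x => complex.Re c * imF f x + complex.Im c * reF f x).
  by apply: niceD; exact: niceZ.
by apply/funext => x; rewrite /imF /reF ReImE.
Qed.

Lemma cintD f g : cnice f -> cnice g -> cint (fun x => f x + g x) = cint f + cint g.
Proof.
move=> [f1 f2] [g1 g2]; rewrite /cint.
rewrite (_ : reF (fun x => f x + g x) = fun x => reF f x + reF g x); last first.
  by apply/funext => x; rewrite /reF ReImE.
rewrite (_ : imF (fun x => f x + g x) = fun x => imF f x + imF g x); last first.
  by apply/funext => x; rewrite /imF ReImE.
by rewrite !lintD.
Qed.

Lemma cintZ f (c : C) : cnice f -> cint (fun x => c * f x) = c * cint f.
Proof.
move=> [f1 f2]; rewrite /cint.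
rewrite (_ : reF (fun x => c * f x) =
   fun x => complex.Re c * reF f x + (- complex.Im c) * imF f x); last first.
  by apply/funext => x; rewrite /reF /imF ReImE mulNr.
rewrite (_ : imF (fun x => c * f x) =
   fun x => complex.Re c * imF f x + complex.Im c * reF f x); last first.
  by apply/funext => x; rewrite /imF /reF ReImE.
rewrite !lintD ?lintZ //; try exact: niceZ.
by rewrite mulNr; case: (c).
Qed.

Lemma cint0 : cint (fun=> 0) = 0.
Proof.
rewrite /cint /reF /imF /=; have -> : lint (fun _ : V => 0) = 0 :> R.
  by rewrite /lint /Rintegral integral0.
by [].
Qed.

Lemma cnice0 : cnice (fun=> 0).
Proof. by split; exact: nice_cst0. Qed.

Lemma cnice_sum I (s : seq I) (F : I -> V -> C) : (forall a, cnice (F a)) ->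
  cnice (fun x => \sum_(a <- s) F a x).
Proof.
move=> nF; elim: s => [|a s IH].
  by under [X in cnice X]funext do rewrite big_nil; exact: cnice0.
under [X in cnice X]funext do rewrite big_cons; exact: cniceD.
Qed.

Lemma cint_sum I (s : seq I) (F : I -> V -> C) : (forall a, cnice (F a)) ->
  cint (fun x => \sum_(a <- s) F a x) = \sum_(a <- s) cint (F a).
Proof.
move=> nF; elim: s => [|a s IH].
  by rewrite big_nil; under [X in cint X]funext do rewrite big_nil; exact: cint0.
rewrite big_cons; under [X in cint X]funext do rewrite big_cons.
by rewrite cintD ?IH //; exact: cnice_sum.
Qed.

Lemma cint_bound f (F : V -> R) : cnice f -> nice F -> (forall x, Nc (f x) <= F x) ->
  Nc (cint f) <= 2 * lint F.
Proof.
move=> [f1 f2] nF fF; apply: le_trans (normc_le_ReIm _) _; rewrite /cint /=.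
rewrite mulr_natl mulr2n; apply: lerD; apply: lint_abs_le => // x.
  exact: le_trans (Re_le_normc _) (fF x).
exact: le_trans (Im_le_normc _) (fF x).
Qed.

Lemma tf_cnice r f : 0 <= r -> tf r f -> cnice f.
Proof.
move=> r0 [sf f0]; split; apply: (nice_cont r0).
- by move=> x; exact: (smooth_contRe sf).
- by move=> x xr; rewrite /reF f0.
- by move=> x; exact: (smooth_contIm sf).
- by move=> x xr; rewrite /imF f0.
Qed.

Lemma tfM r f g : tf r f -> smooth setT g -> tf r (fun x => f x * g x).
Proof.
move=> [sf f0] sg; split; first by apply: smoothM => //; exact: openT.
by move=> x xr; rewrite f0 // mul0r.
Qed.

Lemma tf_cD r f i : 0 <= r -> tf r f -> tf r (cD i f).
Proof.
move=> r0 [sf f0]; split; first exact: smooth_cD.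
move=> x xr; rewrite /cD !(pderiv_out i r0) // => y yr; by rewrite /reF /imF f0.
Qed.

Lemma tf_wD r f w : 0 <= r -> tf r f -> tf r (wD w f).
Proof. by move=> r0 tff; elim: w => //= i w; exact: tf_cD. Qed.

Lemma cint_cD r f i : 0 <= r -> tf r f -> cint (cD i f) = 0.
Proof.
move=> r0 [sf f0]; have /smoothE[s1 s2] := sf.
rewrite /cint /cD /reF /imF /= -/(reF f) -/(imF f).
rewrite !(@lint_pderiv _ _ _ r) //.
- by move=> x; exact: rsm_cont.
- by move=> x; exact: (rsm_der s2).
- by move=> x; exact: (rsm_cont (rsm_pderiv i s2)).
- by move=> x xr; rewrite /imF f0.
- by move=> x; exact: rsm_cont.
- by move=> x; exact: (rsm_der s1).
- by move=> x; exact: (rsm_cont (rsm_pderiv i s1)).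
- by move=> x xr; rewrite /reF f0.
Qed.

Lemma smooth_char xi : smooth setT (fun x : V => cis (- dotv x xi)).
Proof.
apply: smooth_eq (smooth_cis (- xi)); first exact: openT.
by move=> x _; rewrite dotvC dotvNr dotvC.
Qed.

Lemma cD_char xi i (x : V) :
  cD i (fun x => cis (- dotv x xi)) x = (0 +i* - xi 0 i)%C * cis (- dotv x xi).
Proof.
have := cD_cis (- xi) i x; rewrite mxE.
have -> : (fun x => cis (dotv (- xi) x)) = (fun x => cis (- dotv x xi)).
  by apply/funext => y; rewrite dotvC dotvNr.
by rewrite [dotv (- xi) x]dotvC dotvNr.
Qed.

Lemma ft_cD r f i xi : 0 <= r -> tf r f -> ft (cD i f) xi = (0 +i* xi 0 i)%C * ft f xi.
Proof.
move=> r0 tff; have sc := smooth_char xi.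
have := cint_cD i r0 (tfM tff sc).
have n1 : cnice (fun x => cD i f x * cis (- dotv x xi)).
  by apply: (tf_cnice r0); apply: tfM => //; exact: tf_cD.
have n2 : cnice (fun x => f x * cis (- dotv x xi)).
  by apply: (tf_cnice r0); apply: tfM.
have -> : cD i (fun x => f x * cis (- dotv x xi)) =
   fun x => cD i f x * cis (- dotv x xi) +
     (0 +i* - xi 0 i)%C * (f x * cis (- dotv x xi)).
  apply/funext => x; rewrite (@cDM _ _ setT) ?cD_char //; [|exact: openT|exact: tff.1].
  by congr (_ + _); rewrite mulrCA.
rewrite cintD //; last exact: cniceZ.
rewrite cintZ // => /eqP; rewrite addr_eq0 => /eqP E.
rewrite /ft E -mulNr; congr (_ * _).
by apply/eqP; rewrite eq_complex /= oppr0 opprK !eqxx.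
Qed.

Lemma ft_wD r f w xi : 0 <= r -> tf r f ->
  ft (wD w f) xi = (\prod_(i <- w) (0 +i* xi 0 i)%C) * ft f xi.
Proof.
move=> r0 tff; elim: w => [|i w IH]; first by rewrite big_nil mul1r.
by rewrite /= (ft_cD i xi r0 (tf_wD w r0 tff)) IH big_cons mulrA.
Qed.

Lemma normc_im (a : R) : Nc (0 +i* a)%C = `|a|.
Proof. by rewrite normcE2 /= expr0n add0r sqrtr_sqr. Qed.

Lemma normc_prod I (s : seq I) (F : I -> C) :
  Nc (\prod_(a <- s) F a) = \prod_(a <- s) Nc (F a).
Proof. by elim/big_rec2 : _ => [|a x y _ <-]; rewrite ?Normc.normc1 ?Normc.normcM. Qed.

Lemma normc_prod_im w (xi : V) : Nc (\prod_(i <- w) (0 +i* xi 0 i)%C) <= `|xi| ^+ size w.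
Proof.
rewrite normc_prod; elim: w => [|i w IH]; first by rewrite big_nil.
rewrite big_cons exprS normc_im; apply: ler_pM => //.
  by apply: prodr_ge0 => j _; exact: normc_ge0.
exact: coord_le_norm.
Qed.

Lemma ft_bound r f B xi : 0 <= r -> tf r f -> (forall x, Nc (f x) <= B) ->
  Nc (ft f xi) <= 2 * (B * (r *+ 2) ^+ n).
Proof.
move=> r0 tff fB.
have n2 : cnice (fun x => f x * cis (- dotv x xi)).
  by apply: (tf_cnice r0); apply: tfM => //; exact: smooth_char.
rewrite -(lint_ibox n r0) -lintZ; last exact: nice_ibox.
apply: cint_bound => //; first by apply: niceZ; exact: nice_ibox.
move=> x; rewrite Normc.normcM normc_cis mulr1.
have [b|b] := pselect (boxc r x); first by rewrite ibox_in // mulr1.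
by rewrite ibox_out // mulr0 tff.2 // Normc.normc0.
Qed.

Lemma norm_attained (x : V) : `|x| = 0 \/ exists i, `|x| = `|x 0 i|.
Proof.
apply: contrapT => /not_orP[x0 /forallNP H].
have xp : 0 < `|x| by rewrite lt_neqAle eq_sym normr_ge0 andbT; apply/eqP.
have : `|x| < `|x|; last by rewrite ltxx.
apply/normrV_lt => // i; rewrite lt_neqAle coord_le_norm andbT eq_sym.
exact/eqP/H.
Qed.

(** Integrate by parts [p] times along the coordinate in which the frequency is largest. *)
Lemma ft_decay r f B p xi : 0 <= r -> 0 <= B -> tf r f ->
  (forall w, size w = p -> forall x, Nc (wD w f x) <= B) ->
  `|xi| ^+ p * Nc (ft f xi) <= 2 * (B * (r *+ 2) ^+ n).
Proof.
move=> r0 B0 tff fB.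
case: p fB => [|p] fB.
  by rewrite expr0 mul1r; apply: ft_bound tff _ => // x; exact: (fB [::]).
have [x0|[i xi_i]] := norm_attained xi.
  by rewrite x0 expr0n mul0r !mulr_ge0 ?exprn_ge0 ?mulrn_wge0.
have := ft_bound xi r0 (tf_wD (nseq p.+1 i) r0 tff) (fB _ (size_nseq _ _)).
rewrite (ft_wD _ _ r0 tff) Normc.normcM normc_prod big_nseq.
by rewrite iter_mulr_1 normc_im -xi_i.
Qed.

Lemma ft_sub r f g xi : 0 <= r -> tf r f -> tf r g ->
  ft (fun x => f x - g x) xi = ft f xi - ft g xi.
Proof.
move=> r0 tff tfg.
have n1 : cnice (fun x => f x * cis (- dotv x xi)).
  by apply: (tf_cnice r0); apply: tfM => //; exact: smooth_char.
have n2 : cnice (fun x => g x * cis (- dotv x xi)).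
  by apply: (tf_cnice r0); apply: tfM => //; exact: smooth_char.
rewrite /ft -mulN1r -cintZ // -cintD //; last exact: cniceZ.
by congr cint; apply/funext => x; rewrite mulrBl mulN1r.
Qed.

End FT.

(** * Trigonometric approximation *)

Section Kernel.
Variable R : realType.
Local Notation C := R[i].
Local Notation mu1 := (@lebesgue_measure R).

(** A nonnegative trigonometric polynomial that concentrates at the multiples of the period,
    because the base is smaller than 1 elsewhere. *)
Definition ker N (s : R) : R := ((1 + cos s) / 2) ^+ N.
(** The Fourier coefficients of [ker N], by the binomial theorem applied to the square of
    the cosine of the half angle. *)
Definition kc N (j : nat) : R := 'C(2 * N, j)%:R / 4 ^+ N.

Lemma kc_ge0 N j : 0 <= kc N j.
Proof. by rewrite divr_ge0. Qed.

Lemma bin_le_mid N j : ('C(2 * N, j) <= 'C(2 * N, N))%N.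
Proof.
have up i : (i < N)%N -> ('C(2 * N, i) <= 'C(2 * N, i.+1))%N.
  move=> iN; rewrite -(leq_pmul2l (ltn0Sn i)) mul_bin_left.
  by rewrite leq_mul2r; apply/orP; right; lia.
have low k : (k <= N)%N -> ('C(2 * N, N - k) <= 'C(2 * N, N))%N.
  elim: k => [|k IH] kN; first by rewrite subn0.
  apply: leq_trans (IH (ltnW kN)); have := up (N - k.+1)%N; rewrite subnSK //.
  by apply; lia.
have [jN|Nj] := leqP j N; first by rewrite -(subKn jN); apply: low; lia.
have [j2|j2] := leqP j (2 * N); last by rewrite bin_small.
rewrite -bin_sub // (_ : (2 * N - j = N - (j - N))%N); last by lia.
by apply: low; lia.
Qed.

Lemma kc_le_mid N j : kc N j <= kc N N.
Proof. by rewrite ler_wpM2r ?invr_ge0 ?exprn_ge0 // ler_nat bin_le_mid. Qed.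

(** The middle coefficient is the mean of the kernel; it decreases only polynomially in [N]
    since it is the largest of [2 N + 1] coefficients with sum 1. *)
Lemma kc_mid_ge N : 1 <= (2 * N + 1)%:R * kc N N.
Proof.
rewrite /kc mulrA ler_pdivlMr ?exprn_gt0 // mul1r -natrM.
rewrite (_ : 4 ^+ N = (2 ^ (2 * N))%:R :> R); last by rewrite expnM natrX.
rewrite ler_nat -(addn1 1%N) Pascal.
apply: (@leq_trans (\sum_(i < (2 * N).+1) 'C(2 * N, N))).
  by apply: leq_sum => i _; rewrite !exp1n !muln1 bin_le_mid.
by rewrite sum_nat_const card_ord addn1.
Qed.

Lemma ker_expand N s : ((ker N s)%:C)%C =
  \sum_(j < (2 * N).+1) ((kc N j)%:C)%C * cis ((j%:R - N%:R) * s).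
Proof.
have E1 : (((2 * cos (s / 2)) ^+ (2 * N))%:C)%C =
    \sum_(j < (2 * N).+1) ('C(2 * N, j)%:R%:C)%C * cis ((j%:R - N%:R) * s).
  rewrite rmorphXn /=.
  have -> : ((2 * cos (s / 2))%:C)%C = cis (- (s / 2)) + cis (s / 2).
    apply/eqP; rewrite eq_complex /= cosN sinN addNr eqxx andbT.
    by apply/eqP; ring.
  rewrite exprDn; apply: eq_bigr => j _.
  rewrite -!cisMn -cisD -mulr_natl; congr (_ * cis _).
    by rewrite (rmorph_nat (real_complex R)).
  have jN : (j <= 2 * N)%N by rewrite -ltnS.
  by rewrite -mulNrn -[X in X + _]mulr_natr -[X in _ + X]mulr_natr natrB // natrM; field.
have -> : ker N s = (2 * cos (s / 2)) ^+ (2 * N) / 4 ^+ N.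
  rewrite /ker exprM -expr_div_n; congr (_ ^+ _).
  rewrite exprMn (_ : cos s = 2 * cos (s / 2) ^+ 2 - 1).
    by field.
  rewrite [in LHS](splitr s) cosD -!expr2.
  have := cos2Dsin2 (s / 2) => /(canRL (addKr _)) ->; ring.
rewrite rmorphM /= E1 mulr_suml; apply: eq_bigr => j _.
by rewrite /kc rmorphM /= mulrAC.
Qed.

Lemma ker_expandR N s :
  ker N s = \sum_(j < (2 * N).+1) kc N j * cos ((j%:R - N%:R) * s).
Proof.
have := ker_expand N s => /(congr1 (@complex.Re R)) /=.
rewrite raddf_sum /= => ->; apply: eq_bigr => j _.
by rewrite mul0r subr0.
Qed.

Lemma sin_2npi (a : R) k : sin (a + pi *+ 2 *+ k) = sin a.
Proof. by elim: k => [|k IH]; rewrite ?mulr0n ?addr0 // mulrSr addrA sinD2pi. Qed.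

(** The sine takes the same value at both ends of a period, so only the constant character
    has a nonzero integral. *)
Lemma int_cos_period (w a : R) (d : R) k : 0 < w -> d = k%:R \/ d = - k%:R ->
  \int[mu1]_(t in `[- (pi / w), pi / w]) cos (d * (w * (a - t))) =
  if k == 0%N then pi / w *+ 2 else 0.
Proof.
move=> w0 dk; have pw : 0 < pi / w by rewrite divr_gt0 ?pi_gt0.
have pp : - (pi / w) < pi / w by rewrite gtrN.
have cD0 : {within `[- (pi / w), pi / w], continuous (fun t => cos (d * (w * (a - t))) : R)}.
  apply: continuous_subspaceT => t.
  apply: (@continuous_comp _ _ _ (fun t => d * (w * (a - t))) (@cos R)); last exact: continuous_cos.
  apply: cvgM; first exact: cvg_cst.
  apply: cvgM; first exact: cvg_cst.
  by apply: cvgB; [exact: cvg_cst|exact: cvg_id].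
case: eqP => k0.
  have -> : d = 0 by case: dk; rewrite k0 ?oppr0.
  under eq_Rintegral do rewrite mul0r cos0.
  rewrite Rintegral_cst //= mul1r (lebesgue_sym_itv (ltW pw)) //.
have d0 : d != 0 by case: dk => ->; rewrite ?oppr_eq0 pnatr_eq0; apply/eqP.
pose F t := - (sin (d * (w * (a - t))) / (d * w)).
have dF (t : R) : is_derive t 1 F (cos (d * (w * (a - t)))).
  have -> : cos (d * (w * (a - t))) =
     - ((d * w)^-1 * (cos (d * (w * (a - t))) * (d * (w * (0 - 1))))).
    by field; rewrite d0 gt_eqF.
  apply: is_deriveN.
  have H : is_derive t 1 (fun t => sin (d * (w * (a - t))))
      (cos (d * (w * (a - t))) * (d * (w * (0 - 1)))).
    apply: (@is_derive1_comp R (@sin R) (fun t => d * (w * (a - t)))).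
  have := is_deriveZ (d * w)^-1 H.
  congr (is_derive _ _ _ _); apply/funext => u /=.
  by rewrite [RHS]mulrC.
rewrite /Rintegral (@continuous_FTC2 _ _ F) //.
- rewrite -EFinB /F /= opprK.
  set A := d * (w * (a - pi / w)); set B := d * (w * (a - - (pi / w))).
  suff -> : sin B = sin A by rewrite addNr.
  have BA : B = A + d * (pi *+ 2) by rewrite /A /B; field; rewrite gt_eqF.
  case: dk => dk.
    by rewrite BA dk mulr_natl sin_2npi.
  have -> : A = B + k%:R * (pi *+ 2) by rewrite BA dk; ring.
  by rewrite mulr_natl sin_2npi.
- have cF : continuous F.
    by move=> t; apply/differentiable_continuous/derivable1_diffP; have [] := dF t.
  split; first by move=> t _; have [] := dF t.
  + by apply: cvg_at_right_filter; exact: cF.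
  + by apply: cvg_at_left_filter; exact: cF.
- by move=> t _; rewrite derive1E; have [] := dF t.
Qed.

Lemma continuous_ker N (w a : R) : continuous (fun t : R => ker N (w * (a - t))).
Proof.
move=> t; apply: (@continuous_comp _ _ _ (fun t => w * (a - t)) (ker N)).
  apply: cvgM; first exact: cvg_cst.
  by apply: cvgB; [exact: cvg_cst|exact: cvg_id].
rewrite /ker; apply: (@continuous_comp _ _ _ (fun s => (1 + cos s) / 2) (fun u => u ^+ N)); last exact: exprn_continuous.
apply: cvgM; last exact: cvg_cst.
by apply: cvgD; [exact: cvg_cst|exact: continuous_cos].
Qed.

Lemma int_ker N (w a : R) : 0 < w ->
  \int[mu1]_(t in `[- (pi / w), pi / w]) ker N (w * (a - t)) = kc N N * (pi / w *+ 2).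
Proof.
move=> w0.
have cc j : continuous (fun t : R => cos ((j - N%:R) * (w * (a - t)))).
  move=> t; apply: (@continuous_comp _ _ _ (fun t => (j - N%:R) * (w * (a - t))) (@cos R)); last exact: continuous_cos.
  apply: cvgM; first exact: cvg_cst.
  apply: cvgM; first exact: cvg_cst.
  by apply: cvgB; [exact: cvg_cst|exact: cvg_id].
under eq_Rintegral do rewrite ker_expandR.
have int1 j : mu1.-integrable `[- (pi / w), pi / w]
    (EFin \o (fun t : R => cos ((j - N%:R) * (w * (a - t))))).
  by apply: continuous_compact_integrable; [exact: segment_compact|apply: continuous_subspaceT].
have ints (s : seq 'I_(2 * N).+1) : mu1.-integrable `[- (pi / w), pi / w] (EFin \o
    (fun t : R => \sum_(j <- s) kc N j * cos ((j%:R - N%:R) * (w * (a - t))))) /\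
   \int[mu1]_(t in `[- (pi / w), pi / w])
     (\sum_(j <- s) kc N j * cos ((j%:R - N%:R) * (w * (a - t)))) =
   \sum_(j <- s) kc N j *
     \int[mu1]_(t in `[- (pi / w), pi / w]) cos ((j%:R - N%:R) * (w * (a - t))).
  elim: s => [|j s [IH1 IH2]].
    split; first by under [X in _.-integrable _ (_ \o X)]funext do rewrite big_nil; exact: integrable0.
    by under eq_Rintegral do rewrite big_nil; rewrite big_nil /Rintegral integral0.
  have i1 : mu1.-integrable `[- (pi / w), pi / w]
     (EFin \o (fun t : R => kc N j * cos ((j%:R - N%:R) * (w * (a - t))))).
    exact: (integrableZl _ _ (int1 j%:R)).
  split.
    under [X in _.-integrable _ (_ \o X)]funext do rewrite big_cons.
    exact: (integrableD _ i1 IH1).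
  under eq_Rintegral do rewrite big_cons.
  by rewrite RintegralD // IH2 RintegralZl // big_cons.
rewrite (ints _).2 (bigD1 (inord N : 'I_(2 * N).+1)) //=.
have NN : nat_of_ord (inord N : 'I_(2 * N).+1) = N by rewrite inordK //; lia.
rewrite NN (@int_cos_period _ _ _ 0%N) //=; last by left; rewrite subrr.
rewrite big1 ?addr0 // => j jN.
have jN' : (nat_of_ord j != N) by apply: contra jN => /eqP E; apply/eqP/val_inj; rewrite /= NN.
rewrite (@int_cos_period _ _ _ `|(j : int) - (N : int)|%N) //.
  by rewrite absz_eq0 subr_eq0 eqz_nat (negbTE jN') mulr0.
have [jN2|Nj] := leqP j N.
  right; rewrite distnC distnEl // natrB // opprB //.
by left; rewrite distnEl ?natrB // ltnW.
Qed.

End Kernel.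

Section Approximation.
Variables (R : realType) (n : nat).
Local Notation V := 'rV[R]_n.
Local Notation C := R[i].
Local Notation Nc := (@Normc.normc R).

(** The frequencies [lam] form a finite lattice of mesh [w]; the weights [Wt] are the
    coefficients of the product kernel divided by its integral over a period. *)
Definition lam (w : R) N (k : {ffun 'I_n -> 'I_(2 * N).+1}) : V :=
  \row_i (((k i)%:R - N%:R) * w).

Definition Wt (w : R) N (k : {ffun 'I_n -> 'I_(2 * N).+1}) : R :=
  (\prod_i kc R N (k i)) / (kc R N N * (pi / w *+ 2)) ^+ n.

(** For [G] the Fourier transform of a function this is the convolution of that function with
    the normalised kernel (lemma [trig_kernel]): a substitute for Fourier inversion in which
    only finite sums occur. *)
Definition trig (w : R) N (G : V -> C) (x : V) : C :=
  \sum_(k : {ffun 'I_n -> 'I_(2 * N).+1})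
     ((Wt w k)%:C)%C * G (lam w k) * cis (dotv (lam w k) x).

Definition kerV (w : R) N (x y : V) : R := \prod_i ker N (w * (x 0 i - y 0 i)).

Lemma kc_mid_gt0 N : 0 < kc R N N.
Proof.
have := kc_mid_ge R N; rewrite lt_neqAle kc_ge0 andbT => H.
by apply/eqP => E; move: H; rewrite -E mulr0 ler10.
Qed.

Lemma Wt_ge0 w N k : 0 < w -> 0 <= @Wt w N k.
Proof.
move=> w0; rewrite divr_ge0 ?prodr_ge0 // => [i _|]; first exact: kc_ge0.
by rewrite exprn_ge0 // mulr_ge0 ?kc_ge0 // mulrn_wge0 // divr_ge0 ?pi_ge0 // ltW.
Qed.

Lemma Wt_le w N k : 0 < w -> @Wt w N k <= (pi / w *+ 2) ^- n.
Proof.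
move=> w0; have p0 : 0 < pi / w *+ 2 :> R by rewrite pmulrn_lgt0 // divr_gt0 ?pi_gt0.
rewrite /Wt exprMn invfM mulrA ler_piMl ?invr_ge0 ?exprn_ge0 ?(ltW p0) //.
rewrite ler_pdivrMr ?exprn_gt0 ?kc_mid_gt0 // mul1r.
rewrite -[X in _ <= _ ^+ X]card_ord -prodr_const.
by apply: ler_prod => i _; rewrite kc_ge0 kc_le_mid.
Qed.

Lemma kerV_expand w N x y : ((kerV w N x y)%:C)%C =
  \sum_(k : {ffun 'I_n -> 'I_(2 * N).+1}) ((\prod_i kc R N (k i))%:C)%C *
     (cis (dotv (lam w k) x) * cis (- dotv y (lam w k))).
Proof.
rewrite /kerV rmorph_prod /=.
under eq_bigr do rewrite ker_expand.
rewrite bigA_distr_bigA /=; apply: eq_bigr => k _.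
rewrite big_split /= -rmorph_prod /= -cis_sum -cisD; congr (_ * cis _).
rewrite [dotv y _]dotvC -dotvNr -dotvDr /dotv; apply: eq_bigr => i _.
by rewrite !mxE; ring.
Qed.

Lemma ker_ge0 N (s : R) : 0 <= ker N s.
Proof. by rewrite exprn_ge0 // divr_ge0 //; have := cos_geN1 s; lra. Qed.

Lemma kerV_ge0 w N x y : 0 <= kerV w N x y.
Proof. by apply: prodr_ge0 => i _; exact: ker_ge0. Qed.

Lemma continuous_kerV w N x : continuous (kerV w N x : V -> R).
Proof.
apply: (@continuous_prod R _ _ _ (fun i (y : V) => ker N (w * (x 0 i - y 0 i)))) => i.
apply: (@continuous_coord R n (fun t => ker N (w * (x 0 i - t))) i).
exact: continuous_ker.
Qed.

Lemma lint_kerV w N x : 0 < w ->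
  lint (fun y => ibox (pi / w) y * kerV w N x y) = (kc R N N * (pi / w *+ 2)) ^+ n.
Proof.
move=> w0; have p0 : 0 <= pi / w :> R by rewrite divr_ge0 ?pi_ge0 // ltW.
rewrite (lint_prod p0 (fun i => @continuous_ker R N w (x 0 i))).
under eq_bigr do rewrite int_ker //.
by rewrite prodr_const card_ord.
Qed.

Lemma cnice_mul_bounded (g : V -> C) (h : V -> C) : cnice g ->
  continuous (reF h) -> continuous (imF h) -> cnice (fun x => h x * g x).
Proof.
move=> [n1 n2] c1 c2.
have nb r (c : V -> R) u : 0 <= r -> continuous c -> nice u ->
    (forall x, ~ boxc r x -> u x = 0) -> nice (fun x => c x * u x).
  move=> r0 cc nu u0.
  rewrite (_ : (fun x => _) = fun x => ibox r x * c x * u x).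
    by apply: niceM => //; exact: nice_box.
  apply/funext => x; have [b|b] := pselect (boxc r x); first by rewrite ibox_in // mul1r.
  by rewrite u0 // !mulr0.
have nb2 (c : V -> R) u : continuous c -> nice u -> nice (fun x => c x * u x).
  by move=> cc nu; have [_ [r [B [r0 H]]]] := nu; apply: (nb r) => // x /(H x).2.
split.
  rewrite (_ : reF _ = fun x => reF h x * reF g x + (-1) * (imF h x * imF g x)).
    by apply: niceD; [exact: nb2|apply: niceZ; exact: nb2].
  by apply/funext => x; rewrite /reF /imF ReImE mulN1r.
rewrite (_ : imF _ = fun x => reF h x * imF g x + imF h x * reF g x).
  by apply: niceD; exact: nb2.
by apply/funext => x; rewrite /reF /imF ReImE.
Qed.

Lemma cnice_char (g : V -> C) xi : cnice g -> cnice (fun x => g x * cis (- dotv x xi)).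
Proof.
move=> ng; under [X in cnice X]funext do rewrite mulrC.
apply: cnice_mul_bounded => // x.
  exact: (smooth_contRe (smooth_char xi)).
exact: (smooth_contIm (smooth_char xi)).
Qed.

Lemma trig_kernel w N (g : V -> C) x : cnice g ->
  trig w N (ft g) x = cint (fun y =>
    ((((kc R N N * (pi / w *+ 2)) ^+ n)^-1 * kerV w N x y)%:C)%C * g y).
Proof.
move=> ng; rewrite /trig; set m := _ ^+ n.
transitivity (cint (fun y => \sum_(k : {ffun 'I_n -> 'I_(2 * N).+1})
    (((Wt w k)%:C)%C * cis (dotv (lam w k) x)) * (g y * cis (- dotv y (lam w k))))).
  rewrite cint_sum; last by move=> k; apply: cniceZ; exact: cnice_char.
  apply: eq_bigr => k _; rewrite cintZ; last exact: cnice_char.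
  by rewrite /ft; set I := cint _; rewrite mulrAC.
congr cint; apply/funext => y; rewrite rmorphM /= kerV_expand mulr_sumr mulr_suml.
apply: eq_bigr => k _; rewrite /Wt rmorphM /= -/m.
move: (cis _) (cis _) (g y) (((m^-1)%:C)%C) => a b c d; move: ((\prod_i _)%:C)%C => e.
by ring.
Qed.

Lemma unif_cont (g : V -> C) r e : continuous (reF g) -> continuous (imF g) -> 0 < e ->
  exists2 d, 0 < d & forall x y, boxc r x -> `|x - y| < d -> Nc (g x - g y) < e.
Proof.
move=> c1 c2 e0.
pose Q (B : set V) := exists2 d, 0 < d &
  forall x y, B x -> `|x - y| < d -> Nc (g x - g y) < e.
apply: (@compact_ind _ (boxc r) Q).
- exact: compact_boxc.
- by exists 1.
- move=> A B [d d0 Hd] [d' d0' Hd']; exists (Num.min d d'); first by rewrite lt_min d0.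
  by move=> x y [Ax|Bx]; rewrite lt_min => /andP[xd xd']; [exact: Hd|exact: Hd'].
- by move=> A B AB [d d0 Hd]; exists d => // x y /AB; exact: Hd.
move=> x0 _.
have e4 : 0 < e / 4 by rewrite divr_gt0.
have [d1 d10 H1] := (continuous_norm_near (reF g) x0).1 (c1 x0) _ e4.
have [d2 d20 H2] := (continuous_norm_near (imF g) x0).1 (c2 x0) _ e4.
pose d := Num.min d1 d2.
have d0 : 0 < d by rewrite lt_min d10.
have H z : `|x0 - z| < d -> Nc (g x0 - g z) < e / 2.
  rewrite lt_min => /andP[/H1 h1 /H2 h2].
  apply: le_lt_trans (normc_le_ReIm _) _; rewrite !ReImE.
  by have := ltrD h1 h2; rewrite /reF /imF; lra.
exists (ball x0 (d / 2)); first by apply: nbhsx_ballx; rewrite divr_gt0.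
exists (d / 2); first by rewrite divr_gt0.
move=> x y; rewrite -ball_normE /= => xx0 xy.
have -> : g x - g y = (g x0 - g y) - (g x0 - g x) by ring.
apply: le_lt_trans (normcB _ _) _.
have a1 : Nc (g x0 - g x) < e / 2.
  apply: H; apply: lt_trans xx0 _; lra.
have a2 : Nc (g x0 - g y) < e / 2.
  apply: H; rewrite -(subrK x x0) -addrA; apply: le_lt_trans (ler_normD _ _) _; lra.
by have := ltrD a2 a1; lra.
Qed.

(** Powers of [Q] are compared with the exponential, which beats every polynomial. *)
Lemma poly_geom (Q K e : R) m : 0 <= Q < 1 -> 0 <= K -> 0 < e ->
  exists N0, forall N, (N0 <= N)%N -> K * (2 * N + 1)%:R ^+ m * Q ^+ N <= e.
Proof.
move=> /andP[Q0 Q1] K0 e0.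
pose s := (1 - Q) / m.+1%:R.
have s0 : 0 < s by rewrite divr_gt0 // subr_gt0.
have QN N : Q ^+ N * (1 + s * N%:R) ^+ m.+1 <= 1.
  have : Q ^+ N * expR (s * N%:R) ^+ m.+1 <= 1.
    rewrite -expRM_natl.
    have -> : m.+1%:R * (s * N%:R) = N%:R * (1 - Q).
      by rewrite /s mulrA [m.+1%:R * _]mulrC divfK ?pnatr_eq0 // mulrC.
    rewrite expRM_natl -exprMn; apply: exprn_ile1.
      by rewrite mulr_ge0 ?expR_ge0.
    have := expR_ge1Dx (- (1 - Q)); rewrite expRN => H.
    have e1 := expR_gt0 (1 - Q).
    have : Q <= (expR (1 - Q))^-1 by apply: le_trans H; lra.
    by rewrite -div1r ler_pdivlMr.
  apply: le_trans; rewrite ler_wpM2l ?exprn_ge0 // lerXn2r ?nnegrE ?expR_ge0 ?expR_ge1Dx //.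
  by rewrite addr_ge0 // mulr_ge0 // ltW.
pose L := 1 + 2 / s.
have L0 : 0 < L by rewrite ltr_pwDl // divr_ge0 // ltW.
have LN N : (2 * N + 1)%:R <= L * (1 + s * N%:R) :> R.
  have -> : L * (1 + s * N%:R) = 1 + s * N%:R + (2 / s + 2 * N%:R).
    by rewrite /L mulrDl mul1r [2 / s * _]mulrDr mulr1 [2 / s * (_ * _)]mulrA divfK ?gt_eqF.
  rewrite natrD natrM.
  have h1 : 0 <= s * N%:R by rewrite mulr_ge0 // ltW.
  have h2 : 0 <= 2 / s by rewrite divr_ge0 // ltW.
  lra.
have [N0 HN0] : exists N0 : nat, K * L ^+ m / (s * e) <= N0%:R.
  exists (Num.truncn (K * L ^+ m / (s * e))).+1.
  by apply/ltW/truncnS_gt.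
exists N0 => N NN.
have D0 : 0 < 1 + s * N%:R by rewrite ltr_pwDl // mulr_ge0 // ltW.
have h1 : K * (2 * N + 1)%:R ^+ m * Q ^+ N <= K * (L * (1 + s * N%:R)) ^+ m * Q ^+ N.
  rewrite ler_wpM2r ?exprn_ge0 // ler_wpM2l // lerXn2r ?nnegrE //.
  by rewrite mulr_ge0 // ltW.
apply: le_trans h1 _.
have h2 : K * (L * (1 + s * N%:R)) ^+ m * Q ^+ N * (1 + s * N%:R) <= K * L ^+ m.
  have := QN N; move: (1 + s * N%:R) => D HD.
  have -> : K * (L * D) ^+ m * Q ^+ N * D = K * L ^+ m * (Q ^+ N * D ^+ m.+1).
    by rewrite exprMn exprS; ring.
  by rewrite ler_piMr // mulr_ge0 // exprn_ge0 // ltW.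
rewrite -(ler_pM2r D0); apply: le_trans h2 _.
have h3 : K * L ^+ m / (s * e) <= N%:R.
  by apply: le_trans HN0 _; rewrite ler_nat.
have se : 0 < s * e by exact: mulr_gt0.
rewrite (ler_pdivrMr _ _ se) in h3.
apply: le_trans h3 _; rewrite mulrA mulrDr mulr1 [N%:R * s]mulrC [_ * e]mulrC.
by rewrite ler_wpDl // ltW.
Qed.

Lemma cos_away (d s : R) : 0 < d <= 1 -> d <= `|s| <= pi + 1 -> cos s <= cos d.
Proof.
move=> /andP[d0 d1] /andP[ds sp].
have ph := pihalf_ge1 R; have p2 := pi_ge2 R.
have -> : cos s = cos `|s| by have [_|_] := ger0P s; rewrite ?cosN.
have [sl|sl] := leP `|s| pi.
  have [->//|/eqP nds] := eqVneq d `|s|.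
  apply/ltW; rewrite ltr_cos ?in_itv /=; first by rewrite lt_neqAle ds andbT; apply/eqP.
    by apply/andP; split; lra.
  by apply/andP; split; lra.
have c1 : cos `|s| <= 0.
  rewrite -(subrK pi `|s|) cosDpi oppr_le0; apply: cos_ge0_pihalf.
  by apply/andP; split; lra.
apply: le_trans c1 _; apply: cos_ge0_pihalf; by apply/andP; split; lra.
Qed.

Lemma ker_le1 N (s : R) : ker N s <= 1.
Proof.
apply: exprn_ile1; first by rewrite divr_ge0 //; have := cos_geN1 s; lra.
by have := cos_le1 s; lra.
Qed.

Lemma prodr_le_factor (I : finType) (F : I -> R) i :
  (forall j, 0 <= F j <= 1) -> \prod_j F j <= F i.
Proof.
move=> H; rewrite (bigD1 i) //= -[leRHS]mulr1 ler_wpM2l //.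
  by have /andP[] := H i.
by apply: prodr_ile1 => j _; exact: H.
Qed.

(** The kernel has mass one over a period, and the period is so long that seen from the box
    only one peak of the kernel lies in it. Near the diagonal the uniform continuity of [g] gives the estimate; away from it the
    kernel is a power of some [Q < 1], while its normalisation is only polynomial in [N]. *)
Lemma trig_approx w r (g : V -> C) e : 0 < w -> 0 <= r -> w * r <= 1 ->
  cnice g -> continuous (reF g) -> continuous (imF g) ->
  (forall x, ~ boxc r x -> g x = 0) -> 0 < e ->
  exists N0, forall N, (N0 <= N)%N -> forall x, boxc r x ->
    Nc (g x - trig w N (ft g) x) <= e.
Proof.
move=> w0 r0 wr ng c1 c2 g0 e0.
have e4 : 0 < e / 4 by rewrite divr_gt0.
have [d d0 Hd] := unif_cont r c1 c2 e4.
have [S HS] : exists S, forall x, Nc (g x) <= S.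
  have [[m1 [r1 [B1 [r1p H1]]]] [m2 [r2 [B2 [r2p H2]]]]] := ng.
  exists (B1 + B2) => x; apply: le_trans (normc_le_ReIm _) _.
  by apply: lerD; [exact: (H1 x).1|exact: (H2 x).1].
have S0 : 0 <= S by apply: le_trans (HS 0); exact: normc_ge0.
pose vp : R := pi / w.
have vp0 : 0 < vp by rewrite divr_gt0 ?pi_gt0.
(* The condition [w * r <= 1] puts the box well inside a period, so that the difference
   of a point of the box and a point of the period stays away from the other peaks. *)
have rvp : r <= vp by rewrite ler_pdivlMr // mulrC; apply: le_trans wr _; have := pi_ge2 R; lra.
pose d' := Num.min (w * d) 1.
have d'0 : 0 < d' by rewrite lt_min mulr_gt0 ?ltr01.
have d'1 : d' <= 1 by rewrite ge_min lexx orbT.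
pose Q := (1 + cos d') / 2.
have Q0 : 0 <= Q by rewrite divr_ge0 //; have := cos_geN1 d'; lra.
have Q1 : Q < 1.
  suff : cos d' < 1 by rewrite /Q; lra.
  rewrite -[ltRHS]cos0 ltr_cos // in_itv /= ?lexx ?pi_ge0 //.
  by rewrite (ltW d'0); have := pi_ge2 R; lra.
have [N0 HN0] := @poly_geom Q (4 * S) (e / 2) n ltac:(by rewrite Q0) ltac:(by rewrite mulr_ge0) ltac:(by rewrite divr_gt0).
exists N0 => N NN x bx.
set m := (kc R N N * (vp *+ 2)) ^+ n.
have m0 : 0 < m by rewrite exprn_gt0 // mulr_gt0 ?kc_mid_gt0 // pmulrn_lgt0.
pose k y := ibox vp y * kerV w N x y.
have nk : nice k by apply: nice_box; [exact: ltW|exact: continuous_kerV].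
have Ek : lint k = m by exact: lint_kerV.
have nck : cnice (fun y => ((m^-1 * k y)%:C)%C).
  by split; [exact: niceZ|rewrite (_ : imF _ = fun=> 0) //; exact: nice_cst0].
have n1 : cnice (fun y => g x * ((m^-1 * k y)%:C)%C) by exact: cniceZ.
have n2 : cnice (fun y => ((m^-1 * k y)%:C)%C * g y).
  have [h1 h2] := nck; have [h3 h4] := ng; split.
    rewrite (_ : reF _ = fun y => m^-1 * k y * reF g y).
      by apply: niceM => //; exact: niceZ.
    by apply/funext => y; rewrite /reF /imF ReImE /= mul0r subr0.
  rewrite (_ : imF _ = fun y => m^-1 * k y * imF g y).
    by apply: niceM => //; exact: niceZ.
  by apply/funext => y; rewrite /reF /imF ReImE /= mul0r addr0.
have E1 : g x = cint (fun y => g x * ((m^-1 * k y)%:C)%C).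
  rewrite cintZ // /cint (_ : reF _ = fun y => m^-1 * k y) //.
  rewrite (_ : imF _ = fun=> 0) // lintZ // Ek mulVf ?gt_eqF //.
  have -> : lint (fun _ : V => 0) = 0 :> R by rewrite /lint /Rintegral integral0.
  by rewrite (_ : (1 +i* 0)%C = 1) ?mulr1.
have E2 : trig w N (ft g) x = cint (fun y => ((m^-1 * k y)%:C)%C * g y).
  rewrite trig_kernel //; congr cint; apply/funext => y.
  have [b|b] := pselect (boxc r y); last by rewrite g0 // !mulr0.
  congr (_%:C%C * _); congr (_ * _); rewrite /k ibox_in ?mul1r // => i.
  exact: le_trans (b i) rvp.
rewrite {1}E1 E2 -mulN1r -cintZ // -cintD //; last exact: cniceZ.
(* The two terms bound the integrand near the diagonal and away from it. *)
pose F y := m^-1 * (e / 4) * k y + m^-1 * (2 * S * Q ^+ N) * ibox vp y.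
have nF : nice F by apply: niceD; apply: niceZ => //; exact: nice_ibox (ltW vp0).
apply: (@le_trans _ _ (2 * lint F)).
  apply: cint_bound => //; first by apply: cniceD => //; exact: cniceZ.
  move=> y.
  have -> : g x * ((m^-1 * k y)%:C)%C + -1 * (((m^-1 * k y)%:C)%C * g y) =
     ((m^-1 * k y)%:C)%C * (g x - g y) by ring.
  rewrite Normc.normcM normc_real normrM (ger0_norm (ltW (_ : 0 < m^-1))) ?invr_gt0 //.
  have k0 : 0 <= k y by rewrite mulr_ge0 ?ibox_ge0 ?kerV_ge0.
  have -> : F y = m^-1 * (e / 4 * k y + 2 * S * Q ^+ N * ibox vp y) by rewrite /F; ring.
  rewrite (ger0_norm k0) -[X in X <= _]mulrA; apply: ler_wpM2l; first by rewrite invr_ge0 ltW.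
  have S2 : Nc (g x - g y) <= 2 * S.
    by apply: le_trans (normcB _ _) _; rewrite mulr_natl mulr2n lerD.
  have F2 : 0 <= 2 * S * Q ^+ N * ibox vp y.
    by rewrite !mulr_ge0 ?exprn_ge0 ?ibox_ge0.
  have [xyd|xyd] := ltP `|x - y| d.
    apply: ler_wpDr => //; rewrite mulrC ler_wpM2r //.
    exact/ltW/Hd.
  have [b|b] := pselect (boxc vp y); last first.
    by rewrite /k ibox_out // !mul0r !mulr0 addr0.
  apply: ler_wpDl; first by rewrite mulr_ge0 // divr_ge0 // ltW.
  rewrite /k ibox_in // mul1r mulr1 [leRHS]mulrC ler_pM ?normc_ge0 ?kerV_ge0 //.
  have [xy0|[i Hi]] := norm_attained (x - y).
    by move: xyd; rewrite xy0 leNgt d0.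
  apply: (@le_trans _ _ (ker N (w * (x 0 i - y 0 i)))).
    by apply: (@prodr_le_factor _ (fun i => ker N (w * (x 0 i - y 0 i)))) => j;
      rewrite ker_ge0 ker_le1.
  have c0 : 0 <= (1 + cos (w * (x 0 i - y 0 i))) / 2.
    by rewrite divr_ge0 //; have := cos_geN1 (w * (x 0 i - y 0 i)); lra.
  rewrite /ker; apply: lerXn2r; rewrite ?nnegrE //.
  rewrite ler_pM2r ?invr_gt0 // lerD2l; apply: cos_away; first by rewrite d'0.
  rewrite Hi !mxE in xyd; rewrite normrM (gtr0_norm w0).
  apply/andP; split.
    by rewrite ge_min; apply/orP; left; rewrite ler_pM2l.
  have h1 := bx i; have h2 := b i.
  have h3 : `|x 0 i - y 0 i| <= r + vp by apply: le_trans (ler_normB _ _) _; exact: lerD.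
  apply: le_trans (_ : w * (r + vp) <= _); first by rewrite ler_pM2l.
  by rewrite mulrDr /vp mulrCA divff ?gt_eqF // mulr1 addrC lerD2l.
rewrite /F lintD; [|exact: niceZ|by apply: niceZ; exact: nice_ibox (ltW vp0)].
rewrite !lintZ //; last exact: nice_ibox (ltW vp0).
rewrite Ek lint_ibox ?(ltW vp0) //.
have -> : m^-1 * (e / 4) * m = e / 4 by field; rewrite gt_eqF.
rewrite mulrDr; have -> : 2 * (e / 4) = e / 2 by field.
suff H : 2 * (m^-1 * (2 * S * Q ^+ N) * (vp *+ 2) ^+ n) <= e / 2 by lra.
apply: le_trans (HN0 N NN).
have -> : 2 * (m^-1 * (2 * S * Q ^+ N) * (vp *+ 2) ^+ n) =
   4 * S * (m^-1 * (vp *+ 2) ^+ n) * Q ^+ N by ring.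
rewrite ler_wpM2r ?exprn_ge0 // ler_wpM2l ?mulr_ge0 //.
have vn : 0 < vp *+ 2 by rewrite pmulrn_lgt0.
rewrite /m exprMn invfM -mulrA mulVf ?mulr1 ?expf_neq0 ?gt_eqF //.
rewrite -exprVn lerXn2r ?nnegrE ?invr_ge0 ?kc_ge0 //.
by rewrite -div1r ler_pdivrMr ?kc_mid_gt0 // kc_mid_ge.
Qed.

End Approximation.

(** * Weight sequences *)

Section Weight.
Variables (R : realType) (M : nat -> R).
Hypothesis hM : weight_sequence M.

Lemma M_gt0 p : 0 < M p. Proof. by case: hM. Qed.
Lemma M_ge0 p : 0 <= M p. Proof. exact/ltW/M_gt0. Qed.
Lemma M_0 : M 0%N = 1. Proof. by case: hM. Qed.

Definition mratio p : R := M p / M p.+1.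

Lemma mratio_gt0 p : 0 < mratio p.
Proof. by rewrite divr_gt0 ?M_gt0. Qed.

Lemma mratio_dec p q : (p <= q)%N -> mratio q <= mratio p.
Proof.
move=> /subnKC <-; elim: (q - p)%N => [|k IH]; first by rewrite addn0.
apply: le_trans IH; rewrite addnS; move: (p + k)%N => j.
have [_ _ /(_ j.+1 isT) /= H _ _] := hM.
by rewrite /mratio ler_pdivrMr ?M_gt0 // mulrAC ler_pdivlMr ?M_gt0.
Qed.

(** Logarithmic convexity says that the quotients [M p.+1 / M p] increase, and [M 0 = 1]. *)
Lemma M_mul p q : M p * M q <= M (p + q)%N.
Proof.
elim: p => [|p IH]; first by rewrite M_0 mul1r.
have E : M p.+1 = M p / mratio p by rewrite /mratio invf_div mulrC divfK ?gt_eqF ?M_gt0.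
have E2 : M (p + q).+1 = M (p + q)%N / mratio (p + q).
  by rewrite /mratio invf_div mulrC divfK ?gt_eqF ?M_gt0.
rewrite addSn E E2 mulrAC; apply: ler_pM => //.
- by rewrite mulr_ge0 ?M_ge0.
- by rewrite invr_ge0 ltW ?mratio_gt0.
- by rewrite lef_pV2 ?posrE ?mratio_gt0 // mratio_dec // leq_addr.
Qed.

Lemma M_H2 : exists A H : R, [/\ 1 <= A, 1 <= H &
  forall p q, M (p + q)%N <= A * H ^+ (p + q) * M p * M q].
Proof.
have [_ _ _ [A [H [A0 H0 HH]]] _] := hM.
exists (Num.max A 1), (Num.max H 1); split; rewrite ?le_max ?lexx ?orbT // => p q.
have := HH (p + q)%N q (leq_addl p q); rewrite addnK => h; apply: (le_trans h).
rewrite -!mulrA [M q * M p]mulrC !mulrA !ler_wpM2r ?M_ge0 //.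
apply: ler_pM; rewrite ?exprn_ge0 ?(ltW A0) ?(ltW H0) ?le_max ?lexx //.
by rewrite lerXn2r ?nnegrE ?le_max ?(ltW H0) ?lexx.
Qed.

Lemma mratio_sum : exists S : R, forall N, \sum_(0 <= j < N) mratio j <= S.
Proof.
have [_ _ _ _] := hM; set s := (X in (X < _)%E) => sfin.
have s0 p : (1 <= p)%N -> (0%E <= (M p.-1 / M p)%:E)%E.
  by move=> _; rewrite lee_fin divr_ge0 ?M_ge0.
exists (fine s) => N.
have sf : s \is a fin_num.
  by rewrite ge0_fin_numE // /s; apply: nneseries_ge0 => p p1 _; apply: s0.
rewrite -lee_fin fineK //.
have -> : (\sum_(0 <= j < N) mratio j)%:E = (\sum_(1 <= p < N.+1) (M p.-1 / M p)%:E)%E.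
  by rewrite big_add1 /= sumEFin.
apply: nneseries_lim_ge => p p1 _; exact: s0.
Qed.

Lemma mratio_small (c : R) : 0 < c -> exists P, forall p, (P <= p)%N -> mratio p <= c.
Proof.
move=> c0; have [S HS] := mratio_sum.
apply: contrapT => /forallNP H.
have {}H p : c < mratio p.
  have [//|pc] := ltP c (mratio p); exfalso; apply: (H p) => q pq.
  exact: le_trans (mratio_dec pq) pc.
pose N := (Num.truncn (S / c)).+1.
have := HS N; apply/negP; rewrite -ltNge.
apply: (@lt_le_trans _ _ (c *+ N)).
  by rewrite -mulr_natr mulrC -ltr_pdivrMr // truncnS_gt.
rewrite -[X in c *+ X]subn0 -sumr_const_nat; apply: ler_sum => i _; exact/ltW/H.
Qed.

(** The supremum in the associated function is finite, because the summable quotients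
    [M p / M p.+1] tend to zero. *)
Lemma assoc_bounded (t : R) : 0 < t -> exists2 B, 0 < B & forall p, t ^+ p <= B * M p.
Proof.
move=> t0; have ti : 0 < t^-1 by rewrite invr_gt0.
have [P HP] := mratio_small ti.
pose B := \sum_(p < P.+1) t ^+ p / M p.
have term0 p : 0 < t ^+ p / M p by rewrite divr_gt0 ?exprn_gt0 ?M_gt0.
have B0 : 0 < B.
  rewrite /B big_ord_recl; apply: ltr_pwDl; first exact: term0.
  by apply: sumr_ge0 => j _; exact: ltW.
exists B => // p; rewrite -ler_pdivrMr ?M_gt0 //.
have small q : (q <= P)%N -> t ^+ q / M q <= B.
  move=> qP; rewrite /B (bigD1 (Ordinal (qP : (q < P.+1)%N))) //= lerDl.
  by apply: sumr_ge0 => j _; exact: ltW.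
have [pP|/ltnW Pp] := leqP p P; first exact: small.
rewrite -(subnKC Pp); elim: (p - P)%N => [|k IH]; first by rewrite addn0 small.
apply: le_trans IH; rewrite addnS exprS.
have := HP (P + k)%N (leq_addr _ _); rewrite /mratio.
set q := (P + k)%N => H.
rewrite ler_pdivrMr ?M_gt0 // in H.
rewrite ler_pdivrMr ?M_gt0 // -mulrA mulrC -ler_pdivlMr // -!mulrA.
rewrite ler_peMr ?exprn_ge0 ?(ltW t0) //.
by rewrite ler_pdivlMl ?M_gt0 // mulr1 [_ / t]mulrC.
Qed.

(** The exponential of minus the associated function is the infimum of the
    monomial weights, so decay in terms of it is a family of moment estimates. *)
Lemma assoc_le (t X K : R) : 0 <= t -> 0 <= X ->
  (X <= K * expR (- assoc_fun M t)) <-> forall p, t ^+ p * X <= K * M p.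
Proof.
move=> t0 X0; rewrite /assoc_fun; case: ifPn => [tp|]; last first.
  rewrite -leNgt => t0'; have -> : t = 0 by apply/eqP; rewrite eq_le t0 t0'.
  rewrite oppr0 expR0 mulr1; split=> [XK p|/(_ 0%N)]; last by rewrite expr0 mul1r M_0 mulr1.
  case: p => [|p]; first by rewrite expr0 mul1r M_0 mulr1.
  by rewrite expr0n mul0r mulr_ge0 ?M_ge0 // (le_trans X0).
pose A : set R := range (fun p => ln (t ^+ p / M p)); rewrite -/A.
have [B B0 HB] := assoc_bounded tp.
have lnB (C : R) : 0 < C -> (forall p, t ^+ p <= C * M p) -> ubound A (ln C).
  move=> C0 HC _ [p _ <-] /=.
  rewrite ler_ln ?posrE ?divr_gt0 ?exprn_gt0 ?M_gt0 //.
  by rewrite ler_pdivrMr ?M_gt0.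
have Asup : has_sup A.
  by split; [exists (ln (t ^+ 0 / M 0%N)), 0%N|exists (ln B); exact: lnB].
split=> [XK p|H].
  have tM : t ^+ p <= expR (sup A) * M p.
    rewrite -ler_pdivrMr ?M_gt0 // -[leLHS]lnK ?posrE ?divr_gt0 ?exprn_gt0 ?M_gt0 //.
    by rewrite ler_expR; apply: ub_le_sup; [case: Asup|exists p].
  have K0 : 0 <= K.
    by rewrite -(pmulr_lge0 _ (expR_gt0 (- sup A))); apply: le_trans X0 XK.
  apply: le_trans (_ : (expR (sup A) * M p) * (K * expR (- sup A)) <= _).
    by apply: ler_pM; rewrite ?exprn_ge0.
  rewrite expRN; have e0 := expR_gt0 (sup A).
  rewrite (_ : _ * _ * _ = K * M p) //.
  by field; rewrite gt_eqF.
have := X0; rewrite le_eqVlt => /orP[/eqP <-|Xp].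
  rewrite mulr_ge0 ?expR_ge0 //; have := H 0%N; rewrite expr0 mul1r M_0 mulr1.
  exact: le_trans.
have K0 : 0 < K by have := H 0%N; rewrite expr0 mul1r M_0 mulr1; exact: lt_le_trans.
have : sup A <= ln (K / X).
  apply: ge_sup; first by case: Asup.
  apply: lnB; first exact: divr_gt0.
  by move=> p; rewrite mulrAC ler_pdivlMr.
move=> supA; have : expR (sup A) <= K / X.
  by rewrite -[leRHS]lnK ?posrE ?divr_gt0 // ler_expR.
rewrite ler_pdivlMr // expRN => KX.
by rewrite ler_pdivlMr ?expR_gt0 // mulrC.
Qed.

(** The common form of all bounds of order [p] in the parameter [e]: every constant is
    absorbed in a power of [1 / e], the exponent being affine in [p]. *)
Definition bd (d : nat) (e : R) (p : nat) : R := e^-1 ^+ (d * p.+1) * M p.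

Lemma bd_ge0 d e p : 0 < e -> 0 <= bd d e p.
Proof. by move=> e0; rewrite mulr_ge0 ?M_ge0 ?exprn_ge0 // invr_ge0 ltW. Qed.

Lemma bd_le d d' e p : 0 < e <= 1 -> (d <= d')%N -> bd d e p <= bd d' e p.
Proof.
move=> /andP[e0 e1] dd; rewrite /bd ler_wpM2r ?M_ge0 // ler_weXn2l ?leq_mul2r ?dd ?orbT //.
by rewrite invf_ge1.
Qed.

End Weight.

(** * Eventually small parameters *)

Section Evt.
Variable R : realType.

(** For all small parameters. The bound [eta <= 1] makes [0 < e <= 1] available whenever such
    a statement is used (lemma [evtW]). *)
Definition evt (P : R -> Prop) : Prop :=
  exists eta : R, 0 < eta <= 1 /\ forall e, 0 < e <= eta -> P e.

Lemma evtW (P Q : R -> Prop) : (forall e, 0 < e <= 1 -> P e -> Q e) -> evt P -> evt Q.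
Proof.
move=> PQ [h [/andP[h0 h1] H]]; exists h; split; first by rewrite h0.
move=> e /andP[e0 eh]; apply: PQ; first by rewrite e0 (le_trans eh).
by apply: H; rewrite e0.
Qed.

Lemma evt_and (P Q : R -> Prop) : evt P -> evt Q -> evt (fun e => P e /\ Q e).
Proof.
move=> [h [/andP[h0 h1] H]] [k [/andP[k0 k1] K]].
exists (Num.min h k); split; first by rewrite lt_min h0 k0 ge_min h1.
move=> e /andP[e0]; rewrite le_min => /andP[eh ek].
by split; [apply: H|apply: K]; rewrite e0.
Qed.

Lemma evt_all (P : R -> Prop) : (forall e, 0 < e <= 1 -> P e) -> evt P.
Proof. by move=> H; exists 1; split; [rewrite ltr01 lexx|]. Qed.

(** This is what absorbs constants: they are below [1 / e] for small [e]. *)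
Lemma evt_big (C : R) : evt (fun e => C <= e^-1).
Proof.
exists (Num.max C 1)^-1.
have m1 : 1 <= Num.max C 1 by rewrite le_max lexx orbT.
have m0 : 0 < Num.max C 1 by apply: lt_le_trans m1.
split; first by rewrite invr_gt0 m0 invf_le1.
move=> e /andP[e0 em]; apply: (@le_trans _ _ (Num.max C 1)); first by rewrite le_max lexx.
by rewrite -[leLHS]invrK lef_pV2 ?posrE ?invr_gt0.
Qed.

Lemma evt_bigop (I : eqType) (s : seq I) (P : I -> R -> Prop) :
  (forall i, i \in s -> evt (P i)) -> evt (fun e => forall i, i \in s -> P i e).
Proof.
elim: s => [|a s IH] H; first by apply: evt_all.
have h1 := H a (mem_head _ _).
have h2 : evt (fun e => forall i, i \in s -> P i e).
  by apply: IH => i si; apply: H; rewrite inE si orbT.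
apply: evtW (evt_and h1 h2) => e _ [p1 p2] i; rewrite inE => /orP[/eqP ->//|]; exact: p2.
Qed.

Variables (M : nat -> R).
Hypothesis hM : weight_sequence M.

(** Geometric constants are absorbed by a power of [1 / e] of exponent linear in [p], and by
    stability under ultradifferential operators so is a shift of the index of [M]. *)
Lemma absorb (C : R) (d q : nat) : exists d', evt (fun e =>
  forall p, C ^+ p.+1 * (e^-1 ^+ (d * (p + q).+1) * M (p + q)%N) <= bd M d' e p).
Proof.
have [A [H [A1 H1 HH]]] := M_H2 hM.
have A0 : 0 <= A by apply: le_trans A1.
have H0 : 0 <= H by apply: le_trans H1.
pose D := `|C| * A * H ^+ q.+1 * (M q + 1).
exists (d * q.+1 + 1)%N; apply: evtW (evt_big D) => e /andP[e0 e1] De p.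
have T1 : 1 <= e^-1 by rewrite invf_ge1.
have T0 : 0 <= e^-1 by apply: le_trans T1.
have Mq : 0 <= M q by exact: M_ge0.
rewrite /bd.
have s1 : C ^+ p.+1 <= `|C| ^+ p.+1 by rewrite -normrX ler_norm.
apply: le_trans (_ : `|C| ^+ p.+1 * (e^-1 ^+ (d * (p + q).+1) * M (p + q)%N) <= _).
  by rewrite ler_wpM2r // mulr_ge0 ?exprn_ge0 // M_ge0.
apply: le_trans (_ : `|C| ^+ p.+1 * (e^-1 ^+ (d * q.+1 * p.+1) *
     (A ^+ p.+1 * (H ^+ q.+1) ^+ p.+1 * M p * (M q + 1) ^+ p.+1)) <= _).
  rewrite ler_wpM2l ?exprn_ge0 //; apply: ler_pM; rewrite ?exprn_ge0 ?M_ge0 //.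
    apply: ler_weXn2l => //; rewrite -mulnA leq_mul2l mulSn mulnS.
    by rewrite addSn ltnS addnA leq_addr orbT.
  apply: le_trans (HH p q) _; apply: ler_pM => //.
  - by rewrite !mulr_ge0 ?exprn_ge0 // M_ge0.
  - rewrite ler_wpM2r ?M_ge0 //; apply: ler_pM; rewrite ?exprn_ge0 //.
      by rewrite -[leLHS]expr1 ler_weXn2l.
    by rewrite -exprM ler_weXn2l //; nia.
  - apply: (@le_trans _ _ (M q + 1)); first by rewrite lerDl.
    by rewrite -[leLHS]expr1 ler_weXn2l // lerDr.
rewrite mulnDl mul1n exprD.
have -> : `|C| ^+ p.+1 * (e^-1 ^+ (d * q.+1 * p.+1) *
     (A ^+ p.+1 * (H ^+ q.+1) ^+ p.+1 * M p * (M q + 1) ^+ p.+1)) =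
  e^-1 ^+ (d * q.+1 * p.+1) * D ^+ p.+1 * M p.
  by rewrite /D !exprMn; ring.
rewrite ler_wpM2r ?M_ge0 // ler_wpM2l ?exprn_ge0 // lerXn2r ?nnegrE //.
by rewrite !mulr_ge0 ?exprn_ge0 // addr_ge0.
Qed.

Lemma absorb0 (C : R) (d : nat) : exists d', evt (fun e =>
  forall p, C ^+ p.+1 * bd M d e p <= bd M d' e p).
Proof.
have [d' H] := absorb C d 0; exists d'; apply: evtW H => e _ H p.
by have := H p; rewrite !addn0.
Qed.

Lemma absorb1 (C : R) (d : nat) : exists d', evt (fun e =>
  forall p, C * bd M d e p <= bd M d' e p).
Proof.
have [d' H] := absorb0 (Num.max C 1) d; exists d'; apply: evtW H => e /andP[e0 _] H p.
apply: le_trans (H p); rewrite ler_wpM2r ?bd_ge0 //.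
apply: (@le_trans _ _ (Num.max C 1)); first by rewrite le_max lexx.
by rewrite -[leLHS]expr1 ler_weXn2l // le_max lexx orbT.
Qed.

Lemma absorb_pow (C : R) (d : nat) : exists d', evt (fun e => C * e^-1 ^+ d <= e^-1 ^+ d').
Proof.
exists d.+1; apply: evtW (evt_big C) => e /andP[e0 e1] He.
by rewrite exprS ler_wpM2r // exprn_ge0 // invr_ge0 ltW.
Qed.

End Evt.

(** * Nets of test functions and their Fourier transforms *)

Section Nets.
Variables (R : realType) (n : nat) (M : nat -> R).
Hypothesis hM : weight_sequence M.
Local Notation V := 'rV[R]_n.
Local Notation C := R[i].
Local Notation Nc := (@Normc.normc R).
Local Notation net := (net R n).
Implicit Types (B K Gamma : set V) (u v theta : net).

(** The regular, the moderate and the negligible bounds on one set, in the form where all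
    constants are absorbed in powers of the parameter. *)
Definition MAon B u := exists d, evt (fun e =>
  forall w x, B x -> Nc (wD w (u e) x) <= bd M d e (size w)).
Definition MODon B u := forall w, exists d, evt (fun e =>
  forall x, B x -> Nc (wD w (u e) x) <= e^-1 ^+ d).
Definition NEGon B u := forall w m, evt (fun e =>
  forall x, B x -> Nc (wD w (u e) x) <= e ^+ m).
(** Nets of test functions on the whole space, supported in a common set; compactly supported
    representatives are such nets after extension by zero. *)
Definition tnet K u := forall e, 0 < e <= 1 ->
  smooth setT (u e) /\ forall x, ~ K x -> u e x = 0.
(** Decay like the exponential of minus the associated function, as moment estimates. *)
Definition dec Gamma (F : R -> V -> C) := exists d, evt (fun e =>
  forall xi p, Gamma xi -> `|xi| ^+ p * Nc (F e xi) <= bd M d e p).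
Definition ftn u : R -> V -> C := fun e => ft (u e).

Lemma dec_sub G G' F : G `<=` G' -> dec G' F -> dec G F.
Proof. by move=> GG [d H]; exists d; apply: evtW H => e _ H xi p /GG; exact: H. Qed.

Lemma wD_out K (f : V -> C) w x : closed K -> (forall x, ~ K x -> f x = 0) ->
  ~ K x -> wD w f x = 0.
Proof.
move=> cK f0 nKx; have oC : open (~` K) by apply: closed_openC.
rewrite (wD_eq w oC (g := fun=> 0) f0 nKx) wD_cst; by case: w.
Qed.

Lemma compact_in_box K : compact K -> exists2 r, 1 <= r & K `<=` boxc r.
Proof.
move=> /compact_bounded [B [_ H]]; exists (Num.max 1 (B + 1)); first by rewrite le_max lexx.
move=> x Kx; apply/boxc_norm; first by rewrite le_max ler01.
by apply: H => //; rewrite lt_max ltrDl ltr01 orbT.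
Qed.

Lemma compactV_closed K : compact K -> closed K.
Proof. by apply: compact_closed; exact: norm_hausdorff. Qed.

Lemma tnet_tf K u r e : K `<=` boxc r -> tnet K u -> 0 < e <= 1 -> tf r (u e).
Proof. by move=> Kr tu /tu [s h]; split=> // x nb; apply: h => /Kr. Qed.

Lemma MAon_T K u : compact K -> tnet K u -> MAon K u -> MAon setT u.
Proof.
move=> cK tu [d H]; exists d; apply: evtW H => e e01 H w x _.
have [Kx|nK] := pselect (K x); first exact: H.
rewrite (wD_out w (compactV_closed cK) _ nK) ?Normc.normc0 ?bd_ge0 //; last exact: (tu e e01).2.
by case/andP: e01.
Qed.

Lemma MODon_T K u : compact K -> tnet K u -> MODon K u -> MODon setT u.
Proof.
move=> cK tu H w; have [d {}H] := H w; exists d; apply: evtW H => e e01 H x _.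
have [Kx|nK] := pselect (K x); first exact: H.
rewrite (wD_out w (compactV_closed cK) _ nK) ?Normc.normc0 //; last exact: (tu e e01).2.
by rewrite exprn_ge0 // invr_ge0 ltW //; case/andP: e01.
Qed.

Lemma NEGon_T K u : compact K -> tnet K u -> NEGon K u -> NEGon setT u.
Proof.
move=> cK tu H w m; apply: evtW (H w m) => e e01 {}H x _.
have [Kx|nK] := pselect (K x); first exact: H.
rewrite (wD_out w (compactV_closed cK) _ nK) ?Normc.normc0 //; last exact: (tu e e01).2.
by rewrite exprn_ge0 // ltW //; case/andP: e01.
Qed.

Lemma MA_MOD B u : MAon B u -> MODon B u.
Proof.
move=> [d H] w; have [d' H'] := absorb_pow (M (size w)) (d * (size w).+1).
exists d'; apply: evtW (evt_and H H') => e _ [h h'] x Bx.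
by apply: le_trans (h w x Bx) _; rewrite /bd mulrC.
Qed.

(** Integrating by parts [p] times trades the power [p] of the frequency for derivatives of
    order [p]. *)
Lemma dec_of_MA K u : compact K -> tnet K u -> MAon K u -> dec setT (ftn u).
Proof.
move=> cK tu mu; have [r r1 Kr] := compact_in_box cK.
have r0 : 0 <= r by apply: le_trans r1.
have [d H] := MAon_T cK tu mu.
have [d' H'] := absorb1 hM (2 * (r *+ 2) ^+ n) d.
exists d'; apply: evtW (evt_and H H') => e e01 [h h'] xi p _.
have e0 : 0 < e by case/andP: e01.
apply: le_trans (h' p); rewrite -mulrA [_ ^+ n * _]mulrC.
apply: (ft_decay xi r0 (bd_ge0 hM _ _ e0) (tnet_tf Kr tu e01)).
by move=> w <- x; exact: h.
Qed.

Lemma ft_MOD K u : compact K -> tnet K u -> MODon K u ->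
  exists d, evt (fun e => forall xi, Nc (ftn u e xi) <= e^-1 ^+ d).
Proof.
move=> cK tu mu; have [r r1 Kr] := compact_in_box cK.
have r0 : 0 <= r by apply: le_trans r1.
have [d H] := MODon_T cK tu mu [::].
have [d' H'] := absorb_pow (2 * (r *+ 2) ^+ n) d.
exists d'; apply: evtW (evt_and H H') => e e01 [h h'] xi.
apply: le_trans h'; rewrite -mulrA [_ ^+ n * _]mulrC.
by apply: (ft_bound xi r0 (tnet_tf Kr tu e01)) => x; exact: h.
Qed.

Lemma evt_words (P : seq 'I_n -> R -> Prop) p : (forall w, evt (P w)) ->
  evt (fun e => forall w, size w = p -> P w e).
Proof.
move=> H.
have := @evt_bigop R _ (map val (enum {: p.-tuple 'I_n})) P (fun w _ => H w).
apply: evtW => e _ h w sw; apply: h.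
by apply/mapP; exists (Tuple (introT eqP sw)); rewrite ?mem_enum.
Qed.

Lemma ft_NEG K u p m : compact K -> tnet K u -> NEGon K u ->
  evt (fun e => forall xi, `|xi| ^+ p * Nc (ftn u e xi) <= e ^+ m).
Proof.
move=> cK tu mu; have [r r1 Kr] := compact_in_box cK.
have r0 : 0 <= r by apply: le_trans r1.
have H := evt_words p (fun w => NEGon_T cK tu mu w m.+1).
have H' := evt_big (2 * (r *+ 2) ^+ n).
apply: evtW (evt_and H H') => e e01 [h h'] xi.
have e0 : 0 < e by case/andP: e01.
have := ft_decay xi r0 (exprn_ge0 m.+1 (ltW e0)) (tnet_tf Kr tu e01)
  (fun w sw x => h w sw x I).
move=> /le_trans -> //; rewrite mulrCA exprSr -mulrA ler_piMr ?exprn_ge0 ?(ltW e0) //.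
by rewrite -ler_pdivlMl // mulr1.
Qed.

Lemma tnetM K K' u v : tnet K u -> tnet K' v -> tnet K (fun e x => u e x * v e x).
Proof.
move=> tu tv e e01; have [s1 h1] := tu e e01; have [s2 h2] := tv e e01; split.
  by apply: smoothM => //; exact: openT.
by move=> x nK; rewrite h1 // mul0r.
Qed.

(** Comparison with the telescoping series of [4 / (k (k + 1))]. *)
Lemma sum_inv_sq N : \sum_(j < (2 * N).+1) (1 + (j%:R - N%:R) ^+ 2)^-1 <= 8 :> R.
Proof.
have half k : \sum_(0 <= j < k) (1 + j%:R ^+ 2)^-1 <= 4 :> R.
  suff : \sum_(0 <= j < k) (1 + j%:R ^+ 2)^-1 <= 4 - 4 / k.+1%:R :> R.
    by move=> /le_trans; apply; rewrite gerBl divr_ge0.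
  elim: k => [|k IH]; first by rewrite big_geq // divr1 subrr.
  rewrite big_nat_recr //=; apply: le_trans (lerD IH (lexx _)) _.
  have gen (a b c : R) : c <= a - b -> 4 - a + c <= 4 - b by lra.
  apply: gen.
  have k0 : 0 <= k%:R :> R by [].
  rewrite -[k.+2%:R]natr1 -[k.+1%:R]natr1; move: (k%:R : R) k0 => x x0.
  have -> : 4 / (x + 1) - 4 / (x + 1 + 1) = 4 / ((x + 1) * (x + 1 + 1)).
    by field; apply/andP; split; apply/eqP; lra.
  rewrite -[leLHS]div1r ler_pdivrMr; last by have := sqr_ge0 x; lra.
  rewrite mulrAC ler_pdivlMr ?mulr_gt0 //; try lra.
  by have := sqr_ge0 (x - 1); have := sqr_ge0 x; rewrite !expr2; lra.
rewrite -(big_mkord xpredT (fun j => (1 + (j%:R - N%:R) ^+ 2)^-1 : R)).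
rewrite (@big_cat_nat _ _ _ N) //=; last by lia.
have -> : 8 = 4 + 4 :> R by lra.
apply: lerD.
  apply: le_trans (half N.+1); rewrite big_nat_recl // big_nat_rev /= add0n.
  apply: ler_wpDl; first by rewrite invr_ge0 addr_ge0 ?sqr_ge0.
  rewrite le_eqVlt; apply/orP; left; apply/eqP; apply: eq_big_nat => i /andP[_ iN].
  congr (_^-1); congr (1 + _); by rewrite natrB // addrAC subrr add0r sqrrN.
apply: le_trans (half N.+1).
rewrite -{1}[N]add0n big_addn (_ : ((2 * N).+1 - N = N.+1)%N); last by lia.
rewrite le_eqVlt; apply/orP; left; apply/eqP; apply: eq_big_nat => i _.
by rewrite natrD addrK.
Qed.

Lemma sum_prod_inv N : \sum_(k : {ffun 'I_n -> 'I_(2 * N).+1})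
  \prod_i (1 + ((k i)%:R - N%:R) ^+ 2)^-1 <= 8 ^+ n :> R.
Proof.
rewrite -(bigA_distr_bigA (fun (i : 'I_n) (j : 'I_(2 * N).+1) => (1 + (j%:R - N%:R) ^+ 2)^-1 : R)).
rewrite -[X in _ <= _ ^+ X]card_ord -prodr_const; apply: ler_prod => i _.
rewrite sum_inv_sq andbT; apply: sumr_ge0 => j _.
by rewrite invr_ge0 addr_ge0 ?sqr_ge0.
Qed.

Lemma prod_sq_le (w : R) N (k : {ffun 'I_n -> 'I_(2 * N).+1}) : 0 < w <= 1 ->
  \prod_i (1 + ((k i)%:R - N%:R) ^+ 2) <= (4 / w ^+ 2) ^+ n * (1 + `|lam w k| ^+ (2 * n)) :> R.
Proof.
move=> /andP[w0 w1]; set t := `|lam w k|.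
have t0 : 0 <= t by exact: normr_ge0.
have w2 : 0 < w ^+ 2 by rewrite exprn_gt0.
apply: (@le_trans _ _ (\prod_(i : 'I_n) (2 / w ^+ 2 * (1 + t ^+ 2)))).
  apply: ler_prod => i _; rewrite addr_ge0 ?sqr_ge0 //=.
  have : `|((k i)%:R - N%:R) * w| <= t by have := coord_le_norm (lam w k) i; rewrite mxE.
  move=> kt; rewrite mulrAC ler_pdivlMr // mulrDl mul1r -exprMn.
  have h1 : (((k i)%:R - N%:R) * w) ^+ 2 <= t ^+ 2.
    by rewrite -real_normK ?num_real // lerXn2r ?nnegrE.
  have h2 : w ^+ 2 <= 1 by rewrite exprn_ile1 // ltW.
  by have := sqr_ge0 t; lra.
rewrite prodr_const card_ord (_ : 4 / w ^+ 2 = 2 / w ^+ 2 * 2); last by field; rewrite gt_eqF.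
have := divr_ge0 (ler0n R 2) (ltW w2); move: (2 / w ^+ 2) => a a0.
rewrite !exprMn -mulrA ler_wpM2l ?exprn_ge0 //.
rewrite exprM; have [t1|t1] := leP (t ^+ 2) 1.
  apply: (@le_trans _ _ (2 ^+ n)); last by rewrite ler_peMr ?exprn_ge0 // lerDl exprn_ge0 // exprn_ge0.
  by rewrite lerXn2r ?nnegrE ?addr_ge0 ?sqr_ge0 //; lra.
apply: (@le_trans _ _ (2 ^+ n * (t ^+ 2) ^+ n)).
  by rewrite -exprMn lerXn2r ?nnegrE ?addr_ge0 ?mulr_ge0 ?sqr_ge0 //; lra.
by rewrite ler_wpM2l ?exprn_ge0 // lerDr.
Qed.

Lemma ft_char_mul r (f : V -> C) l xi : tf r f ->
  ft (fun x => cis (dotv l x) * f x) xi = ft f (xi - l).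
Proof.
move=> tff; rewrite /ft; congr cint; apply/funext => x.
rewrite mulrAC mulrC -cisD; congr (_ * cis _).
by rewrite dotvDr dotvNr opprD opprK addrC [dotv x l]dotvC.
Qed.

Lemma ft_trig_mul w N (G : V -> C) r (f : V -> C) xi : 0 <= r -> tf r f ->
  ft (fun x => trig w N G x * f x) xi =
  \sum_(k : {ffun 'I_n -> 'I_(2 * N).+1})
     ((Wt w k)%:C)%C * G (lam w k) * ft f (xi - lam w k).
Proof.
move=> r0 tff.
have nk l : cnice (fun x => cis (dotv l x) * f x * cis (- dotv x xi)).
  apply: (tf_cnice r0); apply: tfM; last exact: smooth_char.
  have := tfM tff (smooth_cis l); rewrite /tf.
  by under [X in smooth setT X /\ _ -> _]funext do rewrite mulrC;
     move=> [h1 h2]; split => // x nb; rewrite mulrC h2.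
transitivity (cint (fun x => \sum_(k : {ffun 'I_n -> 'I_(2 * N).+1})
    ((Wt w k)%:C)%C * G (lam w k) * (cis (dotv (lam w k) x) * f x * cis (- dotv x xi)))).
  rewrite /ft; congr cint; apply/funext => x; rewrite /trig mulr_suml mulr_suml.
  by apply: eq_bigr => k _; rewrite !mulrA.
rewrite cint_sum; last by move=> k; exact: cniceZ.
apply: eq_bigr => k _; rewrite cintZ //; congr (_ * _).
by rewrite -(ft_char_mul _ _ tff).
Qed.

Lemma smooth_trig w N (G : V -> C) : smooth setT (trig w N G).
Proof.
apply: smooth_sum; first exact: openT.
move=> k _; apply: smoothM; [exact: openT|exact: smooth_cst|exact: smooth_cis].
Qed.

Lemma wD_trig w N (G : V -> C) (s : seq 'I_n) x :
  wD s (trig w N G) x = trig w N (fun l => (\prod_(i <- s) (0 +i* l 0 i)%C) * G l) x.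
Proof.
rewrite /trig (@wD_sum _ _ setT) //; last 2 first.
- exact: openT.
- by move=> k _; apply: smoothM; [exact: openT|exact: smooth_cst|exact: smooth_cis].
apply: eq_bigr => k _; rewrite (@wDZ _ _ setT) //; [|exact: openT|exact: smooth_cis].
by rewrite wD_cis; ring.
Qed.

(** The weights are bounded, and the reciprocals of a polynomial of degree [2 n] are summable
    over the lattice; the bound is therefore uniform in the number of frequencies. *)
Lemma trig_sum_bound w N (F : V -> R) Z : 0 < w <= 1 -> (forall l, 0 <= F l) ->
  (forall l, (1 + `|l| ^+ (2 * n)) * F l <= Z) ->
  \sum_(k : {ffun 'I_n -> 'I_(2 * N).+1}) Wt w k * F (lam w k) <=
  (pi / w *+ 2) ^- n * ((4 / w ^+ 2) ^+ n * 8 ^+ n) * Z.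
Proof.
move=> w01 F0 FZ; have /andP[w0 w1] := w01.
have p0 : 0 < pi / w *+ 2 :> R by rewrite pmulrn_lgt0 // divr_gt0 ?pi_gt0.
set cW := (pi / w *+ 2) ^- n; set cK := (4 / w ^+ 2) ^+ n.
have cW0 : 0 <= cW by rewrite invr_ge0 exprn_ge0 // ltW.
have cK0 : 0 <= cK by rewrite exprn_ge0 // divr_ge0 // exprn_ge0 // ltW.
have Z0 : 0 <= Z by apply: le_trans (FZ 0); rewrite mulr_ge0 // addr_ge0 // exprn_ge0.
pose P (k : {ffun 'I_n -> 'I_(2 * N).+1}) : R := \prod_i (1 + ((k i)%:R - N%:R) ^+ 2).
have P1 k : 0 < P k by apply: prodr_gt0 => i _; rewrite ltr_pwDl // sqr_ge0.
apply: (@le_trans _ _ (\sum_k (cW * cK * Z) * (P k)^-1)).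
  apply: ler_sum => k _; rewrite ler_pdivlMr //.
  have -> : Wt w k * F (lam w k) * P k = Wt w k * (F (lam w k) * P k) by rewrite mulrA.
  have -> : cW * cK * Z = cW * (cK * Z) by rewrite mulrA.
  apply: ler_pM; rewrite ?Wt_ge0 ?Wt_le ?mulr_ge0 ?(ltW (P1 _)) //.
  apply: (@le_trans _ _ (F (lam w k) * (cK * (1 + `|lam w k| ^+ (2 * n))))).
    by rewrite ler_wpM2l // prod_sq_le.
  by rewrite mulrCA ler_wpM2l // mulrC.
rewrite -mulr_sumr -!mulrA [8 ^+ n * Z]mulrC !mulrA; apply: ler_wpM2l; first by rewrite !mulr_ge0.
apply: le_trans (sum_prod_inv N).
by under eq_bigr do rewrite /P -prodfV; rewrite lexx.
Qed.

Lemma ft_le_approx (r : R) (f g : V -> C) (S d : R) xi : 0 <= r -> tf r f -> smooth setT g -> 0 <= S ->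
  (forall x, Nc (f x) <= S) -> (forall x, boxc r x -> Nc (g x) <= d) ->
  Nc (ft (fun x => g x * f x) xi) <= 2 * (d * S * (r *+ 2) ^+ n).
Proof.
move=> r0 tff sg S0 fS gd.
have d0 : 0 <= d.
  by apply: le_trans (gd 0 _); [exact: normc_ge0|move=> i; rewrite mxE normr0].
have tfg : tf r (fun x => g x * f x).
  have [sf f0] := tff; split; first by apply: smoothM => //; exact: openT.
  by move=> x nb; rewrite f0 ?mulr0.
apply: (ft_bound xi r0 tfg) => x; rewrite Normc.normcM.
have [b|b] := pselect (boxc r x).
  by apply: ler_pM; rewrite ?normc_ge0 // gd.
by rewrite (tff.2 x b) Normc.normc0 mulr0 mulr_ge0.
Qed.

(** Approximating the first factor by trigonometric sums turns the transform of the product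
    into a discrete convolution, whose bound survives the limit. *)
Lemma ft_mul_bound (r w : R) (f g : V -> C) xi (Z : R) : 0 < w <= 1 -> 0 <= r -> w * r <= 1 -> tf r f -> tf r g ->
  (forall l, (1 + `|l| ^+ (2 * n)) * (Nc (ft f l) * Nc (ft g (xi - l))) <= Z) ->
  Nc (ft (fun x => f x * g x) xi) <= (pi / w *+ 2) ^- n * ((4 / w ^+ 2) ^+ n * 8 ^+ n) * Z.
Proof.
move=> w01 r0 wr tff tfg HZ; have /andP[w0 w1] := w01.
set RHS := (X in _ <= X); apply/ler_addgt0Pr => e e0.
have [S S0 HS] : exists2 S, 0 <= S & forall x, Nc (g x) <= S.
  have [n1 n2] := tf_cnice r0 tfg.
  have [m1 [r1 [B1 [r1p H1]]]] := n1; have [m2 [r2 [B2 [r2p H2]]]] := n2.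
  have HB x : Nc (g x) <= B1 + B2.
    apply: le_trans (normc_le_ReIm _) _.
    by apply: lerD; [exact: (H1 x).1|exact: (H2 x).1].
  by exists (B1 + B2) => //; apply: le_trans (HB 0); exact: normc_ge0.
pose D := 2 * (S * (r *+ 2) ^+ n) + 1.
have D0 : 0 < D by rewrite ltr_wpDl // !mulr_ge0 ?exprn_ge0 ?mulrn_wge0.
have [sf f0] := tff.
have [N HN] := trig_approx w0 r0 wr (tf_cnice r0 tff)
  (fun x => @smooth_contRe _ _ _ _ sf x I) (fun x => @smooth_contIm _ _ _ _ sf x I)
  f0 (divr_gt0 e0 D0).
have {}HN := HN N (leqnn N).
have st := smooth_trig w N (ft f).
have sd : smooth setT (fun x => f x - trig w N (ft f) x).
  by apply: smoothB => //; exact: openT.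
have t1 : tf r (fun x => trig w N (ft f) x * g x).
  have [sg g0] := tfg; split; first by apply: smoothM => //; exact: openT.
  by move=> x nb; rewrite g0 ?mulr0.
have t2 : tf r (fun x => f x * g x).
  by apply: tfM => //; case: tfg.
have E : ft (fun x => f x * g x) xi = ft (fun x => trig w N (ft f) x * g x) xi +
    ft (fun x => (f x - trig w N (ft f) x) * g x) xi.
  have -> : (fun x => (f x - trig w N (ft f) x) * g x) =
    (fun x => f x * g x - trig w N (ft f) x * g x).
    by apply/funext => x; rewrite mulrBl.
  by rewrite (ft_sub xi r0 t2 t1) addrC subrK.
rewrite E; apply: le_trans (normcD _ _) _; apply: lerD; last first.
  apply: le_trans (ft_le_approx xi r0 tfg sd S0 HS HN) _.
  have -> : 2 * (e / D * S * (r *+ 2) ^+ n) = e * ((2 * (S * (r *+ 2) ^+ n)) / D) by ring.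
  by rewrite ler_piMr ?(ltW e0) // ler_pdivrMr // mul1r lerDl.
rewrite (ft_trig_mul w N (ft f) xi r0 tfg).
apply: le_trans (normc_sum _ _ _) _.
apply: le_trans (@trig_sum_bound w N (fun l => Nc (ft f l) * Nc (ft g (xi - l))) Z w01 _ HZ).
  apply: ler_sum => k _; rewrite !Normc.normcM normc_real ger0_norm ?Wt_ge0 //.
  by rewrite mulrA.
by move=> l; rewrite mulr_ge0 ?normc_ge0.
Qed.

(** The discrete convolution is split according to the frequency [l] of the multiplier. If [l]
    is small compared to [xi], then [xi - l] stays in the cone where [u] decays; if not, the
    multiplier itself decays at [l], and [u] is at most moderate. *)
Lemma dec_mul K K' theta u Gamma Gamma1 (c : R) : compact K -> compact K' ->
  tnet K theta -> tnet K' u -> MAon K theta -> MODon K' u -> dec Gamma (ftn u) ->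
  0 < c <= 1 / 2 ->
  (forall xi eta, Gamma1 xi -> `|eta| <= c * `|xi| -> Gamma (xi - eta)) ->
  dec Gamma1 (ftn (fun e x => theta e x * u e x)).
Proof.
move=> cK cK' tth tu mth mu [du Hu] /andP[c0 c2] HG.
have [dt Ht] := dec_of_MA cK tth mth.
have [d2 H2] := ft_MOD cK' tu mu.
have [r1 r11 Kr1] := compact_in_box cK; have [r2 r21 Kr2] := compact_in_box cK'.
pose r := Num.max r1 r2.
have r_1 : 1 <= r by rewrite le_max r11.
have r0 : 0 < r by apply: lt_le_trans r_1.
have Kr : K `<=` boxc r by move=> x /Kr1 b i; rewrite le_max b.
have Kr' : K' `<=` boxc r by move=> x /Kr2 b i; rewrite le_max b orbT.
pose w := r^-1.
have w01 : 0 < w <= 1 by rewrite invr_gt0 r0 invf_le1.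
have wr : w * r <= 1 by rewrite mulVf // gt_eqF.
have [dA HA] := absorb0 hM c^-1 (dt + d2).
have [dB HB] := absorb hM c^-1 (dt + d2) (2 * n).
have [dC HC] := absorb0 hM (2 * (1 + M (2 * n))) (du + dt * (2 * n).+1).
pose dm := maxn dA (maxn dB dC).
set Cst := (pi / w *+ 2) ^- n * ((4 / w ^+ 2) ^+ n * 8 ^+ n) : R.
have [d' H'] := absorb1 hM (Cst * 3) dm.
have HAll := evt_and (evt_and Hu Ht) (evt_and H2 (evt_and (evt_and HA HB) (evt_and HC H'))).
exists d'; apply: evtW HAll => e e01 [[hu ht] [h2 [[hA hB] [hC h']]]] xi p Gxi.
have /andP[e0 e1] := e01.
have T1 : 1 <= e^-1 by rewrite invf_ge1.
have T0 : 0 <= e^-1 by apply: le_trans T1.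
have bde d q : 0 <= bd M d e q by exact: bd_ge0.
have c1 : 1 <= c^-1 by rewrite invf_ge1 //; lra.
have ci0 : 0 <= c^-1 by rewrite invr_ge0 ltW.
pose X := `|xi| ^+ p.
have X0 : 0 <= X by rewrite exprn_ge0.
have Mdm q : bd M dA e q <= bd M dm e q /\ bd M dB e q <= bd M dm e q /\ bd M dC e q <= bd M dm e q.
  by split; [|split]; apply: (bd_le hM) => //; rewrite /dm !leq_max leqnn ?orbT.
have key l : (1 + `|l| ^+ (2 * n)) * (X * (Nc (ftn theta e l) * Nc (ftn u e (xi - l))))
    <= 3 * bd M dm e p.
  set A := Nc (ftn theta e l); set B := Nc (ftn u e (xi - l)).
  have A0 : 0 <= A by exact: normc_ge0.
  have B0 : 0 <= B by exact: normc_ge0.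
  have l0 q : 0 <= `|l| ^+ q by rewrite exprn_ge0.
  (* Large frequencies of the multiplier come first. *)
  have [lxi|lxi] := leP (c * `|xi|) `|l|.
    have XL : X <= c^-1 ^+ p.+1 * `|l| ^+ p.
      apply: (@le_trans _ _ (c^-1 ^+ p * `|l| ^+ p)).
        rewrite -exprMn lerXn2r ?nnegrE ?mulr_ge0 //.
        by rewrite ler_pdivlMl.
      by rewrite ler_wpM2r // ler_weXn2l.
    apply: (@le_trans _ _ (c^-1 ^+ p.+1 * ((`|l| ^+ p * A + `|l| ^+ (p + 2 * n) * A) * e^-1 ^+ d2))).
      have -> : c^-1 ^+ p.+1 * ((`|l| ^+ p * A + `|l| ^+ (p + 2 * n) * A) * e^-1 ^+ d2) =
        (1 + `|l| ^+ (2 * n)) * ((c^-1 ^+ p.+1 * `|l| ^+ p) * (A * e^-1 ^+ d2)).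
        by rewrite exprD; ring.
      rewrite ler_wpM2l ?addr_ge0 //; apply: ler_pM => //; first by rewrite mulr_ge0.
      by rewrite ler_wpM2l // h2.
    apply: (@le_trans _ _ (bd M dm e p + bd M dm e p)); last by have := bde dm p; lra.
    rewrite mulrDl mulrDr; apply: lerD.
      apply: le_trans (_ : _ <= bd M dA e p) (Mdm p).1; apply: le_trans (hA p).
      rewrite ler_wpM2l ?exprn_ge0 //.
      apply: (@le_trans _ _ (bd M dt e p * e^-1 ^+ d2)); first by rewrite ler_wpM2r ?exprn_ge0 // ht.
      rewrite /bd mulrAC -exprD ler_wpM2r ?M_ge0 // ler_weXn2l // mulnDl leq_add2l.
      by rewrite leq_pmulr.
    apply: le_trans (_ : _ <= bd M dB e p) (Mdm p).2.1; apply: le_trans (hB p).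
    rewrite ler_wpM2l ?exprn_ge0 //.
    apply: (@le_trans _ _ (bd M dt e (p + 2 * n) * e^-1 ^+ d2)); first by rewrite ler_wpM2r ?exprn_ge0 // ht.
    rewrite /bd mulrAC -exprD ler_wpM2r ?M_ge0 // ler_weXn2l // mulnDl leq_add2l.
    by rewrite leq_pmulr.
  have GG : Gamma (xi - l) by apply: HG => //; exact: ltW.
  have XL : X <= 2 ^+ p.+1 * `|xi - l| ^+ p.
    apply: (@le_trans _ _ (2 ^+ p * `|xi - l| ^+ p)).
      rewrite -exprMn lerXn2r ?nnegrE ?mulr_ge0 //.
      have := ler_normD (xi - l) l; rewrite subrK.
      have : c * `|xi| <= 1 / 2 * `|xi| by rewrite ler_wpM2r.
      lra.
    by rewrite ler_wpM2r ?exprn_ge0 // ler_weXn2l // ler1n.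
  have hl : (1 + `|l| ^+ (2 * n)) * A <= (1 + M (2 * n)) * e^-1 ^+ (dt * (2 * n).+1).
    rewrite mulrDl mul1r mulrDl mul1r; apply: lerD.
      have := ht l 0%N I; rewrite expr0 mul1r => /le_trans; apply.
      by rewrite /bd (M_0 hM) mulr1 ler_weXn2l // leq_mul2l orbC.
    by rewrite [leRHS]mulrC; exact: (ht l (2 * n)%N I).
  apply: (@le_trans _ _ (2 ^+ p.+1 * bd M du e p * ((1 + M (2 * n)) * e^-1 ^+ (dt * (2 * n).+1)))).
    have -> : (1 + `|l| ^+ (2 * n)) * (X * (A * B)) = (X * B) * ((1 + `|l| ^+ (2 * n)) * A) by ring.
    apply: ler_pM => //; rewrite ?mulr_ge0 ?addr_ge0 //.
    apply: (@le_trans _ _ (2 ^+ p.+1 * (`|xi - l| ^+ p * B))); first by rewrite mulrA ler_wpM2r.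
    by rewrite ler_wpM2l ?exprn_ge0 // hu.
  apply: le_trans (_ : _ <= bd M dm e p) _; last by have := bde dm p; lra.
  apply: le_trans (Mdm p).2.2; apply: le_trans (hC p).
  have Mn : 1 <= 1 + M (2 * n) by rewrite lerDl M_ge0.
  have M1 : 0 <= 1 + M (2 * n) by apply: le_trans Mn.
  rewrite /bd exprMn.
  have -> : 2 ^+ p.+1 * (e^-1 ^+ (du * p.+1) * M p) * ((1 + M (2 * n)) * e^-1 ^+ (dt * (2 * n).+1)) =
    2 ^+ p.+1 * (1 + M (2 * n)) * (e^-1 ^+ (du * p.+1 + dt * (2 * n).+1) * M p).
    by rewrite exprD; ring.
  have Mp : 1 + M (2 * n) <= (1 + M (2 * n)) ^+ p.+1.
    by rewrite -[leLHS]expr1; apply: ler_weXn2l.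
  have dd : (du * p.+1 + dt * (2 * n).+1 <= (du + dt * (2 * n).+1) * p.+1)%N.
    by rewrite mulnDl leq_add2l leq_pmulr.
  have Td := ler_weXn2l T1 dd.
  apply: ler_pM.
  - by rewrite mulr_ge0 ?exprn_ge0.
  - by rewrite mulr_ge0 ?exprn_ge0 ?(M_ge0 hM).
  - by apply: ler_wpM2l; rewrite ?exprn_ge0.
  - by apply: ler_wpM2r; rewrite ?(M_ge0 hM).
have rr := ltW r0.
apply: le_trans (h' p); rewrite -mulrA.
have [X00|Xn0] := eqVneq X 0.
  rewrite -/X X00 mul0r; apply: mulr_ge0; last by apply: mulr_ge0 => //; exact: bde.
  have w0 : 0 <= w by rewrite invr_ge0.
  apply: mulr_ge0.
    by rewrite invr_ge0 exprn_ge0 // mulrn_wge0 // divr_ge0 ?pi_ge0.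
  by apply: mulr_ge0; rewrite exprn_ge0 // divr_ge0 // exprn_ge0.
have Xp : 0 < X by rewrite lt_neqAle eq_sym Xn0.
rewrite -/X mulrC -ler_pdivlMr // -mulrA.
apply: (ft_mul_bound w01 rr wr (tnet_tf Kr tth e01) (tnet_tf Kr' tu e01)).
move=> l; rewrite ler_pdivlMr //; apply: le_trans (key l).
rewrite /ftn [leRHS](_ : _ = (1 + `|l| ^+ (2 * n)) *
   (Nc (ft (theta e) l) * Nc (ft (u e) (xi - l))) * X) //.
by move: (Nc _) (Nc _) => A B; ring.
Qed.

End Nets.

(** * Ultradifferentiable bump functions *)

Section Averages.
Variable R : realType.
Local Notation mu1 := (@lebesgue_measure R).

Lemma is_derive_cont (F : R -> R) (x l : R) : is_derive x 1 F l -> {for x, continuous F}.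
Proof. by move=> H; apply/differentiable_continuous/derivable1_diffP; case: H. Qed.

Lemma is_derive_shiftc (F : R -> R) (c x l : R) :
  is_derive (x + c) 1 F l -> is_derive x 1 (fun y : R => F (y + c)) l.
Proof.
move=> H1; have H2 : is_derive x 1 (fun u : R => u + c) 1.
  by have := @is_derive_shift R x 1 c.
have := @is_derive1_comp R F (fun u : R => u + c) x _ _ H1 H2.
by rewrite mulr1.
Qed.

Lemma is_derive_dq (F F' : R -> R) (a x : R) : (forall y : R, is_derive y 1 F (F' y)) ->
  is_derive x 1 (fun y : R => (F (y + a / 2) - F (y - a / 2)) / a)
    ((F' (x + a / 2) - F' (x - a / 2)) / a).
Proof.
move=> dF.
have H : is_derive x 1 (fun y : R => F (y + a / 2) - F (y + - (a / 2)))
   (F' (x + a / 2) - F' (x + - (a / 2))).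
  apply: is_deriveB.
    by apply: (@is_derive_shiftc _ (a / 2)); exact: dF.
  by apply: (@is_derive_shiftc _ (- (a / 2))); exact: dF.
have H2 := is_deriveZ a^-1 H.
rewrite [X in is_derive _ _ X _](_ : _ =
  a^-1 \*: (fun y : R => F (y + a / 2) - F (y + - (a / 2)))).
  by rewrite [X in is_derive _ _ _ X]mulrC; exact: H2.
by apply/funext => y /=; rewrite mulrC.
Qed.

Lemma prim_ex (u : R -> R) (B : R) : continuous u -> (forall x, B < `|x| -> u x = 0) ->
  exists F : R -> R, forall x : R, is_derive x 1 F (u x).
Proof.
move=> cu u0.
have iu : mu1.-integrable setT (EFin \o u).
  have : mu1.-integrable `[- B, B] (EFin \o u).
    by apply: continuous_compact_integrable; [exact: segment_compact|apply: continuous_subspaceT].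
  rewrite -[X in _.-integrable X _ -> _]setIT setIC.
  move/(integrable_restrict mu1 _ measurableT) => /(_ (measurable_itv _)).
  congr (_.-integrable _ _); apply/funext => t; rewrite /patch /=.
  case: ifPn => //; rewrite notin_setE /= in_itv /= -ler_norml => /negP.
  by rewrite -ltNge => /u0 ->.
exists (fun x => \int[mu1]_(t in [set` Interval -oo%O (BRight x)]) u t) => x.
have [||||H1 H2] := @continuous_FTC1 R u -oo%O x (x + 1).
- by rewrite ltrDl.
- by apply: integrableS iu.
- exact: ltNyr.
- exact: (cu x).
by split => //; rewrite -derive1E.
Qed.

(** Averages are only used through a primitive: by the mean value theorem an
    average is a value, which gives all the estimates below at once. *)
Definition prim (u : R -> R) : R -> R :=
  xget (fun=> 0) [set F : R -> R | forall x : R, is_derive x 1 F (u x)].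

Definition Av (a : R) (u : R -> R) (x : R) : R :=
  (prim u (x + a / 2) - prim u (x - a / 2)) / a.

Definition lip (B : R) (u : R -> R) := (forall x y, `|u x - u y| <= `|x - y|) /\
  forall x, B < `|x| -> u x = 0.

Lemma lip_cont B u : lip B u -> continuous u.
Proof.
move=> [lu _] x; apply/(@continuous_norm_near R R^o u x) => e e0.
by exists e => // y; apply: le_lt_trans; exact: lu.
Qed.

Lemma primP B u : lip B u -> forall x : R, is_derive x 1 (prim u) (u x).
Proof.
move=> lu; rewrite /prim; case: xgetP => [F -> //|H].
have [F HF] := prim_ex (lip_cont lu) lu.2.
by have := H F HF.
Qed.

Lemma mean_value (F u : R -> R) (a x : R) : 0 < a -> (forall y : R, is_derive y 1 F (u y)) ->
  exists2 c, `|c - x| <= a / 2 & (F (x + a / 2) - F (x - a / 2)) / a = u c.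
Proof.
move=> a0 dF; have xx : x - a / 2 < x + a / 2 by lra.
have [|c] := @MVT R F u _ _ xx (fun y _ => dF y).
  by apply: continuous_subspaceT => y; exact: is_derive_cont (dF y).
rewrite in_itv /= => /andP[c1 c2] E; exists c.
  by rewrite ler_norml; apply/andP; split; lra.
rewrite E (_ : x + a / 2 - (x - a / 2) = a); first by rewrite mulfK // gt_eqF.
by lra.
Qed.

Lemma Av_mean B u a x : 0 < a -> lip B u -> exists2 c, `|c - x| <= a / 2 & Av a u x = u c.
Proof. by move=> a0 lu; apply: mean_value (primP lu). Qed.

Lemma Av_sub B B' u v a x : 0 < a -> lip B u -> lip B' v ->
  exists c, Av a u x - Av a v x = u c - v c.
Proof.
move=> a0 lu lv.
have [|c _ E] := @mean_value (fun y => prim u y - prim v y) (fun y => u y - v y) a x a0.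
  by move=> y; apply: is_deriveB; [exact: (primP lu)|exact: (primP lv)].
exists c; rewrite -E /Av -mulrBl; congr (_ / _).
by move: (prim _ _) (prim _ _) (prim _ _) (prim _ _) => p q r s; ring.
Qed.

Lemma Av_lip B u a : 0 < a -> lip B u -> lip (B + a / 2) (Av a u).
Proof.
move=> a0 lu; split=> [x y|x Bx].
  have [|c _ E] := @mean_value (fun z => prim u z - prim u (z + (y - x)))
    (fun z => u z - u (z + (y - x))) a x a0.
    move=> z; apply: is_deriveB; first exact: (primP lu).
    by apply: is_derive_shiftc; exact: (primP lu).
  have -> : Av a u x - Av a u y = u c - u (c + (y - x)).
    rewrite -E /Av -mulrBl; congr (_ / _).
    have -> : x + a / 2 + (y - x) = y + a / 2 by ring.
    have -> : x - a / 2 + (y - x) = y - a / 2 by ring.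
    by move: (prim _ _) (prim _ _) (prim _ _) (prim _ _) => p q r s; ring.
  apply: le_trans (lu.1 _ _) _.
  by rewrite opprD addrA subrr add0r opprB.
have [c cx ->] := Av_mean x a0 lu; apply: lu.2.
have := ler_normD c (x - c); rewrite addrC subrK [`|x - c|]distrC; lra.
Qed.

Lemma Av_derive B u a (x : R) : 0 < a -> lip B u ->
  is_derive x 1 (Av a u) ((u (x + a / 2) - u (x - a / 2)) / a).
Proof.
by move=> a0 lu; apply: is_derive_dq; exact: (primP lu).
Qed.

Variable a : nat -> R.
Hypothesis a0 : forall j, 0 < a j.
Hypothesis asum : forall N, \sum_(0 <= j < N) a j <= 1.

(** The starting point: a Lipschitz plateau, equal to 1 on [-2, 2], the averages of total
    width at most 1 preserving the value 1 on [-1, 1]. *)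
Definition trap (x : R) : R := Num.max 0 (Num.min 1 (3 - `|x|)).

(** Successive averages over windows of widths [a j], ..., [a (j + m - 1)]. The starting index
    is kept because the derivative of the limit at [j] involves the limit at [j.+1]. *)
Fixpoint Wav (m j : nat) : R -> R :=
  if m is m'.+1 then Av (a j) (Wav m' j.+1) else trap.

Definition psum N : R := \sum_(0 <= j < N) a j.

Lemma psumS N : psum N.+1 = psum N + a N.
Proof. by rewrite /psum big_nat_recr. Qed.

Lemma psum_mono p q : (p <= q)%N -> psum p <= psum q.
Proof.
move=> /subnKC <-; elim: (q - p)%N => [|k IH]; first by rewrite addn0.
by rewrite addnS psumS; apply: le_trans IH _; rewrite lerDl ltW.
Qed.

Lemma trap_lip : lip 3 trap.
Proof.
split=> [x y|x x3]; rewrite /trap.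
  have := ler_dist_dist x y; rewrite ler_norml => /andP[h1 h2].
  have h3 : 0 <= `|x - y| by [].
  case: (leP 1 (3 - `|x|)) => ?; case: (leP 1 (3 - `|y|)) => ?;
    rewrite ?(max_r ler01); try case: (leP 0 (3 - `|x|)) => ?;
    try case: (leP 0 (3 - `|y|)) => ?; rewrite ler_norml; apply/andP; split; lra.
rewrite max_l // ge_min; apply/orP; right; lra.
Qed.

Lemma trap_le1 x : `|trap x| <= 1.
Proof.
rewrite ger0_norm; last by rewrite /trap le_max lexx.
by rewrite /trap ge_max ler01 ge_min lexx.
Qed.

Lemma Wav_lip m j : lip (3 + (psum (j + m) - psum j) / 2) (Wav m j).
Proof.
elim: m j => [|m IH] j; first by rewrite addn0 subrr mul0r addr0; exact: trap_lip.
have := Av_lip (a0 j) (IH j.+1); rewrite /= addSnnS.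
have -> : 3 + (psum (j + m.+1) - psum j.+1) / 2 + a j / 2 =
  3 + (psum (j + m.+1) - psum j) / 2 by rewrite psumS; lra.
by [].
Qed.

Lemma lip_wk B B' u : B <= B' -> lip B u -> lip B' u.
Proof. by move=> BB [l h]; split=> // x xB; apply: h; exact: le_lt_trans xB. Qed.

Lemma psum01 p q : psum p - psum q <= 1.
Proof.
have := asum p; rewrite -/(psum p); have : 0 <= psum q by apply: sumr_ge0 => i _; exact: ltW.
by lra.
Qed.

Lemma Wav_lip4 m j : lip 4 (Wav m j).
Proof. by apply: lip_wk (Wav_lip m j); have := psum01 (j + m) j; lra. Qed.

Lemma Wav_le1 m j x : `|Wav m j x| <= 1.
Proof.
elim: m j x => [|m IH] j x /=; first exact: trap_le1.
by have [c _ ->] := Av_mean x (a0 j) (Wav_lip4 m j.+1).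
Qed.

Lemma Wav_plateau m j x : `|x| <= 2 - (psum (j + m) - psum j) / 2 -> Wav m j x = 1.
Proof.
elim: m j x => [|m IH] j x.
  rewrite addn0 subrr mul0r subr0 /= /trap => x2.
  by rewrite min_l ?max_r //; lra.
move=> xb /=; have [c cx ->] := Av_mean x (a0 j) (Wav_lip4 m j.+1).
apply: IH; rewrite addSnnS psumS.
have := ler_normD (c - x) x; rewrite subrK; lra.
Qed.

Lemma Wav_step m j x : `|Wav m.+1 j x - Wav m j x| <= a (j + m).
Proof.
elim: m j x => [|m IH] j x.
  rewrite addn0 /=; have [c cx ->] := Av_mean x (a0 j) trap_lip.
  by apply: le_trans (trap_lip.1 _ _) _; have := a0 j; lra.
rewrite -addSnnS.
have [c ->] := Av_sub x (a0 j) (Wav_lip4 m.+1 j.+1) (Wav_lip4 m j.+1).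
exact: IH.
Qed.

Lemma Wav_cauchy m k j x : `|Wav (m + k) j x - Wav m j x| <= psum (j + (m + k)) - psum (j + m).
Proof.
elim: k => [|k IH]; first by rewrite addn0 !subrr normr0.
rewrite !addnS psumS.
have := Wav_step (m + k) j x; move: IH.
have := ler_normD (Wav (m + k).+1 j x - Wav (m + k) j x) (Wav (m + k) j x - Wav m j x).
by rewrite subrKA; lra.
Qed.

Lemma psum_cvg : exists L, forall e, 0 < e -> exists N, forall m, (N <= m)%N ->
  L - e < psum m /\ psum m <= L.
Proof.
pose A := range psum; have hA : has_sup A.
  by split; [exists (psum 0), 0%N|exists 1 => _ [N _ <-]; exact: asum].
exists (sup A) => e e0.
have [_ [N _ <-] HN] := sup_adherent e0 hA.
exists N => m Nm; split; first exact: lt_le_trans HN (psum_mono Nm).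
by apply: ub_le_sup; [case: hA|exists m].
Qed.

(** Averaging a 1-Lipschitz function over a window of width [a] moves it by at most [a], and
    the widths are summable, so the convergence is uniform. *)
Lemma Wav_lim : exists U : nat -> R -> R, forall e, 0 < e -> exists N, forall m, (N <= m)%N ->
  forall j x, `|U j x - Wav m j x| <= e.
Proof.
have [L HL] := psum_cvg.
have mono j x : exists l : R, forall m, Wav m j x - (L - psum (j + m)) <= l <= Wav m j x + (L - psum (j + m)).
  pose A := range (fun m => Wav m j x - (L - psum (j + m))).
  have Lm m : psum m <= L.
    by have [N HN] := HL 1 ltr01; have [_] := HN (maxn N m) (leq_maxl _ _);
      apply: le_trans; apply: psum_mono; exact: leq_maxr.
  have ub k m : Wav k j x - (L - psum (j + k)) <= Wav m j x + (L - psum (j + m)).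
    have [km|mk] := leqP k m.
      have := Wav_cauchy k (m - k) j x; rewrite subnKC // ler_norml => /andP[h1 h2].
      have := Lm (j + m)%N; lra.
    have := Wav_cauchy m (k - m) j x; rewrite subnKC 1?ltnW // ler_norml => /andP[h1 h2].
    have := Lm (j + k)%N; lra.
  have hA : has_sup A.
    by split; [exists (Wav 0 j x - (L - psum (j + 0))), 0%N|
      exists (Wav 0 j x + (L - psum (j + 0))) => _ [k _ <-]; exact: ub].
  exists (sup A) => m; apply/andP; split.
    by apply: ub_le_sup; [case: hA|exists m].
  by apply: ge_sup; [case: hA|move=> _ [k _ <-]; exact: ub].
have HU j : exists u : R -> R, forall x m, Wav m j x - (L - psum (j + m)) <= u x <= Wav m j x + (L - psum (j + m)).
  by have [u Hu] := choice (mono j); exists u.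
have [U {}HU] := choice HU; exists U => e e0.
have [N HN] := HL e e0; exists N => m Nm j x.
have /andP[h1 h2] := HU j x m.
have [h3 h4] := HN (j + m)%N (leq_trans Nm (leq_addl _ _)).
by rewrite ler_norml; apply/andP; split; lra.
Qed.

(** The limits satisfy the averaging recursion exactly, because it shifts the starting index. *)
Lemma chain_ex : exists U : nat -> R -> R,
  [/\ forall j, U j = Av (a j) (U j.+1), forall j, lip 4 (U j),
      forall j x, `|U j x| <= 1 & forall j x, `|x| <= 1 -> U j x = 1].
Proof.
have [U HU] := Wav_lim.
have lU j : lip 4 (U j).
  split=> [x y|x x4]; last first.
    apply/eqP; rewrite -normr_le0; apply/ler_addgt0Pl => e e0; rewrite addr0.
    have [N HN] := HU e e0.
    by have := HN N (leqnn N) j x; rewrite (Wav_lip4 N j).2 // subr0.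
  apply/ler_addgt0Pl => e e0.
  have [N HN] := HU (e / 2) ltac:(by rewrite divr_gt0).
  have h1 := HN N (leqnn N) j x; have h2 := HN N (leqnn N) j y.
  have h3 := (Wav_lip4 N j).1 x y.
  move: h1 h2 h3; rewrite 2!ler_norml => /andP[p1 p2] /andP[p3 p4].
  rewrite ler_norml => /andP[p5 p6]; rewrite ler_norml; apply/andP; split; lra.
exists U; split => //.
- move=> j; apply/funext => x; apply/eqP; rewrite -subr_eq0 -normr_le0.
  apply/ler_addgt0Pl => e e0; rewrite addr0.
  have [N HN] := HU (e / 2) ltac:(by rewrite divr_gt0).
  have h1 := HN N.+1 (leqnSn N) j x.
  have [c E] := Av_sub x (a0 j) (lU j.+1) (Wav_lip4 N j.+1).
  have h2 := HN N (leqnn N) j.+1 c; rewrite -E in h2.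
  move: h1 h2; rewrite /= 2!ler_norml => /andP[p1 p2] /andP[p3 p4].
  by rewrite ler_norml; apply/andP; split; lra.
- move=> j x; apply/ler_addgt0Pl => e e0.
  have [N HN] := HU e e0.
  have h1 := HN N (leqnn N) j x; have h2 := Wav_le1 N j x.
  have := ler_normD (U j x - Wav N j x) (Wav N j x); rewrite subrK; lra.
- move=> j x x1; apply/eqP; rewrite -subr_eq0 -normr_le0.
  apply/ler_addgt0Pl => e e0; rewrite addr0.
  have [N HN] := HU e e0.
  have := HN N (leqnn N) j x; rewrite Wav_plateau //.
  by have := psum01 (j + N) j; lra.
Qed.

(** Each derivative falls on the outermost average still available, where it
    becomes a difference quotient. *)
Lemma bump_chain : exists D : nat -> R -> R,
  [/\ forall p (x : R), is_derive x 1 (D p) (D p.+1 x),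
      forall p x, `|D p x| <= \prod_(i < p) (2 / a i),
      forall x, `|x| <= 1 -> D 0%N x = 1 & forall x, 4 < `|x| -> D 0%N x = 0].
Proof.
have [U [UA lU U1 Up]] := chain_ex.
pose fix D (p j : nat) (x : R) {struct p} : R := if p is p'.+1 then
  (D p' j.+1 (x + a j / 2) - D p' j.+1 (x - a j / 2)) / a j else U j x.
have dD p j (x : R) : is_derive x 1 (D p j) (D p.+1 j x).
  elim: p j x => [|p IH] j x.
    by have := Av_derive x (a0 j) (lU j.+1); rewrite -UA.
  exact: (is_derive_dq (a j) x (IH j.+1)).
have bD p j x : `|D p j x| <= \prod_(i < p) (2 / a (j + i)).
  elim: p j x => [|p IH] j x; first by rewrite big_ord0 /=; exact: U1.
  rewrite big_ord_recl addn0 /= normrM normfV (gtr0_norm (a0 j)).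
  set P := \prod_(i < p) _.
  have h y : `|D p j.+1 y| <= P.
    by apply: le_trans (IH _ _) _; rewrite /P; under eq_bigr do rewrite addSnnS.
  rewrite [leRHS]mulrAC ler_wpM2r ?invr_ge0 ?(ltW (a0 j)) //.
  by apply: le_trans (ler_normB _ _) _; have := h (x + a j / 2); have := h (x - a j / 2); lra.
exists (fun p => D p 0%N); split=> //.
- by move=> x; exact: Up.
- by move=> x; exact: (lU 0%N).2.
Qed.

End Averages.

(** * Bumps with derivatives bounded by the weight sequence *)

Section BumpV.
Variables (R : realType) (n : nat) (M : nat -> R).
Hypothesis hM : weight_sequence M.
Local Notation V := 'rV[R]_n.
Local Notation C := R[i].
Local Notation Nc := (@Normc.normc R).

(** Windows proportional to [M p / M p.+1] have finite total width by non-quasianalyticity,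
    and the product of their reciprocals telescopes to [M p]. *)
Lemma bump1 : exists (D : nat -> R -> R) (L : R),
  [/\ 1 <= L, forall p (x : R), is_derive x 1 (D p) (D p.+1 x),
      forall p x, `|D p x| <= L ^+ p * M p,
      forall x, `|x| <= 1 -> D 0%N x = 1 & forall x, 4 < `|x| -> D 0%N x = 0].
Proof.
have [S HS] := mratio_sum hM.
have S0 : 0 <= S by have := HS 0%N; rewrite big_geq.
pose k := (S + 1)^-1.
have S1 : 0 < S + 1 by rewrite ltr_wpDl.
have k0 : 0 < k by rewrite invr_gt0.
pose a j := k * mratio M j.
have a0 j : 0 < a j by rewrite mulr_gt0 ?mratio_gt0.
have asum N : \sum_(0 <= j < N) a j <= 1.
  rewrite -mulr_sumr mulrC ler_pdivrMr // mul1r.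
  by apply: le_trans (HS N) _; rewrite lerDl.
have [D [dD bD D1 D0]] := bump_chain a0 asum.
exists D, (2 / k); split=> //.
  by rewrite /k invrK; have : 0 <= S by []; lra.
move=> p x; apply: le_trans (bD p x) _.
suff -> : \prod_(i < p) (2 / a i) = (2 / k) ^+ p * M p by [].
elim: p {x} => [|p IH]; first by rewrite big_ord0 expr0 mul1r (M_0 hM).
rewrite big_ord_recr /= IH /a /mratio exprSr; field.
by rewrite !gt_eqF ?(M_gt0 hM).
Qed.

Lemma wD_dot (U : nat -> R -> R) (l : V) : (forall p (t : R), is_derive t 1 (U p) (U p.+1 t)) ->
  smooth setT (fun x => (U 0%N (dotv l x))%:C)%C /\
  forall w x, wD w (fun x => (U 0%N (dotv l x))%:C)%C x =
    ((\prod_(i <- w) l 0 i * U (size w) (dotv l x))%:C)%C.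
Proof.
move=> dU; split.
  apply/smoothE; split => k.
    by have := rsm_dot l dU 0 1 k; apply: Ck_eq; [exact: openT|move=> x _; rewrite mul1r].
  exact: Ck_cst.
elim=> [|i w IH] x; first by rewrite big_nil mul1r.
rewrite /= (cD_eq i openT (fun y _ => IH y)) // /cD /reF /imF /=.
have H := derive_dot i (dU (size w) (dotv l x)).
rewrite /pderiv (derive_cst (0 : R^o)) big_cons.
have H2 := @is_deriveZ _ _ _ _ (\prod_(j <- w) l 0 j) x _ _ H.
have [_ ->] := H2.
by congr (_%:C)%C; rewrite /GRing.scale /=; ring.
Qed.

(** The Leibniz estimate, with [M j * M k <= M (j + k)]. *)
Lemma ultra_mul W (x : V) (f g : V -> C) (L : R) : open W -> W x -> smooth W f -> smooth W g ->
  1 <= L ->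
  (forall w, Nc (wD w f x) <= L ^+ (size w).+1 * M (size w)) ->
  (forall w, Nc (wD w g x) <= L ^+ (size w).+1 * M (size w)) ->
  forall w, Nc (wD w (fun x => f x * g x) x) <= (2 * L ^+ 2) ^+ (size w).+1 * M (size w).
Proof.
move=> oW Wx sf sg L1 bf bg w.
have L0 : 0 <= L by apply: le_trans L1.
pose F j := L ^+ j.+1 * M j.
have F0 j : 0 <= F j by rewrite mulr_ge0 ?exprn_ge0 ?(M_ge0 hM).
have FF j k : (j + k <= size w)%N -> F j * F k <= L ^+ (j + k).+2 * M (j + k)%N.
  move=> _; rewrite /F mulrACA -exprD addSn addnS; apply: ler_wpM2l; first by rewrite exprn_ge0.
  exact: M_mul.
have := @leibniz_bound R n W x w f g F F (fun j => L ^+ j.+2 * M j) (size w) oW Wx sf sg F0 F0 FF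
  (fun u _ => bf u) (fun u _ => bg u) (leqnn _).
move=> /le_trans; apply; rewrite mulrA; apply: ler_wpM2r; first exact: M_ge0.
rewrite exprMn; apply: ler_pM; rewrite ?exprn_ge0 //.
  by rewrite ler_weXn2l // ler1n.
by rewrite -exprM ler_weXn2l //; lia.
Qed.

(** The product over the coordinates of rescaled bumps in one variable. *)
Lemma bumpV (c : V) (r : R) : 0 < r -> exists (phi : V -> C) (L : R),
  [/\ 1 <= L, smooth setT phi, forall w x, Nc (wD w phi x) <= L ^+ (size w).+1 * M (size w),
      forall x, `|x - c| <= r -> phi x = 1 & forall x, 4 * r < `|x - c| -> phi x = 0].
Proof.
move=> r0; have [D [L [L1 dD bD D1 D0]]] := bump1.
have L0 : 0 <= L by apply: le_trans L1.
pose l (i : 'I_n) : V := r^-1 *: delta_mx 0 i.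
pose U i p (t : R) := D p (t - c 0 i / r).
have dU i p (t : R) : is_derive t 1 (U i p) (U i p.+1 t).
  by apply: (@is_derive_shiftc _ _ (- (c 0 i / r))); exact: dD.
pose F i x := ((U i 0%N (dotv (l i) x))%:C)%C.
have EF i x : F i x = ((D 0%N ((x - c) 0 i / r))%:C)%C.
  by rewrite /F /U dotvC /l dotvZr dotv_delta !mxE mulrBl mulrC.
have sF i : smooth setT (F i) by have [] := wD_dot (l i) (dU i).
pose rho := Num.max 1 r^-1; have rho1 : 1 <= rho by rewrite le_max lexx.
have rho0 : 0 <= rho by apply: le_trans rho1.
pose L' := Num.max 1 (rho * L).
have L'1 : 1 <= L' by rewrite le_max lexx.
have bF i w x : Nc (wD w (F i) x) <= L' ^+ (size w).+1 * M (size w).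
  have [_ ->] := wD_dot (l i) (dU i).
  rewrite normc_real normrM.
  have h1 : `|\prod_(j <- w) (l i) 0 j| <= rho ^+ size w.
    elim: w => [|j w IH]; first by rewrite big_nil normr1.
    rewrite big_cons normrM exprS; apply: ler_pM => //.
    apply: (@le_trans _ _ (r^-1)); last by rewrite le_max lexx orbT.
    rewrite mxE normrM (gtr0_norm (_ : 0 < r^-1)) ?invr_gt0 // ler_piMr ?invr_ge0 ?(ltW r0) //.
    by rewrite mxE; case: (_ && _); rewrite ?normr0 ?normr1.
  apply: (@le_trans _ _ (rho ^+ size w * (L ^+ size w * M (size w)))).
    by apply: ler_pM => //; exact: bD.
  rewrite mulrA -exprMn; apply: ler_wpM2r; first exact: M_ge0.
  apply: (@le_trans _ _ (L' ^+ size w)); last by rewrite ler_weXn2l.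
  by rewrite lerXn2r ?nnegrE ?mulr_ge0 ?le_max ?ler01 ?lexx ?orbT.
have prodF (s : seq 'I_n) : exists2 K, 1 <= K & forall w x,
   Nc (wD w (fun x => \prod_(i <- s) F i x) x) <= K ^+ (size w).+1 * M (size w).
  elim: s => [|i s [K K1 IH]].
    exists 1 => // w x; rewrite (_ : (fun x => _) = fun=> 1); last first.
      by apply/funext => y; rewrite big_nil.
    rewrite wD_cst expr1n mul1r; case: w => [|j w]; first by rewrite Normc.normc1 (M_0 hM).
    by rewrite Normc.normc0 (M_ge0 hM).
  pose K2 := Num.max L' K.
  have K20 : 1 <= K2 by rewrite le_max L'1.
  exists (2 * K2 ^+ 2).
    have : 1 <= K2 ^+ 2 by rewrite exprn_ege1.
    by lra.
  move=> w x; under [X in wD w X]funext do rewrite big_cons.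
  have up (A : R) (w' : seq 'I_n) : 1 <= A -> A <= K2 -> A ^+ (size w').+1 * M (size w') <= K2 ^+ (size w').+1 * M (size w').
    move=> A1 AK; apply: ler_wpM2r; first exact: M_ge0.
    by rewrite lerXn2r ?nnegrE ?(le_trans ler01).
  apply: (@ultra_mul setT) => //; first exact: openT.
  - by apply: smooth_prod => //; exact: openT.
  - by move=> w'; apply: (le_trans (bF i w' x)); apply: up; rewrite // le_max lexx.
  - by move=> w'; apply: (le_trans (IH w' x)); apply: up; rewrite // le_max lexx orbT.
have [K K1 HK] := prodF (index_enum 'I_n).
exists (fun x => \prod_i F i x), K; split=> //.
- by apply: smooth_prod => //; exact: openT.
- move=> x xc; apply: big1 => i _; rewrite EF D1 //.
  rewrite normrM normfV (gtr0_norm r0) ler_pdivrMr // mul1r.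
  exact: le_trans (coord_le_norm _ _) xc.
- move=> x xc; have [x0|[i Hi]] := norm_attained (x - c).
    by move: xc; rewrite x0 ltNge mulr_ge0 // ltW.
  apply/eqP/prodf_eq0; exists i => //; rewrite EF D0 //.
  by rewrite normrM normfV (gtr0_norm r0) ltr_pdivlMr // -Hi.
Qed.

End BumpV.

(** * Moderate, negligible and regular nets *)

Section NetAlgebra.
Variables (R : realType) (n : nat) (M : nat -> R).
Hypothesis hM : weight_sequence M.
Local Notation V := 'rV[R]_n.
Local Notation C := R[i].
Local Notation Nc := (@Normc.normc R).
Local Notation net := (net R n).
Implicit Types (B K Gamma W Omega : set V) (u v theta t : net).

Definition Mod Omega u := smooth_net Omega u /\
  forall K, compact K -> K `<=` Omega -> MODon K u.
Definition Neg Omega u := smooth_net Omega u /\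
  forall K, compact K -> K `<=` Omega -> NEGon K u.
Definition MAr Omega u := smooth_net Omega u /\
  forall K, compact K -> K `<=` Omega -> MAon M K u.

Lemma NEG_MOD B u : NEGon B u -> MODon B u.
Proof.
move=> H w; exists 0%N; apply: evtW (H w 0%N) => e _ h x Bx.
by have := h x Bx; rewrite !expr0.
Qed.

Lemma Neg_Mod Omega u : Neg Omega u -> Mod Omega u.
Proof. by move=> [s H]; split=> // K cK KO; apply: NEG_MOD; exact: H. Qed.

Lemma MAr_Mod Omega u : MAr Omega u -> Mod Omega u.
Proof. by move=> [s H]; split=> // K cK KO; apply: (MA_MOD (M := M)); exact: H. Qed.

Lemma aword_of w : exists a : {ffun 'I_n -> nat}, mlen a = size w /\
  forall Omega (f : V -> C), open Omega -> smooth Omega f ->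
  forall x, Omega x -> partial a f x = wD w f x.
Proof.
have [a pa sa] := aword_surj w; exists a; split=> // Omega f oO sf x Ox.
by rewrite partial_wD; exact: (wD_perm oO sf pa).
Qed.

Lemma moderateP Omega u : open Omega -> moderate Omega u <-> Mod Omega u.
Proof.
move=> oO; split=> -[su H]; split=> //.
  move=> K cK KO w; have [a [_ Ha]] := aword_of w.
  have [m [c [eta [c0 eta1 h]]]] := H K a cK KO.
  have [d Hd] := absorb_pow c m; exists d.
  apply: evtW (evt_and Hd (ex_intro _ eta (conj eta1 h))) => e e01 [hd he] x Kx.
  rewrite -(Ha Omega) //; [|exact: su|exact: KO].
  by apply: le_trans (he x Kx) _; rewrite exprVn in hd *.
move=> K a cK KO; have [d [eta [eta1 h]]] := H K cK KO (aword a).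
exists d, 1, eta; split=> // e e0 x Kx.
by rewrite partial_wD mul1r -exprVn; exact: h.
Qed.

Lemma negligible_netP Omega u : open Omega -> Defs.negligible Omega u <-> Neg Omega u.
Proof.
move=> oO; split=> [[[su _] H]|[su H]].
  split=> // K cK KO w m; have [a [_ Ha]] := aword_of w.
  have [c [eta [c0 eta1 h]]] := H K a m.+1 cK KO.
  apply: evtW (evt_and (evt_big c) (ex_intro _ eta (conj eta1 h))) => e e01 [hd he] x Kx.
  rewrite -(Ha Omega) //; [|exact: su|exact: KO].
  have /andP[e0 e1] := e01.
  apply: le_trans (he x Kx) _; rewrite exprS mulrA ler_piMl ?exprn_ge0 ?(ltW e0) //.
  by rewrite -ler_pdivlMr // div1r.
split; first by apply/moderateP => //; exact: Neg_Mod.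
move=> K a m cK KO; have [eta [eta1 h]] := H K cK KO (aword a) m.
exists 1, eta; split=> // e e0 x Kx.
by rewrite partial_wD mul1r; exact: h.
Qed.

Lemma powR_nat_bound (e N : R) d : 0 < e <= 1 -> N <= d%:R -> e `^ (- N) <= e^-1 ^+ d.
Proof.
move=> /andP[e0 e1] Nd; rewrite powRN exprVn lef_pV2 ?posrE ?exprn_gt0 ?powR_gt0 //.
by rewrite -powR_mulrn ?(ltW e0) //; apply: ger_powR => //; rewrite e0.
Qed.

(** An exponent below [a m + b] is below [d (m + 1)] for some integer [d], and the geometric
    constant is absorbed as well. *)
Lemma moderateMAP Omega u : open Omega -> moderateMA Omega M u <-> MAr Omega u.
Proof.
move=> oO; split=> -[su H]; split=> //.
  move=> K cK KO; have [N [c [eta [[N0 [a [b [a0 b0 Nab]]]] c0 eta1 h]]]] := H K cK KO.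
  pose d := (Num.truncn (a + b)).+1.
  have Nd m : N m <= (d * m.+1)%:R.
    apply: le_trans (Nab m) _; rewrite natrM.
    have hd : a + b <= d%:R by apply/ltW/truncnS_gt.
    apply: (@le_trans _ _ ((a + b) * m.+1%:R)); last by rewrite ler_wpM2r.
    by rewrite mulrDl; apply: lerD; [rewrite ler_wpM2l // ler_nat|rewrite ler_peMr // ler1n].
  have [d' Hd] := absorb0 hM c d; exists d'.
  have hh : evt (fun e => forall (al : {ffun 'I_n -> nat}) x, K x ->
      Nc (partial al (u e) x) <= c ^+ (mlen al).+1 * M (mlen al) * e `^ (- N (mlen al))).
    by exists eta; split=> // e e0 al x Kx; exact: h.
  apply: evtW (evt_and Hd hh) => e e01 [hd he] w x Kx.
  have [al [sa Ha]] := aword_of w.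
  rewrite -(Ha Omega) //; [|exact: su|exact: KO].
  apply: le_trans (he al x Kx) _; rewrite sa; apply: le_trans (hd (size w)).
  rewrite /bd -mulrA ler_wpM2l ?exprn_ge0 ?(ltW c0) // mulrC ler_wpM2r ?(M_ge0 hM) //.
  exact: powR_nat_bound.
move=> K cK KO; have [d [eta [eta1 h]]] := H K cK KO.
exists (fun m => (d * m.+1)%:R), 1, eta; split=> //.
  split=> [m|]; first by [].
  exists d%:R, d%:R; split=> // m.
  by rewrite natrM -natr1 mulrDr mulr1.
move=> al e e0 x Kx; rewrite partial_wD expr1n mul1r mulrC -size_aword.
apply: le_trans (h e e0 (aword al) x Kx) _.
have /andP[ep _] := e0.
by rewrite /bd powRN powR_mulrn ?(ltW ep) // exprVn.
Qed.

Lemma compact_cball (x : V) (e : R) : compact [set y : V | `|y - x| <= e].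
Proof.
apply: bounded_closed_compact.
  exists (`|x| + e); split; first exact: num_real.
  move=> B xB y /= yx; have := ler_normD (y - x) x; rewrite subrK; lra.
rewrite (_ : [set y : V | _] = closed_ball_ Num.norm x e); first exact: closed_closed_ball_.
by apply/seteqP; split=> y /=; rewrite distrC.
Qed.

Lemma nbhs_cball (x : V) (e : R) : 0 < e -> nbhs x [set y : V | `|y - x| <= e].
Proof.
move=> e0; apply/(nbhs_ballP x); exists e => //= y.
by rewrite -ball_normE /= distrC => /ltW.
Qed.

Lemma nbhs_cball_sub (x : V) W : nbhs x W -> exists2 e, 0 < e & [set y : V | `|y - x| <= e] `<=` W.
Proof.
move=> /(nbhs_ballP x)[/= e e0 He]; exists (e / 2); first by rewrite divr_gt0.
move=> y /= yx; apply: He; rewrite -ball_normE /= distrC.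
by apply: le_lt_trans yx _; rewrite ltr_pdivrMr // ltr_pMr // ltr1n.
Qed.

Lemma nbhs_compact Omega x : open Omega -> Omega x ->
  exists K, [/\ compact K, nbhs x K & K `<=` Omega].
Proof.
move=> oO Ox; have [e e0 He] := nbhs_cball_sub (open_nbhs_nbhs (conj oO Ox)).
exists [set y | `|y - x| <= e]; split=> //; [exact: compact_cball|exact: nbhs_cball].
Qed.

Lemma NEGonS B B' u : B `<=` B' -> NEGon B' u -> NEGon B u.
Proof. by move=> BB H w m; apply: evtW (H w m) => e _ h x /BB; exact: h. Qed.
Lemma MAonS B B' u : B `<=` B' -> MAon M B' u -> MAon M B u.
Proof. by move=> BB [d h]; exists d; apply: evtW h => e _ h w x /BB; exact: h. Qed.

Lemma NEGonU B B' u : NEGon B u -> NEGon B' u -> NEGon (B `|` B') u.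
Proof.
move=> H H' w m; apply: evtW (evt_and (H w m) (H' w m)) => e _ [k k'] x.
by move=> [Bx|Bx]; [exact: k|exact: k'].
Qed.
Lemma MAonU B B' u : MAon M B u -> MAon M B' u -> MAon M (B `|` B') u.
Proof.
move=> [d h] [d' h']; exists (maxn d d'); apply: evtW (evt_and h h') => e e01 [k k'] w x.
by move=> [Bx|Bx]; [apply: le_trans (k w x Bx) _|apply: le_trans (k' w x Bx) _];
  apply: (bd_le hM) => //; rewrite ?leq_maxl ?leq_maxr.
Qed.

(** Finitely many of the neighbourhoods cover a given compact set, and the bounds pass to
    finite unions. *)
Lemma Neg_loc Omega u : (forall x, Omega x -> exists W, [/\ open W, W x & Neg W u]) -> Neg Omega u.
Proof.
move=> H; split.
  by move=> e e01; apply: smooth_loc => x /H [W [oW Wx [s _]]]; exists W => //; exact: s.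
move=> K cK KO; apply: (@compact_ind _ K (fun B => NEGon B u)) => //.
- by move=> w m; apply: evt_all.
- by move=> A B; apply: NEGonU.
- by move=> A B AB; apply: NEGonS.
move=> x /KO /H [W [oW Wx [_ h]]]; have [K' [cK' nK' K'W]] := nbhs_compact oW Wx.
by exists K' => //; exact: h.
Qed.
Lemma MAr_loc Omega u : (forall x, Omega x -> exists W, [/\ open W, W x & MAr W u]) -> MAr Omega u.
Proof.
move=> H; split.
  by move=> e e01; apply: smooth_loc => x /H [W [oW Wx [s _]]]; exists W => //; exact: s.
move=> K cK KO; apply: (@compact_ind _ K (fun B => MAon M B u)) => //.
- by exists 0%N; apply: evt_all.
- by move=> A B; apply: MAonU.
- by move=> A B AB; apply: MAonS.
move=> x /KO /H [W [oW Wx [_ h]]]; have [K' [cK' nK' K'W]] := nbhs_compact oW Wx.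
by exists K' => //; exact: h.
Qed.

Lemma ModS Omega W u : W `<=` Omega -> Mod Omega u -> Mod W u.
Proof.
move=> WO [s h]; split=> [e /s|K cK KW]; first exact: smooth_sub.
by apply: h => // x /KW /WO.
Qed.
Lemma NegS Omega W u : W `<=` Omega -> Neg Omega u -> Neg W u.
Proof.
move=> WO [s h]; split=> [e /s|K cK KW]; first exact: smooth_sub.
by apply: h => // x /KW /WO.
Qed.
Lemma MArS Omega W u : W `<=` Omega -> MAr Omega u -> MAr W u.
Proof.
move=> WO [s h]; split=> [e /s|K cK KW]; first exact: smooth_sub.
by apply: h => // x /KW /WO.
Qed.

Definition eqon Omega u v := forall e, 0 < e <= 1 -> forall x, Omega x -> u e x = v e x.

Lemma Mod_eq Omega u v : open Omega -> eqon Omega u v -> Mod Omega u -> Mod Omega v.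
Proof.
move=> oO uv [s h]; split=> [e e01|K cK KO w].
  by apply: smooth_eq (s e e01) => // x; exact: uv.
have [d k] := h K cK KO w; exists d; apply: evtW k => e e01 k x Kx.
by rewrite -(wD_eq w oO (uv e e01) (KO x Kx)); exact: k.
Qed.
Lemma Neg_eq Omega u v : open Omega -> eqon Omega u v -> Neg Omega u -> Neg Omega v.
Proof.
move=> oO uv [s h]; split=> [e e01|K cK KO w m].
  by apply: smooth_eq (s e e01) => // x; exact: uv.
apply: evtW (h K cK KO w m) => e e01 k x Kx.
by rewrite -(wD_eq w oO (uv e e01) (KO x Kx)); exact: k.
Qed.
Lemma MAr_eq Omega u v : open Omega -> eqon Omega u v -> MAr Omega u -> MAr Omega v.
Proof.
move=> oO uv [s h]; split=> [e e01|K cK KO].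
  by apply: smooth_eq (s e e01) => // x; exact: uv.
have [d k] := h K cK KO; exists d; apply: evtW k => e e01 k w x Kx.
by rewrite -(wD_eq w oO (uv e e01) (KO x Kx)); exact: k.
Qed.

Fixpoint words m : seq (seq 'I_n) :=
  if m is m'.+1 then [::] :: [seq i :: w | i <- enum 'I_n, w <- words m'] else [:: [::]].

Lemma words_mem m w : (size w <= m)%N -> w \in words m.
Proof.
elim: m w => [|m IH] [|i w] //= wm; rewrite inE; apply/orP; right.
by apply/allpairsP; exists (i, w); split=> //=; [rewrite mem_enum|exact: IH].
Qed.

Lemma evt_words_le (P : seq 'I_n -> R -> Prop) m : (forall w, evt (P w)) ->
  evt (fun e => forall w, (size w <= m)%N -> P w e).
Proof.
move=> H; have := @evt_bigop R _ (words m) P (fun w _ => H w).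
by apply: evtW => e _ h w /words_mem; exact: h.
Qed.

Lemma MODon_le B u m : MODon B u -> exists d, evt (fun e =>
  forall w, (size w <= m)%N -> forall x, B x -> Nc (wD w (u e) x) <= e^-1 ^+ d).
Proof.
move=> H; have [d Hd] := choice H.
exists (\max_(w <- words m) d w); apply: evtW (evt_words_le m Hd) => e /andP[e0 e1] h w sw x Bx.
apply: le_trans (h w sw x Bx) _; rewrite ler_weXn2l ?invf_ge1 //.
by rewrite (big_rem w) /= ?words_mem // leq_maxl.
Qed.

Lemma Mod_mul Omega u v : open Omega -> Mod Omega u -> Mod Omega v ->
  Mod Omega (fun e x => u e x * v e x).
Proof.
move=> oO [su hu] [sv hv]; split=> [e e01|K cK KO w]; first by apply: smoothM; [|exact: su|exact: sv].
have [d1 h1] := MODon_le (size w) (hu K cK KO); have [d2 h2] := MODon_le (size w) (hv K cK KO).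
have [d h] := absorb_pow (2 ^+ size w : R) (d1 + d2).
exists d; apply: evtW (evt_and h (evt_and h1 h2)) => e e01 [k [k1 k2]] x Kx.
have /andP[e0 _] := e01; have T0 : 0 <= e^-1 by rewrite invr_ge0 ltW.
apply: le_trans k; apply: (@leibniz_bound _ _ Omega x w _ _ (fun=> e^-1 ^+ d1) (fun=> e^-1 ^+ d2)
  (fun=> e^-1 ^+ (d1 + d2)) (size w)) => //; try exact: KO; try exact: su; try exact: sv.
- by move=> _; rewrite exprn_ge0.
- by move=> _; rewrite exprn_ge0.
- by move=> _ _ _; rewrite exprD.
- by move=> s ss; exact: k1.
- by move=> s ss; exact: k2.
Qed.

(** To reach the order [m] one uses the negligible factor at the order [m] plus the exponent
    of the moderate one. *)
Lemma Neg_mul Omega u v : open Omega -> Neg Omega u -> Mod Omega v ->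
  Neg Omega (fun e x => u e x * v e x).
Proof.
move=> oO [su hu] [sv hv]; split=> [e e01|K cK KO w m]; first by apply: smoothM; [|exact: su|exact: sv].
have [d2 h2] := MODon_le (size w) (hv K cK KO).
have h1 := evt_words_le (size w) (fun w => hu K cK KO w (m + d2).+1).
apply: evtW (evt_and (evt_big (2 ^+ size w)) (evt_and h1 h2)) => e e01 [k [k1 k2]] x Kx.
have /andP[e0 _] := e01; have T0 : 0 <= e^-1 by rewrite invr_ge0 ltW.
have E : e ^+ (m + d2).+1 * e^-1 ^+ d2 = e ^+ m * e.
  by rewrite -addSn exprD exprSr exprVn mulfK // expf_neq0 // gt_eqF.
apply: (@le_trans _ _ (2 ^+ size w * (e ^+ m * e))); last first.
  by rewrite mulrCA ler_piMr ?exprn_ge0 ?(ltW e0) // -ler_pdivlMr // div1r.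
apply: (@leibniz_bound _ _ Omega x w _ _ (fun=> e ^+ (m + d2).+1) (fun=> e^-1 ^+ d2)
  (fun=> e ^+ m * e) (size w)) => //; try exact: KO; try exact: su; try exact: sv.
- by move=> _; rewrite exprn_ge0 // ltW.
- by move=> _; rewrite exprn_ge0.
- by move=> _ _ _; rewrite E.
- by move=> s ss; exact: k1.
- by move=> s ss; exact: k2.
Qed.

Lemma MAr_mul Omega u v : open Omega -> MAr Omega u -> MAr Omega v ->
  MAr Omega (fun e x => u e x * v e x).
Proof.
move=> oO [su hu] [sv hv]; split=> [e e01|K cK KO]; first by apply: smoothM; [|exact: su|exact: sv].
have [d1 h1] := hu K cK KO; have [d2 h2] := hv K cK KO.
pose d := maxn d1 d2.
have [d' h'] := absorb0 hM 2 (2 * d).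
exists d'; apply: evtW (evt_and h' (evt_and h1 h2)) => e e01 [k [k1 k2]] w x Kx.
have /andP[e0 e1] := e01; have T1 : 1 <= e^-1 by rewrite invf_ge1.
have E j : bd M d e j = (e^-1 ^+ d) ^+ j.+1 * M j by rewrite /bd exprM.
have := @ultra_mul _ _ M hM Omega x (u e) (v e) (e^-1 ^+ d) oO (KO x Kx) (su e e01) (sv e e01)
  (exprn_ege1 d T1) _ _ w.
move=> H; apply: le_trans (H _ _) _.
- move=> s; rewrite -E; apply: le_trans (k1 s x Kx) _; apply: (bd_le hM) => //; exact: leq_maxl.
- move=> s; rewrite -E; apply: le_trans (k2 s x Kx) _; apply: (bd_le hM) => //; exact: leq_maxr.
apply: le_trans (k (size w)); rewrite /bd exprMn -!exprM !mulrA.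
by rewrite (_ : (d * (2 * (size w).+1) = 2 * d * (size w).+1)%N) ?lexx //; lia.
Qed.

Lemma Mod_add Omega u v : open Omega -> Mod Omega u -> Mod Omega v ->
  Mod Omega (fun e x => u e x + v e x).
Proof.
move=> oO [su hu] [sv hv]; split=> [e e01|K cK KO w]; first by apply: smoothD; [|exact: su|exact: sv].
have [d1 h1] := hu K cK KO w; have [d2 h2] := hv K cK KO w.
have [d h] := absorb_pow (2 : R) (maxn d1 d2).
exists d; apply: evtW (evt_and h (evt_and h1 h2)) => e e01 [k [k1 k2]] x Kx.
have /andP[e0 e1] := e01; have T1 : 1 <= e^-1 by rewrite invf_ge1.
apply: le_trans k; rewrite (wDD w oO (su e e01) (sv e e01) (KO x Kx)).
apply: le_trans (normcD _ _) _; rewrite mulr_natl mulr2n; apply: lerD.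
  by apply: le_trans (k1 x Kx) _; rewrite ler_weXn2l // leq_maxl.
by apply: le_trans (k2 x Kx) _; rewrite ler_weXn2l // leq_maxr.
Qed.

Lemma Neg_add Omega u v : open Omega -> Neg Omega u -> Neg Omega v ->
  Neg Omega (fun e x => u e x + v e x).
Proof.
move=> oO [su hu] [sv hv]; split=> [e e01|K cK KO w m]; first by apply: smoothD; [|exact: su|exact: sv].
apply: evtW (evt_and (evt_big 2) (evt_and (hu K cK KO w m.+1) (hv K cK KO w m.+1))) => e e01 [k [k1 k2]] x Kx.
have /andP[e0 e1] := e01.
rewrite (wDD w oO (su e e01) (sv e e01) (KO x Kx)).
apply: le_trans (normcD _ _) _; apply: le_trans (lerD (k1 x Kx) (k2 x Kx)) _.
rewrite -mulr2n -mulr_natl exprSr mulrCA ler_piMr ?exprn_ge0 ?(ltW e0) //.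
by rewrite -ler_pdivlMr // div1r.
Qed.

Lemma MAr_add Omega u v : open Omega -> MAr Omega u -> MAr Omega v ->
  MAr Omega (fun e x => u e x + v e x).
Proof.
move=> oO [su hu] [sv hv]; split=> [e e01|K cK KO]; first by apply: smoothD; [|exact: su|exact: sv].
have [d1 h1] := hu K cK KO; have [d2 h2] := hv K cK KO.
have [d h] := absorb1 hM 2 (maxn d1 d2).
exists d; apply: evtW (evt_and h (evt_and h1 h2)) => e e01 [k [k1 k2]] w x Kx.
apply: le_trans (k (size w)); rewrite (wDD w oO (su e e01) (sv e e01) (KO x Kx)).
apply: le_trans (normcD _ _) _; rewrite mulr_natl mulr2n; apply: lerD.
  by apply: le_trans (k1 w x Kx) _; apply: (bd_le hM) => //; exact: leq_maxl.
by apply: le_trans (k2 w x Kx) _; apply: (bd_le hM) => //; exact: leq_maxr.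
Qed.

Lemma MAr_const Omega (c : C) : MAr Omega (fun _ _ => c).
Proof.
split=> [e _|K cK KO]; first exact: smooth_cst.
have [d h] := absorb1 hM (Nc c) 0.
exists d; apply: evtW h => e e01 h w x Kx; rewrite wD_cst; apply: le_trans (h (size w)).
have /andP[e0 _] := e01.
case: w => [|i w]; first by rewrite /bd mul0n expr0 (M_0 hM) !mulr1.
by rewrite Normc.normc0 mulr_ge0 ?normc_ge0 // bd_ge0.
Qed.

Lemma Neg0 Omega : Neg Omega (fun _ _ => 0).
Proof.
split=> [e _|K cK KO w m]; first exact: smooth_cst.
apply: evt_all => e /andP[e0 _] x _; rewrite wD_cst; case: w => [|i w];
by rewrite Normc.normc0 exprn_ge0 // ltW.
Qed.

Lemma MAr_opp Omega u : open Omega -> MAr Omega u -> MAr Omega (fun e x => - u e x).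
Proof.
move=> oO h; apply: MAr_eq (MAr_mul oO (MAr_const Omega (-1)) h) => // e _ x _.
by rewrite mulN1r.
Qed.

Lemma Neg_opp Omega u : open Omega -> Neg Omega u -> Neg Omega (fun e x => - u e x).
Proof.
move=> oO h; apply: Neg_eq (Neg_mul oO h (MAr_Mod (MAr_const Omega (-1)))) => // e _ x _.
by rewrite mulrN1.
Qed.

Lemma Mod_wD Omega u w : Mod Omega u -> Mod Omega (fun e => wD w (u e)).
Proof.
move=> [su hu]; split=> [e e01|K cK KO w']; first by apply: smooth_wD; exact: su.
have [d h] := hu K cK KO (w' ++ w); exists d; apply: evtW h => e _ h x Kx.
by have := h x Kx; rewrite wD_cat.
Qed.

Lemma Neg_wD Omega u w : Neg Omega u -> Neg Omega (fun e => wD w (u e)).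
Proof.
move=> [su hu]; split=> [e e01|K cK KO w' m]; first by apply: smooth_wD; exact: su.
by apply: evtW (hu K cK KO (w' ++ w) m) => e _ h x Kx; have := h x Kx; rewrite wD_cat.
Qed.

End NetAlgebra.

(** * The Colombeau algebra in terms of representatives *)

Section Interface.
Variables (R : realType) (n : nat) (M : nat -> R).
Hypothesis hM : weight_sequence M.
Local Notation V := 'rV[R]_n.
Local Notation C := R[i].
Local Notation Nc := (@Normc.normc R).
Local Notation net := (net R n).
Implicit Types (B K Gamma W Omega : set V) (u v w theta t : net).
Local Notation nsub u v := (fun e x => u e x - v e x).
Local Notation nmul u v := (fun e x => u e x * v e x).

(** Two nets with the same class in the Colombeau algebra, except that neither has to be
    moderate. *)
Definition eqv Omega u v := Neg Omega (nsub u v).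

Lemma eqv_refl Omega u : open Omega -> eqv Omega u u.
Proof. by move=> oO; apply: Neg_eq (Neg0 _) => // e _ x _; rewrite subrr. Qed.

Lemma eqv_eqon Omega u v : open Omega -> eqon Omega u v -> eqv Omega u v.
Proof. by move=> oO uv; apply: Neg_eq (Neg0 _) => // e e01 x Ox; rewrite uv // subrr. Qed.

Lemma eqv_sym Omega u v : open Omega -> eqv Omega u v -> eqv Omega v u.
Proof. by move=> oO h; apply: Neg_eq (Neg_opp hM oO h) => // e _ x _; rewrite opprB. Qed.

Lemma eqv_trans Omega v u w : open Omega -> eqv Omega u v -> eqv Omega v w -> eqv Omega u w.
Proof. by move=> oO h k; apply: Neg_eq (Neg_add oO h k) => // e _ x _; rewrite addrA subrK. Qed.

Lemma eqvS Omega W u v : W `<=` Omega -> eqv Omega u v -> eqv W u v.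
Proof. exact: NegS. Qed.

Lemma eqv_mul Omega u v w : open Omega -> Mod Omega w -> eqv Omega u v ->
  eqv Omega (nmul w u) (nmul w v).
Proof. by move=> oO mw h; apply: Neg_eq (Neg_mul oO h mw) => // e _ x _; rewrite -mulrBr mulrC. Qed.

Lemma eqv_mulr Omega u v w : open Omega -> Mod Omega w -> eqv Omega u v ->
  eqv Omega (nmul u w) (nmul v w).
Proof. by move=> oO mw h; apply: Neg_eq (Neg_mul oO h mw) => // e _ x _; rewrite mulrBl. Qed.

Lemma eqv_add Omega u v u' v' : open Omega -> eqv Omega u v -> eqv Omega u' v' ->
  eqv Omega (fun e x => u e x + u' e x) (fun e x => v e x + v' e x).
Proof.
move=> oO h k; apply: Neg_eq (Neg_add oO h k) => // e _ x _.
by rewrite opprD addrACA.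
Qed.

Lemma eqv_wD Omega u v s : open Omega -> smooth_net Omega u -> smooth_net Omega v -> eqv Omega u v ->
  eqv Omega (fun e => wD s (u e)) (fun e => wD s (v e)).
Proof.
move=> oO su sv h; apply: Neg_eq (Neg_wD s h) => // e e01 x Ox.
by rewrite (wDB s oO (su e e01) (sv e e01) Ox).
Qed.

Lemma eqv_Mod Omega u v : open Omega -> eqv Omega u v -> Mod Omega v -> Mod Omega u.
Proof.
move=> oO h mv; apply: Mod_eq (Mod_add oO (Neg_Mod h) mv) => // e _ x _.
by rewrite subrK.
Qed.

Lemma gclassP Omega t u : open Omega -> gclass Omega t u <-> Mod Omega u /\ eqv Omega u t.
Proof.
move=> oO; rewrite /gclass /=; split=> -[/(moderateP _ oO) h /(negligible_netP _ oO) k] //.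
Qed.

Lemma gclass_eq Omega u v : open Omega -> eqv Omega u v -> gclass Omega u = gclass Omega v.
Proof.
move=> oO uv; apply/seteqP; split=> w /(gclassP _ _ oO)[mw h]; apply/(gclassP _ _ oO); split=> //.
  exact: eqv_trans h uv.
by apply: eqv_trans h _ => //; exact: eqv_sym.
Qed.

Lemma gclass_refl Omega t : open Omega -> Mod Omega t -> gclass Omega t t.
Proof. by move=> oO mt; apply/gclassP => //; split=> //; exact: eqv_refl. Qed.

Lemma bigcup_same T1 T2 (F : set T1) (G : T1 -> set T2) A p : F p -> (forall q, F q -> G q = A) ->
  \bigcup_(q in F) G q = A.
Proof.
move=> Fp H; apply/seteqP; split=> [x [q Fq]|x Ax]; first by rewrite H.
by exists p; rewrite ?H.
Qed.

Lemma gmulE Omega u v : open Omega -> Mod Omega u -> Mod Omega v ->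
  gmul Omega (gclass Omega u) (gclass Omega v) = gclass Omega (nmul u v).
Proof.
move=> oO mu mv; apply: (bigcup_same (gclass_refl oO mu)) => u' /(gclassP _ _ oO)[mu' hu].
apply: (bigcup_same (gclass_refl oO mv)) => v' /(gclassP _ _ oO)[mv' hv].
apply: gclass_eq => //; apply: (@eqv_trans _ (nmul u' v)) => //.
  exact: eqv_mul.
exact: eqv_mulr.
Qed.

Lemma gpartialE Omega a t : open Omega -> Mod Omega t ->
  gpartial Omega a (gclass Omega t) = gclass Omega (fun e => wD (aword a) (t e)).
Proof.
move=> oO mt; apply: (bigcup_same (gclass_refl oO mt)) => u /(gclassP _ _ oO)[mu hu].
apply: gclass_eq => //.
rewrite (_ : (fun eps => _) = (fun e => wD (aword a) (u e))); last by apply/funext => e; exact: partial_wD.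
by apply: eqv_wD => //; [case: mu|case: mt].
Qed.

Lemma grestrE Omega W t : open Omega -> open W -> W `<=` Omega -> Mod Omega t ->
  grestr W (gclass Omega t) = gclass W t.
Proof.
move=> oO oW WO mt; apply: (bigcup_same (gclass_refl oO mt)) => u /(gclassP _ _ oO)[mu hu].
by apply: gclass_eq => //; exact: eqvS hu.
Qed.

Lemma colombeauMAP W t : open W -> Mod W t ->
  colombeauMA W M (gclass W t) <-> exists2 w, MAr M W w & eqv W w t.
Proof.
move=> oW mt; split=> [[w /(moderateMAP hM _ oW) mw E]|[w mw h]].
  exists w => //; have := gclass_refl oW mt; rewrite -E => /(gclassP _ _ oW)[_].
  exact: eqv_sym.
by exists w; [exact/(moderateMAP hM)|exact: gclass_eq].
Qed.

Definition ext0 Omega (f : V -> C) : V -> C := fun x => if x \in Omega then f x else 0.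

Lemma fourierE Omega (f : V -> C) xi : fourier Omega f xi = ft (ext0 Omega f) xi.
Proof.
rewrite /fourier /ft /cint /integral_on /lint /vmu; congr (_ +i* _)%C;
  rewrite Rintegral_mkcond; apply: eq_Rintegral => p _; rewrite /reF /imF /ext0 /rowv /patch;
  rewrite (_ : (p \in _) = (vs_row p \in Omega)) //;
  by case: ifP => _; rewrite ?mul0r // /cis cosN sinN.
Qed.

(** Extension by zero is smooth because the supports stay in a compact subset. *)
Lemma compact_repP Omega t u : open Omega -> compact_rep Omega (gclass Omega t) u ->
  exists K, [/\ compact K, K `<=` Omega, tnet K (fun e => ext0 Omega (u e)) &
    eqv Omega (fun e => ext0 Omega (u e)) t].
Proof.
move=> oO [/(gclassP _ _ oO)[mu hu] [K [cK KO sK]]].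
have z e x : 0 < e <= 1 -> ~ K x -> ext0 Omega (u e) x = 0.
  move=> e01 nKx; rewrite /ext0; case: ifP => // /set_mem Ox.
  apply: contrapT => /eqP ux; apply: nKx; apply: (sK e e01).
  by apply: subset_closure.
exists K; split=> //.
  move=> e e01; split; last by move=> x; exact: z.
  apply: smooth_loc => x _; have [Ox|nO] := pselect (Omega x).
    exists Omega => //; apply: (smooth_eq (f := u e)) => //; last by case: mu => s _; exact: s.
    by move=> y Oy; rewrite /ext0 mem_set.
  exists (~` K); first by move=> /KO.
  apply: (smooth_eq (f := fun=> 0)); last exact: smooth_cst.
    by apply: closed_openC; exact: compactV_closed.
  by move=> y nK; rewrite z.
apply: eqv_trans hu => //; apply: eqv_eqon => // e _ x Ox.
by rewrite /ext0 mem_set.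
Qed.

Lemma tnet_rep Omega K t v : open Omega -> Mod Omega t -> compact K -> K `<=` Omega -> tnet K v ->
  eqv Omega v t -> compact_rep Omega (gclass Omega t) v.
Proof.
move=> oO mt cK KO tv h; split; first by apply/gclassP => //; split=> //; exact: eqv_Mod h mt.
exists K; split=> // e e01; have cl := compactV_closed cK.
move=> y hy; rewrite [K](closure_id K).1 //; apply: closureS hy => x /= [Ox vx].
by apply: contrapT => nK; move: vx; rewrite (tv e e01).2 // eqxx.
Qed.

Lemma ext0_tnet Omega K v e : K `<=` Omega -> tnet K v -> 0 < e <= 1 -> ext0 Omega (v e) = v e.
Proof.
move=> KO tv e01; apply/funext => x; rewrite /ext0; case: ifP => // /negP nO.
by rewrite (tv e e01).2 // => /KO /mem_set.
Qed.

Lemma norm_le_enorm (x : V) : `|x| <= enorm x.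
Proof.
apply/normrV_le => [|i]; first by rewrite sqrtr_ge0.
rewrite -sqrtr_sqr ler_wsqrtr // /dotv (bigD1 i) //= -expr2 lerDl.
by apply: sumr_ge0 => j _; rewrite -expr2 sqr_ge0.
Qed.

Lemma enorm_le (x : V) : enorm x <= n.+1%:R * `|x|.
Proof.
rewrite -[leRHS]ger0_norm ?mulr_ge0 // -sqrtr_sqr ler_wsqrtr // /dotv.
apply: (@le_trans _ _ (\sum_(i < n) `|x| ^+ 2)).
  apply: ler_sum => i _; rewrite -expr2 -real_normK ?num_real //.
  by rewrite lerXn2r ?nnegrE // coord_le_norm.
rewrite sumr_const card_ord -[leLHS]mulr_natl exprMn ler_wpM2r ?exprn_ge0 //.
by rewrite -natrX ler_nat expnS expn1; nia.
Qed.

(** The six constants are absorbed in the exponent of [1 / e], and the Euclidean norm is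
    equivalent to the maximum norm. *)
Lemma decP Gamma (F : R -> V -> C) :
  (exists a b c k eps0 : R, [/\ 0 <= a, 0 <= b, 0 < c, 0 < k & 0 < eps0 <= 1] /\
     forall e xi, 0 < e <= eps0 -> Gamma xi ->
      Nc (F e xi) <= c * e `^ (- b) * expR (- assoc_fun M (k * e `^ a * enorm xi))) <->
  dec M Gamma F.
Proof.
split=> [[a [b [c [k [eta [[a0 b0 c0 k0 eta1] H]]]]]]|[d [eta [eta1 H]]]].
  pose d := (Num.truncn (a + b)).+1.
  pose k' := Num.max 1 k^-1; pose c' := Num.max 1 c.
  have hd : a + b <= d%:R by apply/ltW/truncnS_gt.
  have [d' Hd] := absorb0 hM (k' * c') d; exists d'.
  have hh : evt (fun e => forall xi, Gamma xi ->
      Nc (F e xi) <= c * e `^ (- b) * expR (- assoc_fun M (k * e `^ a * enorm xi))).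
    by exists eta; split=> // e e0 xi; exact: H.
  apply: evtW (evt_and Hd hh) => e e01 [h1 h2] xi p Gxi.
  have /andP[e0 e1] := e01.
  have pa : 0 < k * e `^ a by rewrite mulr_gt0 // powR_gt0.
  have P0 : 0 <= k * e `^ a * enorm xi by rewrite mulr_ge0 ?sqrtr_ge0 // ltW.
  have h3 := (assoc_le hM _ P0 (normc_ge0 _)).1 (h2 xi Gxi) p.
  apply: le_trans (h1 p).
  apply: (@le_trans _ _ (((k * e `^ a)^-1) ^+ p * ((k * e `^ a * enorm xi) ^+ p * Nc (F e xi)))).
    rewrite exprMn !mulrA -exprMn mulVf ?gt_eqF // expr1n mul1r.
    by rewrite ler_wpM2r ?normc_ge0 // lerXn2r ?nnegrE ?sqrtr_ge0 // norm_le_enorm.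
  apply: (@le_trans _ _ (((k * e `^ a)^-1) ^+ p * (c * e `^ (- b) * M p))).
    by rewrite ler_wpM2l // exprn_ge0 // invr_ge0 ltW.
  rewrite /bd !mulrA ler_wpM2r ?(M_ge0 hM) //.
  have k1 : 1 <= k' by rewrite le_max lexx.
  have c1 : 1 <= c' by rewrite le_max lexx.
  have -> : (k * e `^ a)^-1 ^+ p * c * e `^ (- b) = (k^-1 ^+ p * c) * (e `^ (- a) ^+ p * e `^ (- b)).
    by rewrite invfM exprMn -powRN; ring.
  apply: ler_pM; rewrite ?mulr_ge0 ?exprn_ge0 ?invr_ge0 ?powR_ge0 ?(ltW k0) ?(ltW c0) //.
    rewrite exprMn; apply: ler_pM; rewrite ?exprn_ge0 ?invr_ge0 ?(ltW k0) ?(ltW c0) //.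
      apply: (@le_trans _ _ (k' ^+ p)); last by apply: ler_weXn2l.
      by rewrite lerXn2r ?nnegrE ?invr_ge0 ?(ltW k0) ?le_max ?lexx ?orbT ?ler01.
    apply: (@le_trans _ _ c'); first by rewrite le_max lexx orbT.
    by rewrite -[leLHS]expr1 ler_weXn2l.
  rewrite -powR_mulrn ?powR_ge0 // -powRrM -powRD; last by rewrite (gt_eqF e0) implybT.
  rewrite mulNr -opprD; apply: powR_nat_bound => //.
  rewrite natrM; apply: (@le_trans _ _ ((a + b) * p.+1%:R)); last by rewrite ler_wpM2r.
  by rewrite mulrDl; apply: lerD; [rewrite ler_wpM2l // ler_nat|rewrite ler_peMr // ler1n].
exists d%:R, d%:R, 1, n.+1%:R^-1, eta; split; first by split=> //; rewrite invr_gt0.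
move=> e xi e0 Gxi; have /andP[ep _] := e0.
have P0 : 0 <= n.+1%:R^-1 * e `^ d%:R * enorm xi.
  by rewrite !mulr_ge0 ?invr_ge0 ?powR_ge0 ?sqrtr_ge0.
apply: (assoc_le hM _ P0 (normc_ge0 _)).2 => p.
have := H e e0 xi p Gxi; rewrite /bd => h.
rewrite powRN powR_mulrn ?(ltW ep) // mul1r.
apply: (@le_trans _ _ (e ^+ (d * p) * (`|xi| ^+ p * Nc (F e xi)))).
  rewrite mulrA ler_wpM2r ?normc_ge0 // exprM -exprMn.
  rewrite lerXn2r ?nnegrE // ?mulr_ge0 ?exprn_ge0 ?invr_ge0 ?sqrtr_ge0 ?(ltW ep) //.
  rewrite mulrAC [leLHS]mulrC ler_wpM2l ?exprn_ge0 ?(ltW ep) //.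
  by rewrite mulrC ler_pdivrMr // mulrC enorm_le.
apply: (@le_trans _ _ (e ^+ (d * p) * (e^-1 ^+ (d * p.+1) * M p))).
  by rewrite ler_wpM2l // exprn_ge0 // ltW.
rewrite mulrA ler_wpM2r ?(M_ge0 hM) // mulnS addnC exprD mulrA -exprMn.
by rewrite mulfV ?gt_eqF // expr1n mul1r exprVn.
Qed.

(** The directions outside the set [SigmaMA], in terms of moment estimates for a net of test
    functions on the whole space. *)
Definition reg_dir Omega t (xi0 : V) := exists K u Gamma,
  [/\ compact K /\ K `<=` Omega, tnet K u, eqv Omega u t,
      open_cone Gamma /\ Gamma xi0 & dec M Gamma (ftn u)].

Lemma SigmaP Omega t xi0 : open Omega -> Mod Omega t ->
  SigmaMA Omega M (gclass Omega t) xi0 <-> xi0 != 0 /\ ~ reg_dir Omega t xi0.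
Proof.
move=> oO mt; split=> -[x0 H]; split=> // H'; apply: H.
  have [K [u [G [[cK KO] tu hu [oG Gx] du]]]] := H'.
  have /decP[a [b [c [k [eta [h1 h2]]]]]] := du.
  exists G, u, a, b, c, k, eta; split; [exact: oG|exact: Gx|exact: tnet_rep tu hu|exact: h1|].
  move=> e xi e0 Gxi; rewrite fourierE (ext0_tnet KO tu); first exact: h2.
  by have [_ _ _ _ /andP[_ e1]] := h1; case/andP: e0 => -> /= /le_trans ->.
have [G [u [a [b [c [k [eta [oG Gx /(compact_repP oO)[K [cK KO tu hu]] h1 h2]]]]]]]] := H'.
exists K, (fun e => ext0 Omega (u e)), G; split=> //; apply/decP.
exists a, b, c, k, eta; split=> // e xi e0 Gxi.
by have := h2 e xi e0 Gxi; rewrite fourierE.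
Qed.

Lemma EM_MAr Omega phi : open Omega -> Defs.EM Omega M phi -> MAr M Omega (fun=> phi).
Proof.
move=> oO [s H]; apply/(moderateMAP hM) => //; split=> // K cK KO.
have [c [c0 h]] := H K cK KO; exists (fun=> 0), c, 1; split=> //.
- by split=> //; exists 0, 0; split=> // m; rewrite mul0r addr0.
- by rewrite ltr01 lexx.
by move=> a e e0 x Kx; rewrite oppr0 powRr0 mulr1; exact: h.
Qed.

Lemma bump_DM (c : V) r : 0 < r -> exists phi : V -> C,
  [/\ forall Omega, open Omega -> [set y : V | `|y - c| <= 4 * r] `<=` Omega -> DM Omega M phi,
    MAr M setT (fun=> phi), forall x, `|x - c| <= r -> phi x = 1 &
    tnet [set y : V | `|y - c| <= 4 * r] (fun=> phi)].
Proof.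
move=> r0; have [phi [L [L1 s b p1 p0]]] := bumpV hM c r0.
have L0 : 0 < L by apply: lt_le_trans L1.
have em W : open W -> Defs.EM W M phi.
  move=> oW; split; first by apply: smooth_sub s.
  move=> K cK KW; exists L; split=> // a x Kx.
  by rewrite partial_wD -size_aword; exact: b.
have tn : tnet [set y : V | `|y - c| <= 4 * r] (fun=> phi).
  by move=> e e01; split=> // x /= /negP; rewrite -ltNge; exact: p0.
exists phi; split=> //; last by apply: EM_MAr => //; [exact: openT|apply: em; exact: openT].
move=> Omega oO KO; split; first exact: em.
exists [set y : V | `|y - c| <= 4 * r]; split=> //; first exact: compact_cball.
have cl := compactV_closed (@compact_cball R n c (4 * r)).
move=> y h; rewrite [X in X y](closure_id _).1 //; apply: closureS h => x /= [_ px]; rewrite leNgt; apply/negP => /p0 E.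
by move: px; rewrite E eqxx.
Qed.

Lemma WFP Omega t x0 xi0 : open Omega -> Mod Omega t ->
  WFMA Omega M (gclass Omega t) (x0, xi0) <-> [/\ Omega x0, xi0 != 0 &
   ~ exists phi, [/\ DM Omega M phi, \forall x \near x0, phi x = 1 & reg_dir Omega (nmul (fun=> phi) t) xi0]].
Proof.
move=> oO mt; rewrite /WFMA /=.
have E phi : DM Omega M phi -> xi0 != 0 ->
   ~ SigmaMA Omega M (gmul Omega (gconst Omega phi) (gclass Omega t)) xi0 <->
   reg_dir Omega (nmul (fun=> phi) t) xi0.
  move=> [em _] xi00; have mp := MAr_Mod (EM_MAr oO em).
  have mm := Mod_mul oO mp mt.
  rewrite /gconst gmulE //; split=> [H|H /(SigmaP _ oO mm)[]//].
  by apply: contrapT => ng; apply: H; apply/SigmaP.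
split=> -[Ox x00 H]; split=> // -[phi [dphi p1 h]]; apply: H; exists phi; split=> //.
  exact/E.
exact/E.
Qed.

End Interface.

(** * Microlocal regularity *)

Section Micro.
Variables (R : realType) (n : nat) (M : nat -> R).
Hypothesis hM : weight_sequence M.
Local Notation V := 'rV[R]_n.
Local Notation C := R[i].
Local Notation Nc := (@Normc.normc R).
Local Notation net := (net R n).
Implicit Types (B K Gamma W Omega : set V) (u v w theta t : net).
Local Notation nsub u v := (fun e x => u e x - v e x).
Local Notation nmul u v := (fun e x => u e x * v e x).
Local Notation nadd u v := (fun e x => u e x + v e x).

(** Rescaled to the size of [xi0], the cone contains a ball around [xi0]; half of that ball
    generates the smaller cone. *)
Lemma cone_shrink Gamma xi0 : open_cone Gamma -> Gamma xi0 -> exists Gamma1 (c : R),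
  [/\ open_cone Gamma1, Gamma1 xi0, 0 < c <= 1 / 2 &
    forall xi eta, Gamma1 xi -> `|eta| <= c * `|xi| -> Gamma (xi - eta)].
Proof.
move=> [oG hG] Gx; have /nbhs_ballP[/= d d0 Hd] := open_nbhs_nbhs (conj oG Gx).
pose h := d / 2; have h0 : 0 < h by rewrite divr_gt0.
pose N := `|xi0| + d; have N0 : 0 < N by rewrite ltr_wpDl.
pose c := Num.min (1 / 2) (h / N).
have c0 : 0 < c by rewrite lt_min !divr_gt0.
exists (\bigcup_(t in [set t : R | 0 < t]) ((fun x : V => t *: x) @^-1` ball xi0 h)), c; split.
- split.
    apply: bigcup_open => t _; apply: open_comp; last exact: ball_open.
    by move=> x _; apply: scaler_continuous.
  move=> s x s0 [t /= t0 bx]; exists (t / s); first by rewrite /= divr_gt0.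
  by rewrite /= scalerA divfK // gt_eqF.
- by exists 1; rewrite /= ?scale1r ?ltr01 //; exact: ballxx.
- by rewrite c0 ge_min lexx.
move=> x y [t /= t0]; rewrite -ball_normE /= => xt yx.
have -> : x - y = t^-1 *: (t *: (x - y)) by rewrite scalerA mulVf ?scale1r // gt_eqF.
apply: hG; first by rewrite invr_gt0.
apply: Hd; rewrite -ball_normE /=.
have -> : xi0 - t *: (x - y) = (xi0 - t *: x) + t *: y by rewrite scalerBr opprB addrA addrAC.
apply: le_lt_trans (ler_normD _ _) _.
have tx : `|t *: x| < N.
  have -> : t *: x = xi0 - (xi0 - t *: x) by rewrite subKr.
  by apply: le_lt_trans (ler_normB _ _) _; rewrite ltrD2l (lt_trans xt) // /h; lra.
have ty : `|t *: y| <= h.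
  rewrite normrZ gtr0_norm //; apply: (@le_trans _ _ (c * `|t *: x|)).
    by rewrite normrZ gtr0_norm // mulrCA ler_wpM2l // ltW.
  apply: (@le_trans _ _ (h / N * N)); last by rewrite divfK // gt_eqF.
  apply: ler_pM => //; [exact: ltW|by rewrite ge_min lexx orbT|exact: ltW].
rewrite /h in xt ty; lra.
Qed.

Lemma open_coneI G1 G2 : open_cone G1 -> open_cone G2 -> open_cone (G1 `&` G2 : set V).
Proof.
move=> [oG1 h1] [oG2 h2]; split; first exact: openI.
by move=> s x s0 [a b]; split; [exact: h1|exact: h2].
Qed.

Lemma tnet_MAr Omega K theta : compact K -> tnet K theta -> MAon M K theta -> MAr M Omega theta.
Proof.
move=> cK tt mt; split=> [e e01|K' _ _].
  by apply: (@smooth_sub _ _ setT) => //; case: (tt e e01).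
exact: MAonS (MAon_T hM cK tt mt).
Qed.

Lemma tnet_mul Omega K theta u : open Omega -> compact K -> K `<=` Omega -> tnet K theta ->
  smooth_net Omega u -> tnet K (nmul theta u).
Proof.
move=> oO cK KO tt su e e01; have [st zt] := tt e e01; split; last by move=> x nK; rewrite zt // mul0r.
apply: smooth_loc => x _; have [Ox|nO] := pselect (Omega x).
  exists Omega => //; apply: smoothM => //; last exact: su.
  exact: smooth_sub st.
exists (~` K); first by move=> /KO.
apply: (smooth_eq (f := fun=> 0)); last exact: smooth_cst.
  by apply: closed_openC; exact: compactV_closed.
by move=> y nK; rewrite zt // mul0r.
Qed.

(** Off the support of [theta] both products vanish, so nothing is asked outside [W]. *)
Lemma eqv_cut Omega W K theta u v : open Omega -> open W -> compact K -> K `<=` W -> tnet K theta ->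
  Mod W theta -> eqv W u v -> eqv Omega (nmul theta u) (nmul theta v).
Proof.
move=> oO oW cK KW tt mt h; apply: Neg_loc => x _; have [Wx|nW] := pselect (W x).
  by exists W; split=> //; exact: eqv_mul.
have oC : open (~` K) by apply: closed_openC; exact: compactV_closed.
exists (~` K); split=> //; first by move=> /KW.
apply: eqv_eqon => // e e01 y nK; by rewrite (tt e e01).2 // !mul0r.
Qed.

Definition decays_in Omega Gamma t := exists K u,
  [/\ compact K, K `<=` Omega, tnet K u, eqv Omega u t & dec M Gamma (ftn u)].

Lemma reg_dirE Omega t xi0 : reg_dir M Omega t xi0 <->
  exists Gamma, [/\ open_cone Gamma, Gamma xi0 & decays_in Omega Gamma t].
Proof.
split=> [[K [u [G [[cK KO] tu h [oG Gx] d]]]]|[G [oG Gx [K [u [cK KO tu h d]]]]]].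
  by exists G; split=> //; exists K, u.
by exists K, u, G.
Qed.

Lemma decays_in_eqv Omega Gamma t t' : open Omega -> eqv Omega t t' -> decays_in Omega Gamma t ->
  decays_in Omega Gamma t'.
Proof.
move=> oO h [K [u [cK KO tu k d]]]; exists K, u; split=> //.
exact: eqv_trans k h.
Qed.

Lemma decays_in_eqon Omega Gamma t t' : open Omega -> eqon Omega t t' -> decays_in Omega Gamma t ->
  decays_in Omega Gamma t'.
Proof. by move=> oO h; apply: decays_in_eqv => //; exact: eqv_eqon. Qed.

Lemma decays_in_sub Omega G G' t : G `<=` G' -> decays_in Omega G' t -> decays_in Omega G t.
Proof. by move=> GG [K [u [cK KO tu k d]]]; exists K, u; split=> //; exact: dec_sub d. Qed.

Lemma decays_in0 Omega G : open Omega -> decays_in Omega G (fun _ _ => 0).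
Proof.
move=> oO; exists set0, (fun _ _ => 0); split=> //.
- exact: compact0.
- by move=> e _; split=> // ; exact: smooth_cst.
- exact: eqv_refl.
exists 0%N; apply: evt_all => e /andP[e0 _] xi p _.
rewrite /ftn /ft (_ : (fun x : V => _) = fun=> 0); last by apply/funext => x; rewrite mul0r.
by rewrite cint0 Normc.normc0 mulr0 bd_ge0.
Qed.

Lemma ftD r f g (xi : V) : 0 <= r -> tf r f -> tf r g ->
  ft (fun x => f x + g x) xi = ft f xi + ft g xi.
Proof.
move=> r0 tff tfg.
have tfn : tf r (fun x => - g x).
  have [sg g0] := tfg; split; first by apply: smoothN => //; exact: openT.
  by move=> x nb; rewrite g0 // oppr0.
have -> : (fun x => f x + g x) = (fun x => f x - - g x) by apply/funext => x; rewrite opprK.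
have z : tf r (fun _ : V => 0 : C) by split=> //; exact: smooth_cst.
have -> : (fun x => f x - - g x) = (fun x => f x - (0 - g x)) by apply/funext => x; rewrite sub0r.
rewrite (ft_sub xi r0 tff); last by rewrite (_ : (fun x => _) = (fun x => - g x)) //; apply/funext => x; rewrite sub0r.
rewrite (ft_sub xi r0 z tfg) (_ : ft (fun=> 0) xi = 0) ?sub0r ?opprK //.
rewrite /ft (_ : (fun x : V => _) = fun=> 0) ?cint0 //.
by apply/funext => x; rewrite mul0r.
Qed.

Lemma tnetD K K' u v : tnet K u -> tnet K' v -> tnet (K `|` K') (nadd u v).
Proof.
move=> tu tv e e01; have [su zu] := tu e e01; have [sv zv] := tv e e01; split.
  by apply: smoothD => //; exact: openT.
by move=> x nK; rewrite zu ?zv ?addr0 // => h; apply: nK; [right|left].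
Qed.

Lemma tnet_box2 K K' u v : compact K -> compact K' -> tnet K u -> tnet K' v ->
  exists2 r : R, 0 <= r & forall e, 0 < e <= 1 -> tf r (u e) /\ tf r (v e).
Proof.
move=> cK cK' tu tv; have [r r1 Kr] := compact_in_box (compactU cK cK').
exists r; first exact: le_trans r1.
by move=> e e01; split; [apply: tnet_tf tu e01|apply: tnet_tf tv e01] => x Kx; apply: Kr; [left|right].
Qed.

Lemma decays_in_add Omega G t t' : open Omega -> decays_in Omega G t -> decays_in Omega G t' ->
  decays_in Omega G (nadd t t').
Proof.
move=> oO [K [u [cK KO tu h [d1 H1]]]] [K' [u' [cK' KO' tu' h' [d2 H2]]]].
exists (K `|` K'), (nadd u u'); split.
- exact: compactU.
- by move=> x [/KO|/KO'].
- exact: tnetD.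
- exact: eqv_add.
have [r r0 tt] := tnet_box2 cK cK' tu tu'.
have [d H] := absorb1 hM 2 (maxn d1 d2); exists d.
apply: evtW (evt_and H (evt_and H1 H2)) => e e01 [k [k1 k2]] xi p Gx.
have [t1 t2] := tt e e01; rewrite /ftn (ftD xi r0 t1 t2).
apply: le_trans (k p).
apply: (@le_trans _ _ (`|xi| ^+ p * (Nc (ftn u e xi) + Nc (ftn u' e xi)))).
  by rewrite ler_wpM2l ?exprn_ge0 ?normcD.
rewrite mulrDr mulr_natl mulr2n; apply: lerD.
  by apply: le_trans (k1 xi p Gx) _; apply: (bd_le hM) => //; exact: leq_maxl.
by apply: le_trans (k2 xi p Gx) _; apply: (bd_le hM) => //; exact: leq_maxr.
Qed.

Lemma eqv_MODon Omega K u t : open Omega -> Mod Omega t -> eqv Omega u t -> compact K -> K `<=` Omega ->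
  MODon K u.
Proof. by move=> oO mt h cK KO; have [_ k] := eqv_Mod oO h mt; exact: k. Qed.

(** Lemma [dec_mul] for representatives; the product is supported where the representative
    of [t] is. *)
Lemma decays_in_mul Omega Gamma Gamma1 (c : R) K theta t : open Omega -> Mod Omega t ->
  0 < c <= 1 / 2 -> (forall xi eta, Gamma1 xi -> `|eta| <= c * `|xi| -> Gamma (xi - eta)) ->
  compact K -> tnet K theta -> MAon M K theta ->
  decays_in Omega Gamma t -> decays_in Omega Gamma1 (nmul theta t).
Proof.
move=> oO mt c0 HG cK tth mth [K' [u [cK' KO tu h d]]].
exists K', (nmul theta u); split=> //.
- move=> e e01; split; first by have [] := tnetM tth tu e01.
  by move=> x nK; rewrite (tu e e01).2 // mulr0.
- apply: eqv_mul => //; apply: (MAr_Mod (M := M)) => //; exact: tnet_MAr cK tth mth.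
apply: (dec_mul hM cK cK' tth tu mth _ d c0 HG).
exact: eqv_MODon mt h cK' KO.
Qed.

(** Differentiation multiplies the transform by a polynomial in the frequency, that is, it
    shifts the order of the moments. *)
Lemma dec_wD K u s Gamma : compact K -> tnet K u -> dec M Gamma (ftn u) ->
  dec M Gamma (ftn (fun e => wD s (u e))).
Proof.
move=> cK tu [d H]; have [r r1 Kr] := compact_in_box cK.
have r0 : 0 <= r by apply: le_trans r1.
have [d' H'] := absorb hM 1 d (size s); exists d'.
apply: evtW (evt_and H H') => e e01 [h h'] xi p Gx.
rewrite /ftn (ft_wD _ _ r0 (tnet_tf Kr tu e01)) Normc.normcM.
apply: le_trans (h' p); rewrite expr1n mul1r.
apply: le_trans (h xi (p + size s)%N Gx).
rewrite exprD -mulrA ler_wpM2l ?exprn_ge0 // ler_wpM2r ?normc_ge0 //.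
exact: normc_prod_im.
Qed.

(** Regularity at a point of the cotangent bundle tested with all regular multipliers
    supported near [x0], not with one cut-off: in this form it is stable under
    multiplication and under further localisation. *)
Definition micro Omega t (x0 xi0 : V) := exists Gamma W,
  [/\ open_cone Gamma /\ Gamma xi0, [/\ open W, W x0 & W `<=` Omega] &
    forall K theta, compact K -> K `<=` W -> tnet K theta -> MAon M K theta ->
      decays_in Omega Gamma (nmul theta t)].

Lemma bump_in W x0 : open W -> W x0 -> exists (phi : V -> C) (r : R),
  [/\ 0 < r, [set y : V | `|y - x0| <= 4 * r] `<=` W, forall Omega, open Omega -> W `<=` Omega -> DM Omega M phi,
    forall x, `|x - x0| <= r -> phi x = 1 &
    tnet [set y : V | `|y - x0| <= 4 * r] (fun=> phi) /\ MAr M setT (fun=> phi)].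
Proof.
move=> oW Wx; have [e e0 He] := nbhs_cball_sub (open_nbhs_nbhs (conj oW Wx)).
pose r := e / 4; have r0 : 0 < r by rewrite divr_gt0.
have KW : [set y : V | `|y - x0| <= 4 * r] `<=` W.
  by move=> y /= yx; apply: He => /=; apply: le_trans yx _; rewrite /r mulrC divfK.
have [phi [dphi m p1 tn]] := bump_DM hM x0 r0.
exists phi, r; split=> // Om oO WO; apply: dphi => // y /KW; exact: WO.
Qed.

(** If one cut-off [phi] works, then so does every regular [theta] supported where [phi] is 1,
    because [theta = theta phi] and multiplication by [theta] only shrinks the cone. *)
Lemma WF_micro Omega t x0 xi0 : open Omega -> Mod Omega t ->
  WFMA Omega M (gclass Omega t) (x0, xi0) <-> [/\ Omega x0, xi0 != 0 & ~ micro Omega t x0 xi0].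
Proof.
move=> oO mt; split=> [/(WFP hM _ _ oO mt)[Ox x00 H]|[Ox x00 H]]; last first.
  apply/(WFP hM) => //; split=> // -[phi [dphi p1 /reg_dirE[G [oG Gx g]]]]; apply: H.
  have [G1 [c [oG1 G1x c0 HG]]] := cone_shrink oG Gx.
  exists G1, (Omega `&` [set x | phi x = 1]^°); split=> //.
    split; [by apply: openI => //; exact: open_interior|by split|by move=> x []].
  move=> K theta cK KW tt mth.
  apply: (decays_in_eqon (t := nmul theta (nmul (fun=> phi) t))) => //.
    move=> e e01 x Ox'; have [Kx|nK] := pselect (K x).
      by have [_ /interior_subset /= ->] := KW x Kx; rewrite mul1r.
    by rewrite (tt e e01).2 // !mul0r.
  apply: (decays_in_mul (Gamma := G) (c := c) (K := K)) => //.
  apply: Mod_mul => //; apply: (MAr_Mod (M := M)) => //; apply: EM_MAr => //; by case: dphi.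
split=> // -[G [W [[oG Gx] [oW Wx WO] h]]]; apply: H.
have [phi [r [r0 KW dphi p1 [tn mphi]]]] := bump_in oW Wx.
exists phi; split; first exact: dphi.
  apply: filterS (nbhs_cball x0 r0) => y; exact: p1.
apply/reg_dirE; exists G; split=> //; apply: (h _ _ _ KW) => //; first exact: compact_cball.
by have [_] := mphi; apply=> //; exact: compact_cball.
Qed.

(** A multiplier times a regular net is again a multiplier. *)
Lemma micro_mul Omega g t x0 xi0 : open Omega -> MAr M Omega g ->
  micro Omega t x0 xi0 -> micro Omega (nmul g t) x0 xi0.
Proof.
move=> oO mg [G [W [hG [oW Wx WO] H]]]; exists G, W; split=> // K theta cK KW tt mt.
have KO : K `<=` Omega by move=> x /KW /WO.
apply: (decays_in_eqon (t := nmul (nmul theta g) t)) => //; first by move=> e _ x _; rewrite mulrA.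
apply: (H K) => //; first by apply: (tnet_mul oO) => //; case: mg.
have [_] := MAr_mul hM oO (tnet_MAr Omega cK tt mt) mg; exact.
Qed.

(** The cut-off [chi] has to be inserted before differentiating: the derivative of a
    decaying representative of [chi t] decays, and it represents the derivative of [t]
    where [chi] is 1. *)
Lemma micro_wD Omega s t x0 xi0 : open Omega -> Mod Omega t ->
  micro Omega t x0 xi0 -> micro Omega (fun e => wD s (t e)) x0 xi0.
Proof.
move=> oO mt [G [W [[oG Gx] [oW Wx WO] H]]].
have [chi [r [r0 KW _ p1 [tn mchi]]]] := bump_in oW Wx.
have cB := @compact_cball R n x0 (4 * r).
have mchi' : MAon M [set y : V | `|y - x0| <= 4 * r] (fun=> chi) by have [_] := mchi; apply.
have [K [v [cK KO tv h d]]] := H _ _ cB KW tn mchi'.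
have [G1 [c [oG1 G1x c0 HG]]] := cone_shrink oG Gx.
have BW : ball x0 r `<=` W.
  move=> y; rewrite -ball_normE /= distrC => /ltW yr; apply: KW => /=.
  by apply: le_trans yr _; rewrite ler_peMl ?ler1n // ltW.
exists G1, (ball x0 r); split=> //.
  by split; [exact: ball_open|exact: ballxx|move=> x /BW /WO].
move=> K' theta cK' KB tt mth.
have mct : Mod Omega (nmul (fun=> chi) t).
  apply: Mod_mul => //; apply: (MAr_Mod (M := M)); exact: (MArS (Omega := setT)) mchi.
have mv := eqv_Mod oO h mct.
apply: (decays_in_eqon (t := nmul theta (fun e => wD s ((nmul (fun=> chi) t) e)))) => //.
  move=> e e01 x Ox; have [Kx|nK] := pselect (K' x).
    congr (_ * _); apply: (@wD_eq _ _ (ball x0 r)) => //; [exact: ball_open| |exact: KB].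
    move=> y; rewrite -ball_normE /= distrC => /ltW yr.
    by rewrite p1 // mul1r.
  by rewrite (tt e e01).2 // !mul0r.
apply: (decays_in_mul (Gamma := G) (c := c) (K := K')) => //; first exact: Mod_wD.
exists K, (fun e => wD s (v e)); split=> //.
- move=> e e01; have [sv zv] := tv e e01; split; first exact: smooth_wD.
  by move=> x nK; exact: (wD_out s (compactV_closed cK) zv nK).
- by apply: eqv_wD => //; [case: mv|case: mct].
exact: dec_wD cK tv d.
Qed.

Lemma micro_reg_dir Omega t x0 xi0 : open Omega -> Mod Omega t -> Omega x0 -> reg_dir M Omega t xi0 ->
  micro Omega t x0 xi0.
Proof.
move=> oO mt Ox /reg_dirE[G [oG Gx g]]; have [G1 [c [oG1 G1x c0 HG]]] := cone_shrink oG Gx.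
exists G1, Omega; split=> //; first by split.
move=> K theta cK KO tt mth.
exact: (decays_in_mul (Gamma := G) (c := c) (K := K)).
Qed.

(** Two cut-offs [s1], [s2] patch to [s1 + s2 (1 - s1)], which is 1 where either of them is 1;
    the extra factor [1 - s1] is harmless since all regular multipliers are allowed. *)
Lemma reg_dir_micro Omega t xi0 K u : open Omega -> Mod Omega t -> compact K -> K `<=` Omega -> tnet K u ->
  eqv Omega u t -> (forall x, K x -> micro Omega t x xi0) -> reg_dir M Omega t xi0.
Proof.
move=> oO mt cK KO tu h H.
pose Q B := exists sigma Ks Gamma, [/\ compact Ks, K `&` B `<=` [set x | forall e, 0 < e <= 1 -> sigma e x = 1],
   tnet Ks sigma /\ MAon M Ks sigma, open_cone Gamma /\ Gamma xi0 &
   forall theta, MAr M setT theta -> decays_in Omega Gamma (nmul theta (nmul sigma t))].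
have : Q K.
  apply: (compact_ind (Q := Q) cK).
  - exists (fun _ _ => 0), set0, setT; split=> //.
    + exact: compact0.
    + by move=> x [].
    + by split; [move=> e _; split=> //; exact: smooth_cst|exists 0%N; exact: evt_all].
    + by split=> //; split=> //; exact: openT.
    move=> theta _; apply: decays_in_eqon (decays_in0 _ oO) => // e _ x _.
    by rewrite mul0r mulr0.
  - move=> A B [s1 [K1 [G1 [c1 h1 [t1 m1] [hG1 x1] g1]]]] [s2 [K2 [G2 [c2 h2 [t2 m2] [hG2 x2] g2]]]].
    have M1 := tnet_MAr setT c1 t1 m1; have M2 := tnet_MAr setT c2 t2 m2.
    pose w := nmul s2 (fun e x => 1 - s1 e x).
    have M3 : MAr M setT (fun e x => 1 - s1 e x).
      by apply: (MAr_add hM openT); [exact: MAr_const|apply: (MAr_opp hM openT)].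
    have M4 := MAr_mul hM openT M2 M3.
    exists (nadd s1 w), (K1 `|` K2), (G1 `&` G2); split.
    + exact: compactU.
    + move=> x [Kx [Ax|Bx]] e e01; rewrite /w.
        by rewrite (h1 x (conj Kx Ax)) // subrr mulr0 addr0.
      by rewrite (h2 x (conj Kx Bx)) // mul1r addrC subrK.
    + split.
        apply: tnetD => //; apply: (tnet_mul openT) => //; by case: M3.
      have [_ k] := MAr_add hM openT M1 M4; apply: k => //; exact: compactU.
    + by split; [exact: open_coneI|].
    move=> theta mth.
    apply: (decays_in_eqon (t := nadd (nmul theta (nmul s1 t)) (nmul (nmul theta (fun e x => 1 - s1 e x)) (nmul s2 t)))) => //.
      by move=> e _ x _; rewrite /w; ring.
    apply: decays_in_add => //.
      by apply: decays_in_sub (g1 theta mth) => x [].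
    apply: decays_in_sub (g2 _ (MAr_mul hM openT mth M3)); by move=> x [].
  - move=> A B AB [s [Ks [G [cs hs ts hG g]]]]; exists s, Ks, G; split=> // x [Kx Ax].
    by apply: hs; split=> //; exact: AB.
  move=> x Kx; have [G [W [hG [oW Wx WO] k]]] := H x Kx.
  have [chi [r [r0 KW _ p1 [tn mchi]]]] := bump_in oW Wx.
  have cB := @compact_cball R n x (4 * r).
  exists [set y : V | `|y - x| <= r]; first exact: nbhs_cball.
  exists (fun=> chi), [set y : V | `|y - x| <= 4 * r], G; split=> //.
  + by move=> y [_ yx] e _; exact: p1.
  + by split=> //; have [_] := mchi; apply.
  move=> theta mth.
  have mp := MAr_mul hM openT (tnet_MAr setT cB tn (mchi.2 _ cB (fun _ _ => I))) mth.
  apply: (decays_in_eqon (t := nmul (nmul (fun=> chi) theta) t)) => //; first by move=> e _ y _; ring.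
  apply: (k _ _ cB KW); first by apply: (tnet_mul openT) => //; case: mth.
  by have [_] := mp; apply.
move=> [s [Ks [G [cs hs [ts ms] [oG Gx] g]]]].
apply/reg_dirE; exists G; split=> //; apply: decays_in_eqv (g _ (MAr_const hM setT 1)) => //.
have ms' : Mod Omega s by apply: (MAr_Mod (M := M)); exact: tnet_MAr cs ts ms.
apply: (eqv_trans (v := u)) => //.
apply: (eqv_trans (v := nmul s u)) => //.
  apply: (eqv_trans (v := nmul s t)) => //.
    by apply: eqv_eqon => // e _ x _; rewrite mul1r.
  by apply: eqv_mul => //; exact: (eqv_sym hM).
apply: eqv_eqon => // e e01 x _; have [Kx|nK] := pselect (K x).
  by rewrite hs // mul1r.
by rewrite (tu e e01).2 // mulr0.
Qed.

(** The cut-off of a regular representative is regular with compact support. *)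
Lemma micro_regular Omega W t w x0 xi0 : open Omega -> Mod Omega t -> open W -> W `<=` Omega -> W x0 ->
  MAr M W w -> eqv W w t -> micro Omega t x0 xi0.
Proof.
move=> oO mt oW WO Wx mw h; exists setT, W; split=> //.
  by split=> //; split=> //; exact: openT.
move=> K theta cK KW tt mth; exists K, (nmul theta w).
have tn : tnet K (nmul theta w) by apply: (tnet_mul oW) => //; case: mw.
split=> //; first by move=> x /KW /WO.
  apply: (eqv_cut oO oW cK KW tt _ h).
  by apply: (MAr_Mod (M := M)); exact: tnet_MAr cK tt mth.
apply: (dec_of_MA hM cK tn).
by have [_] := MAr_mul hM oW (tnet_MAr W cK tt mth) mw; apply.
Qed.

End Micro.

(** * Regular representatives from decay in all directions *)

Section Synthesis.
Variables (R : realType) (n : nat) (M : nat -> R).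
Hypothesis hM : weight_sequence M.
Local Notation V := 'rV[R]_n.
Local Notation C := R[i].
Local Notation Nc := (@Normc.normc R).
Local Notation net := (net R n).
Implicit Types (B K Gamma W Omega : set V) (u v theta t : net) (F G : R -> V -> C).
Local Notation nsub u v := (fun e x => u e x - v e x).
Local Notation nmul u v := (fun e x => u e x * v e x).
Local Notation nadd u v := (fun e x => u e x + v e x).

Definition rays B : set V := [set xi | exists2 s : R, 0 < s & B (s *: xi)].

Definition closeto F G := forall p m, evt (fun e =>
  forall xi, `|xi| ^+ p * Nc (F e xi - G e xi) <= e ^+ m).

Lemma tnetB K K' u v : tnet K u -> tnet K' v -> tnet (K `|` K') (nsub u v).
Proof.
move=> tu tv e e01; have [su zu] := tu e e01; have [sv zv] := tv e e01; split.
  by apply: smoothB => //; exact: openT.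
by move=> x nK; rewrite zu ?zv ?subr0 // => h; apply: nK; [right|left].
Qed.

Lemma closeto_ft Omega K K' u v : compact K -> compact K' -> K `<=` Omega -> K' `<=` Omega ->
  tnet K u -> tnet K' v -> eqv Omega u v -> closeto (ftn u) (ftn v).
Proof.
move=> cK cK' KO KO' tu tv [_ h] p m.
have cU : compact (K `|` K') by exact: compactU.
have NE : NEGon (K `|` K') (nsub u v) by apply: h => // x [/KO|/KO'].
have [r r0 tt] := tnet_box2 cK cK' tu tv.
apply: evtW (ft_NEG p m cU (tnetB tu tv) NE) => e e01 k xi.
have [t1 t2] := tt e e01.
by have := k xi; rewrite /ftn (ft_sub xi r0 t1 t2).
Qed.

Lemma sphere_compact : compact [set xi : V | `|xi| = 1].
Proof.
have -> : [set xi : V | `|xi| = 1] = [set xi : V | `|xi - 0| <= 1] `&` ~` ball (0 : V) 1.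
  apply/seteqP; split=> x; rewrite -ball_normE /= sub0r subr0 normrN.
    by move=> ->; rewrite lexx ltxx.
  by move=> [x1 /negP]; rewrite -leNgt => x2; apply/eqP; rewrite eq_le x1 x2.
apply: compact_closedI; first exact: compact_cball.
by apply: open_closedC; exact: ball_open.
Qed.

(** By compactness of the sphere, one neighbourhood serves all directions. The decaying function
    [G] is pieced together from transforms of representatives that depend on the direction,
    so it is itself not a Fourier transform, but it is close to one. *)
Lemma micro_all Omega t x0 : open Omega -> Mod Omega t -> Omega x0 ->
  (forall xi, xi != 0 -> micro M Omega t x0 xi) ->
  exists W, [/\ open W, W x0, W `<=` Omega &
    forall K theta, compact K -> K `<=` W -> tnet K theta -> MAon M K theta ->
      exists G, dec M [set xi | xi != 0] G /\ closeto G (ftn (nmul theta t))].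
Proof.
move=> oO mt Ox H.
pose Q B := exists W, [/\ open W, W x0 & W `<=` Omega] /\
    forall K theta, compact K -> K `<=` W -> tnet K theta -> MAon M K theta ->
      exists G, dec M (rays B) G /\ closeto G (ftn (nmul theta t)).
suff [W [[oW Wx WO] h]] : Q [set xi : V | `|xi| = 1].
  exists W; split=> // K theta cK KW tt mth; have [G [dG cG]] := h K theta cK KW tt mth.
  exists G; split=> //; apply: dec_sub dG => xi /= x0'.
  exists (`|xi|^-1); first by rewrite invr_gt0 normr_gt0.
  by rewrite /= normrZ normfV normr_id mulVf // normr_eq0.
apply: (compact_ind (Q := Q) sphere_compact).
- exists Omega; split; first by split.
  move=> K theta cK KW tt mth; exists (ftn (nmul theta t)); split.
    by exists 0%N; apply: evt_all => e _ xi p [].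
  move=> p m; apply: evt_all => e /andP[e0 _] xi.
  by rewrite subrr Normc.normc0 mulr0 exprn_ge0 // ltW.
- move=> A B [W1 [[oW1 Wx1 WO1] h1]] [W2 [[oW2 Wx2 WO2] h2]].
  exists (W1 `&` W2); split; first by split=> //; [exact: openI|move=> x [/WO1]].
  move=> K theta cK KW tt mth.
  have [G1 [[d1 D1] c1]] := h1 K theta cK (fun x Kx => (KW x Kx).1) tt mth.
  have [G2 [[d2 D2] c2]] := h2 K theta cK (fun x Kx => (KW x Kx).2) tt mth.
  exists (fun e xi => if `[< rays A xi >] then G1 e xi else G2 e xi); split.
    exists (maxn d1 d2); apply: evtW (evt_and D1 D2) => e e01 [k1 k2] xi p xiAB.
    case: asboolP => [xA|nA].
      by apply: le_trans (k1 xi p xA) _; apply: (bd_le hM) => //; exact: leq_maxl.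
    apply: le_trans (k2 xi p _) _; last by apply: (bd_le hM) => //; exact: leq_maxr.
    by have [s s0 [As|Bs]] := xiAB; [case: nA; exists s|exists s].
  move=> p m; apply: evtW (evt_and (c1 p m) (c2 p m)) => e _ [k1 k2] xi.
  by case: ifP.
- move=> A B AB [W [hW h]]; exists W; split=> // K theta cK KW tt mth.
  have [G [dG cG]] := h K theta cK KW tt mth; exists G; split=> //.
  by apply: dec_sub dG => xi [s s0 As]; exists s => //; exact: AB.
move=> x /= x1; have x00 : x != 0 by rewrite -normr_gt0 x1 ltr01.
have [Gam [W [[[oG hG] Gx] [oW Wx WO] h]]] := H x x00.
exists Gam; first exact: open_nbhs_nbhs.
exists W; split=> // K theta cK KW tt mth.
have KO : K `<=` Omega by move=> y /KW /WO.
have [K' [u [cK' KO' tu eu du]]] := h K theta cK KW tt mth.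
exists (ftn u); split.
  apply: dec_sub du => xi [s s0 Gs].
  have -> : xi = s^-1 *: (s *: xi) by rewrite scalerA mulVf ?scale1r // gt_eqF.
  by apply: hG => //; rewrite invr_gt0.
apply: (closeto_ft cK' cK KO' KO tu _ eu).
by apply: (tnet_mul oO cK KO tt); case: mt.
Qed.

Lemma trig_bound w N (F : V -> C) Z x : 0 < w <= 1 ->
  (forall l, (1 + `|l| ^+ (2 * n)) * Nc (F l) <= Z) ->
  Nc (trig w N F x) <= (pi / w *+ 2) ^- n * ((4 / w ^+ 2) ^+ n * 8 ^+ n) * Z.
Proof.
move=> w01 HF; apply: le_trans (normc_sum _ _ _) _.
apply: le_trans (trig_sum_bound N w01 (fun l => normc_ge0 (F l)) HF).
have /andP[w0 _] := w01.
apply: ler_sum => k _; rewrite !Normc.normcM normc_real ger0_norm ?Wt_ge0 //.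
by rewrite normc_cis mulr1.
Qed.

Lemma trigB w N (F G : V -> C) x :
  trig w N F x - trig w N G x = trig w N (fun l => F l - G l) x.
Proof. by rewrite /trig -sumrB; apply: eq_bigr => k _; rewrite mulrBr mulrBl. Qed.

Lemma bound_split (q : nat) (P : C) (l : V) (z : C) : Nc P <= `|l| ^+ q ->
  (1 + `|l| ^+ (2 * n)) * Nc (P * z) <= `|l| ^+ q * Nc z + `|l| ^+ (q + 2 * n) * Nc z.
Proof.
move=> hP; rewrite Normc.normcM exprD mulrDl mul1r mulrCA !mulrA; apply: lerD.
  by rewrite ler_wpM2r ?normc_ge0.
by rewrite ler_wpM2r ?normc_ge0 // ler_wpM2r // exprn_ge0.
Qed.

(** The net [w] is the trigonometric sum of [G] over a frequency lattice. It is regular because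
    the lattice sums of a decaying function are bounded uniformly in the number [N e] of
    frequencies, and it is close to [u] because [G] is close to the transform of [u] and
    because [N e] is chosen so large that the sums approximate the derivatives of [u]. *)
Lemma synthesis K K' u G : compact K -> compact K' -> tnet K u -> MODon K u ->
  dec M [set xi | xi != 0] G -> closeto G (ftn u) ->
  exists w, MAr M setT w /\ NEGon K' (nsub w u).
Proof.
move=> cK cK' tu mu [d0 D0] cG.
have [r r1 Kr] := compact_in_box (compactU cK cK').
have r0 : 0 < r by apply: lt_le_trans r1.
have K1r : K `<=` boxc r by move=> x Kx; apply: Kr; left.
have K2r : K' `<=` boxc r by move=> x Kx; apply: Kr; right.
pose w := r^-1.
have w01 : 0 < w <= 1 by rewrite invr_gt0 r0 invf_le1.
have wr : w * r <= 1 by rewrite mulVf // gt_eqF.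
have w0 : 0 < w by case/andP: w01.
have rr := ltW r0.
(* Nothing is known about [G] at the frequency zero; there the moderate bound on the transform
   of [u] suffices, since all moments of positive order vanish. *)
pose G' e (xi : V) := if xi == 0 then ftn u e xi else G e xi.
have [d DG] : dec M setT G'.
  have [d1 D1] := ft_MOD cK tu mu; exists (maxn d0 d1).
  apply: evtW (evt_and D0 D1) => e e01 [k0 k1] xi p _.
  have /andP[e0 e1] := e01; rewrite /G'; case: eqVneq => [->|x0].
    case: p => [|p]; last by rewrite normr0 expr0n mul0r bd_ge0.
    rewrite expr0 mul1r; apply: le_trans (k1 0) _.
    by rewrite /bd (M_0 hM) muln1 mulr1 ler_weXn2l ?invf_ge1 // leq_maxr.
  by apply: le_trans (k0 xi p x0) _; apply: (bd_le hM) => //; exact: leq_maxl.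
have cG' : closeto G' (ftn u).
  move=> p m; apply: evtW (cG p m) => e /andP[e0 _] k xi; rewrite /G'; case: ifP => // _.
  by rewrite subrr Normc.normc0 mulr0 exprn_ge0 // ltW.
(* Derivatives up to the order [m e], which tends to infinity, are approximated up to an
   error [e ^+ m e], which is smaller than any power of [e]. *)
pose m e := Num.truncn (e^-1 : R).
have HN : forall e : R, exists N, 0 < e <= 1 -> forall s, (size s <= m e)%N -> forall x, boxc r x ->
    Nc (wD s (u e) x - trig w N (ft (wD s (u e))) x) <= e ^+ m e.
  move=> e; have [e01|] := boolP (0 < e <= 1); last by exists 0%N.
  have e0 : 0 < e by case/andP: e01.
  have ex s : exists N0, forall N, (N0 <= N)%N -> forall x, boxc r x ->
      Nc (wD s (u e) x - trig w N (ft (wD s (u e))) x) <= e ^+ m e.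
    have tfs := tf_wD s rr (tnet_tf K1r tu e01).
    have [ss zs] := tfs.
    apply: (trig_approx w0 rr wr (tf_cnice rr tfs) _ _ zs (exprn_gt0 _ e0)).
      by move=> x; apply: (smooth_contRe ss).
    by move=> x; apply: (smooth_contIm ss).
  have [f Hf] := choice ex.
  exists (\max_(s <- words n (m e)) f s)%N => _ s sm x bx; apply: Hf => //.
  by rewrite (big_rem s) /= ?words_mem // leq_maxl.
have [N {}HN] := choice HN.
pose wn : net := fun e => trig w (N e) (G' e).
set Cst := (pi / w *+ 2) ^- n * ((4 / w ^+ 2) ^+ n * 8 ^+ n) : R.
have Cst0 : 0 <= Cst.
  rewrite /Cst !mulr_ge0 ?exprn_ge0 ?invr_ge0 ?exprn_ge0 ?divr_ge0 ?exprn_ge0 ?(ltW w0) //.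
  by rewrite mulrn_wge0 // divr_ge0 ?pi_ge0 // ltW.
exists wn; split.
  split=> [e _|K'' _ _]; first exact: smooth_trig.
  have [dB HB] := absorb hM 1 d (2 * n).
  have [d' H'] := absorb1 hM (Cst * 2) (maxn d dB).
  exists d'; apply: evtW (evt_and DG (evt_and HB H')) => e e01 [hd [hB h']] s x _.
  rewrite /wn wD_trig; apply: le_trans (h' (size s)); rewrite -mulrA.
  apply: trig_bound => // l.
  apply: le_trans (bound_split _ (normc_prod_im s l)) _.
  rewrite mulr_natl mulr2n; apply: lerD.
    apply: le_trans (hd l (size s) I) _; apply: (bd_le hM) => //; exact: leq_maxl.
  apply: le_trans (hd l (size s + 2 * n)%N I) _.
  apply: le_trans (_ : _ <= bd M dB e (size s)) _; last by apply: (bd_le hM) => //; exact: leq_maxr.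
  by have := hB (size s); rewrite expr1n mul1r.
move=> s k.
have C1 := cG' (size s) k.+2; have C2 := cG' (size s + 2 * n)%N k.+2.
have E1 := evt_and (evt_big (Cst * 2)) (evt_big 2).
have E2 := evt_and (evt_big ((size s)%:R : R)) (evt_big (k.+1%:R : R)).
apply: evtW (evt_and (evt_and C1 C2) (evt_and E1 E2)) => e e01 [[c1 c2] [[e1 e2] [e3 e4]]] x Kx.
have /andP[e0 el] := e01; have T0 : 0 <= e^-1 by rewrite invr_ge0 ltW.
have [su _] := tu e e01.
rewrite (wDB s openT (smooth_trig w (N e) (G' e)) su I) wD_trig.
have Eft : ft (wD s (u e)) = fun l => (\prod_(i <- s) (0 +i* l 0 i)%C) * ftn u e l.
  by apply/funext => l; rewrite (ft_wD s l rr (tnet_tf K1r tu e01)).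
have h1 : Nc (wD s (u e) x - trig w (N e) (ft (wD s (u e))) x) <= e ^+ k.+1.
  apply: le_trans (HN e e01 s _ x (K2r x Kx)) _.
    by rewrite truncn_ge_nat.
  by rewrite ler_wiXn2l ?(ltW e0) // truncn_ge_nat.
have h2 : Nc (trig w (N e) (fun l => (\prod_(i <- s) (0 +i* l 0 i)%C) * G' e l) x -
    trig w (N e) (ft (wD s (u e))) x) <= e ^+ k.+1.
  rewrite Eft trigB.
  apply: (@le_trans _ _ (Cst * (e ^+ k.+2 + e ^+ k.+2))).
    apply: trig_bound => // l; rewrite -mulrBr.
    apply: le_trans (bound_split _ (normc_prod_im s l)) _.
    by apply: lerD; [exact: c1|exact: c2].
  rewrite -mulr2n -mulr_natl mulrA exprS mulrA.
  by rewrite ler_piMl ?exprn_ge0 ?(ltW e0) // -ler_pdivlMr // div1r.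
(* Compare both sides with the trigonometric sum of the transform of [u]. *)
have tri (a b c : C) : a - b = (a - c) - (b - c) by rewrite opprB addrA subrK.
rewrite (tri _ _ (trig w (N e) (ft (wD s (u e))) x)).
apply: le_trans (normcB _ _) _; apply: le_trans (lerD h2 h1) _.
rewrite -mulr2n -mulr_natl exprS mulrA ler_piMl ?exprn_ge0 ?(ltW e0) //.
by rewrite -ler_pdivlMr // div1r.
Qed.

(** The net synthesised from the directions around [x0] is regular and represents [t] where
    the cut-off is 1. *)
Lemma regular_near Omega t x0 : open Omega -> Mod Omega t -> Omega x0 ->
  (forall xi, xi != 0 -> micro M Omega t x0 xi) ->
  exists W, [/\ open W, W x0, W `<=` Omega & exists2 w, MAr M W w & eqv W w t].
Proof.
move=> oO mt Ox H; have [W [oW Wx WO h]] := micro_all oO mt Ox H.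
have [chi [r [r0 KW _ p1 [tn mchi]]]] := bump_in hM oW Wx.
have cB := @compact_cball R n x0 (4 * r).
have KO : [set y : V | `|y - x0| <= 4 * r] `<=` Omega by move=> y /KW /WO.
have [G [dG cG]] := h _ _ cB KW tn (mchi.2 _ cB (fun _ _ => I)).
have mct : Mod Omega (nmul (fun=> chi) t).
  apply: Mod_mul => //; apply: (MAr_Mod (M := M)); exact: (MArS (Omega := setT)) mchi.
have tu : tnet [set y : V | `|y - x0| <= 4 * r] (nmul (fun=> chi) t).
  by apply: (tnet_mul oO cB KO tn); case: mt.
have [w [mw nw]] := synthesis cB (@compact_cball R n x0 r) tu (mct.2 _ cB KO) dG cG.
have BC : ball x0 r `<=` [set y : V | `|y - x0| <= r].
  by move=> y; rewrite -ball_normE /= distrC => /ltW.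
have BO : ball x0 r `<=` Omega.
  move=> y /BC /= yr; apply: KO => /=; apply: le_trans yr _.
  by rewrite ler_peMl ?ler1n // ltW.
exists (ball x0 r); split=> //; [exact: ball_open|exact: ballxx|].
exists w; first exact: (MArS (Omega := setT)) mw.
have oB : open (ball x0 r) by exact: ball_open.
apply: (eqv_trans (v := nmul (fun=> chi) t)) => //.
  split=> [e e01|K cK KB].
    apply: smoothB => //; first by apply: (@smooth_sub _ _ setT) => //; case: mw => sw _; exact: sw.
    by apply: (@smooth_sub _ _ setT) => //; case: (tu e e01).
  by apply: NEGonS nw => y /KB /BC.
by apply: eqv_eqon => // e _ y /BC /p1 ->; rewrite mul1r.
Qed.

End Synthesis.

(** * The largest regular open set *)

Section Gluing.
Variables (R : realType) (n : nat) (M : nat -> R).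
Hypothesis hM : weight_sequence M.
Local Notation V := 'rV[R]_n.
Local Notation C := R[i].
Local Notation net := (net R n).
Implicit Types (B K Gamma W Omega : set V) (u v theta t : net).
Local Notation nsub u v := (fun e x => u e x - v e x).
Local Notation nmul u v := (fun e x => u e x * v e x).
Local Notation nadd u v := (fun e x => u e x + v e x).

Definition regular Omega t W :=
  [/\ open W, W `<=` Omega & exists2 w, MAr M W w & eqv W w t].

Lemma regular_openP Omega t W : open Omega -> Mod Omega t ->
  regular_open Omega M (gclass Omega t) W <-> regular Omega t W.
Proof.
move=> oO mt; split=> -[oW WO].
  by rewrite (grestrE hM) // => /(colombeauMAP hM oW (ModS WO mt)); split.
by move=> h; split=> //; rewrite (grestrE hM) //; exact/(colombeauMAP hM oW (ModS WO mt)).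
Qed.

(** The local representatives are glued along the countable basis of rational balls: the sums
    [S] of their pieces become stationary near each point, since the products [P] of the
    complementary cut-offs vanish there from some index on. *)
Lemma regular_bigcup Omega t : open Omega -> Mod Omega t ->
  regular Omega t (\bigcup_(W in regular Omega t) W).
Proof.
move=> oO mt; set U := \bigcup_(W in _) W.
have oU : open U by apply: bigcup_open => W [].
have UO : U `<=` Omega by move=> x [W [_ WO _] Wx]; exact: WO.
split=> //.
(* The balls on whose concentric enlargement a regular representative exists. *)
pose inreg k := 0 < (qball R n k).2 /\ exists2 W, regular Omega t W &
  [set y : V | `|y - (qball R n k).1| <= 4 * (qball R n k).2] `<=` W.
have pieces k : exists pz : (V -> C) * net, [/\ MAr M setT (fun=> pz.1), MAr M setT pz.2,
    eqv Omega pz.2 (nmul (fun=> pz.1) t) &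
    inreg k -> forall x, `|x - (qball R n k).1| <= (qball R n k).2 -> pz.1 x = 1].
  have [[r0 [W [oW WO [w mw ew]] BW]]|ni] := pselect (inreg k); last first.
    exists (fun=> 0, fun _ _ => 0); split=> //=; [exact: MAr_const|exact: MAr_const|].
    by apply: eqv_eqon => // e _ x _; rewrite mul0r.
  have [phi [_ mp p1 tn]] := bump_DM hM (qball R n k).1 r0.
  have cB := @compact_cball R n (qball R n k).1 (4 * (qball R n k).2).
  have mpB := mp.2 _ cB (fun _ _ => I).
  exists (phi, nmul (fun=> phi) w); split=> //=.
    apply: (tnet_MAr hM setT cB); first by apply: (tnet_mul oW cB BW tn); case: mw.
    by have [_] := MAr_mul hM oW (tnet_MAr hM W cB tn mpB) mw; apply.
  apply: (eqv_cut oO oW cB BW tn _ ew).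
  by apply: (MAr_Mod (M := M)); exact: tnet_MAr cB tn mpB.
have [pz Hpz] := choice pieces.
pose P := fix P k : net := if k is k'.+1 then nmul (P k') (fun _ x => 1 - (pz k').1 x) else fun _ _ => 1.
pose S := fix S k : net := if k is k'.+1 then nadd (S k') (nmul (P k') (pz k').2) else fun _ _ => 0.
have mP k : MAr M setT (P k).
  elim: k => [|k IH] /=; first exact: MAr_const.
  apply: (MAr_mul hM openT IH); apply: (MAr_add hM openT); first exact: MAr_const.
  by apply: (MAr_opp hM openT); case: (Hpz k).
have mS k : MAr M setT (S k).
  elim: k => [|k IH] /=; first exact: MAr_const.
  apply: (MAr_add hM openT IH); apply: (MAr_mul hM openT (mP k)).
  by case: (Hpz k).
have eS k : eqv Omega (S k) (nmul (fun e x => 1 - P k e x) t).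
  elim: k => [|k IH] /=; first by apply: eqv_eqon => // e _ x _; rewrite subrr mul0r.
  have [_ _ ez _] := Hpz k.
  have mPk : Mod Omega (P k) by apply: (MAr_Mod (M := M)); exact: (MArS (Omega := setT)) (mP k).
  apply: (eqv_trans (v := nadd (nmul (fun e x => 1 - P k e x) t) (nmul (P k) (nmul (fun=> (pz k).1) t)))) => //.
    by apply: eqv_add => //; exact: eqv_mul.
  by apply: eqv_eqon => // e _ x _; ring.
have P0 k x e : inreg k -> `|x - (qball R n k).1| <= (qball R n k).2 -> forall j, P (k.+1 + j)%N e x = 0.
  move=> ik xk; have [_ _ _ /(_ ik x xk) p1] := Hpz k.
  elim=> [|j IH]; first by rewrite addn0 /= p1 subrr mulr0.
  rewrite addnS (_ : P _ e x = P (k.+1 + j)%N e x * (1 - (pz (k.+1 + j)%N).1 x)) //.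
  by rewrite IH mul0r.
have Sst k x e : inreg k -> `|x - (qball R n k).1| <= (qball R n k).2 -> forall j, S (k.+1 + j)%N e x = S k.+1 e x.
  move=> ik xk; elim=> [|j IH]; first by rewrite addn0.
  rewrite addnS (_ : S _ e x = S (k.+1 + j)%N e x + P (k.+1 + j)%N e x * (pz (k.+1 + j)%N).2 e x) //.
  by rewrite (P0 k x e ik xk j) mul0r addr0 IH.
have Jex x : exists k, U x -> inreg k /\ `|x - (qball R n k).1| < (qball R n k).2.
  have [[W rW Wx]|nU] := pselect (U x); last by exists 0%N.
  have [oW _ _] := rW.
  have [k] := qball_dense (open_nbhs_nbhs (conj oW Wx)).
  case E : (qball R n k) => [c r] [r0 xc cW]; exists k => _; rewrite /inreg E /=.
  split; first by split=> //; exists W.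
  by move: xc; rewrite -ball_normE /= distrC.
(* Any index of a ball containing [x] will do, by stationarity. *)
have [J HJ] := choice Jex.
pose w : net := fun e x => S (J x).+1 e x.
have wS k e x : U x -> inreg k -> `|x - (qball R n k).1| < (qball R n k).2 -> w e x = S k.+1 e x.
  move=> Ux ik xk; have [iJ xJ] := HJ x Ux.
  rewrite /w -(Sst _ x e iJ (ltW xJ) k) -(Sst _ x e ik (ltW xk) (J x)).
  by rewrite !addSn addnC.
pose Bk k := [set x : V | U x /\ `|x - (qball R n k).1| < (qball R n k).2].
have oB k : open (Bk k).
  rewrite (_ : Bk k = U `&` ball (qball R n k).1 (qball R n k).2); first by apply: openI => //; exact: ball_open.
  by apply/seteqP; split=> x; rewrite -ball_normE /= distrC.
exists w.
  apply: (MAr_loc hM) => x Ux; have [iJ xJ] := HJ x Ux; exists (Bk (J x)); split=> //.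
  apply: (MAr_eq (u := S (J x).+1)) => //; last exact: (MArS (Omega := setT)) (mS _).
  by move=> e _ y [Uy yk]; rewrite (wS _ e y Uy iJ yk).
apply: Neg_loc => x Ux; have [iJ xJ] := HJ x Ux; exists (Bk (J x)); split=> //.
have BO : Bk (J x) `<=` Omega by move=> y [/UO].
apply: Neg_eq (eqvS BO (eS (J x).+1)) => // e _ y [Uy yk].
rewrite (wS _ e y Uy iJ yk); congr (_ - _).
by have := P0 _ y e iJ (ltW yk) 0%N; rewrite addn0 => ->; rewrite subr0 mul1r.
Qed.

Lemma singsuppP Omega t : open Omega -> Mod Omega t ->
  singsuppMA Omega M (gclass Omega t) = Omega `\` \bigcup_(W in regular Omega t) W.
Proof.
move=> oO mt; rewrite /singsuppMA; congr (_ `\` _); set U := \bigcup_(W in _) W.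
have lU : is_largest (regular_open Omega M (gclass Omega t)) U.
  split; first exact/(regular_openP _ oO mt)/regular_bigcup.
  by move=> W /(regular_openP _ oO mt) rW x Wx; exists W.
have [rX lX] := xgetPex set0 (ex_intro _ U lU).
apply/seteqP; split; first exact: lU.2.
by apply: lX; case: lU.
Qed.

End Gluing.

(** * Projections and inclusions of the wave front set *)

Theorem proposition17 (R : realType) (n : nat) (Omega : set 'rV[R]_n)
    (M : nat -> R) (f : set (net R n))
    (Omega_open : open Omega) (Omega_neq0 : Omega !=set0)
    (hM : weight_sequence M) (hf : colombeau Omega f) :
  [/\ fst @` WFMA Omega M f = singsuppMA Omega M f,
      colombeau_c Omega f -> snd @` WFMA Omega M f = SigmaMA Omega M f,
      (forall alpha : {ffun 'I_n -> nat},
         WFMA Omega M (gpartial Omega alpha f) `<=` WFMA Omega M f) &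
      (forall g : set (net R n), colombeauMA Omega M g ->
         WFMA Omega M (gmul Omega g f) `<=` WFMA Omega M f)].
Proof.
have [t /(moderateP _ Omega_open) mt <-] := hf.
have WFE x xi := WF_micro hM x xi Omega_open mt.
split.
- rewrite (singsuppP hM) //; apply/seteqP; split.
    move=> _ [[x xi] /= /WFE[Ox _ nm] <-]; split=> // -[W [oW WO [w mw ew]] Wx].
    by apply: nm; exact: (micro_regular hM xi Omega_open mt oW WO Wx mw ew).
  move=> x [Ox nU].
  have [[xi [xi0 nm]]|H] := pselect (exists xi, xi != 0 /\ ~ micro M Omega t x xi).
    by exists (x, xi) => //; apply/WFE.
  case: nU; have [] := regular_near hM Omega_open mt Ox.
    by move=> xi xi0; apply: contrapT => nm; apply: H; exists xi.
  by move=> W [oW Wx WO r]; exists W.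
- move=> [_ [u /(compact_repP Omega_open)[K [cK KO tu eu]]]].
  apply/seteqP; split=> [_ [[x xi] /= /WFE[Ox xi0 nm] <-]|xi /(SigmaP hM _ Omega_open mt)[xi0 ng]].
    by apply/(SigmaP hM) => //; split=> // g; apply: nm; exact: micro_reg_dir.
  apply: contrapT => H; apply: ng.
  apply: (reg_dir_micro hM Omega_open mt cK KO tu eu) => x Kx.
  by apply: contrapT => nm; apply: H; exists (x, xi) => //; apply/WFE; split=> //; exact: KO.
- move=> a [x xi]; rewrite (gpartialE hM) // => /(WF_micro hM _ _ Omega_open (Mod_wD _ mt))[Ox xi0 nm].
  by apply/WFE; split=> // m; apply: nm; exact: micro_wD.
move=> _ [g /(moderateMAP hM _ Omega_open) mg <-] [x xi].
have mmg := MAr_Mod mg.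
rewrite (gmulE hM Omega_open mmg mt) => /(WF_micro hM _ _ Omega_open (Mod_mul Omega_open mmg mt))[Ox xi0 nm].
by apply/WFE; split=> // m; apply: nm; exact: micro_mul.
Qed.
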